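(* Assume $0<\alpha<1$ and $0<\rho<2$, and let $T>0$. Given $(u^0,u^1)\in X_{N,0}^{0}\times X_{N,0}^{-2}$, there exists $f\in L^2(0,T)$ such that the weak solution $u$ (in the sense defined in the context) of $$u_{tt}+A_N^2u+\rho\tilde A_N^{\alpha}u_t=0,\quad u_x(0,t)=u_{xxx}(0,t)=0,\quad u_x(\pi,t)=f(t),\quad u_{xxx}(\pi,t)=0,$$ $$u(x,0)=u^0(x),\quad u_t(x,0)=u^1(x)$$ on $(0,\pi)\times(0,T)$ satisfies $u(\cdot,T)=u_t(\cdot,T)=0$, and there exists a constant $C$ depending only on $\alpha,\rho,T$ such that $f$ can be chosen with $$\|f\|_{L^2(0,T)}\le C\big(\|u^0\|_{X_{N,0}^{0}}+\|u^1\|_{X_{N,0}^{-2}}\big).$$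
   Context: $A_N=-\partial_x^2$ is the Neumann Laplacian on $(0,\pi)$, with eigenvalues $n^2$, $n\ge0$, and orthonormal eigenfunctions $\varphi_0=1/\sqrt\pi$, $\varphi_n=\sqrt{2/\pi}\cos(nx)$ for $n\ge1$. For $p\in\mathbb R$, $X_{N,0}^p$ is the space of (generalized) series $v=\sum_{n\ge1}a_n\varphi_n$ (zero mean) with $\|v\|_{X_{N,0}^p}^2=\sum_{n\ge1}n^{2p}|a_n|^2<\infty$. The operators $A_N^\alpha$ act by $A_N^\alpha\sum a_n\varphi_n=\sum n^{2\alpha}a_n\varphi_n$. The symbol $\langle\cdot,\cdot\rangle$ is the duality pairing of $X_{N,0}^p$ and $X_{N,0}^{-p}$: $\langle\sum a_n\varphi_n,\sum b_n\varphi_n\rangle=\sum a_nb_n$. The extended operator is $\tilde A_N^{\alpha}v(x)=\mathrm{PV}\int_0^\pi(v(x)-v(y))J_N(x,y)\,dy$, where $J_N(x,y)=\frac{\alpha}{\Gamma(1-\alpha)}\int_0^\infty p_N(t,x,y)t^{-\alpha-1}dt$ and $p_N$ is the heat kernel of $A_N$. The initial boundary value problem is formal; its precise meaning is the following weak formulation. Adjoint solutions. For $\tau\in(0,T]$ and $w^0=\sum_{n\ge1}w_n^0\varphi_n\in X_{N,0}^2$, $w^1=\sum_{n\ge1}w_n^1\varphi_n\in X_{N,0}^0$, let $w(x,t)=\sum_{n\ge1}w_n(t)\varphi_n(x)$, $t\in[0,\tau]$, where $w_n''-\rho n^{2\alpha}w_n'+n^4w_n=0$, $w_n(\tau)=w_n^0$,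 $w_n'(\tau)=w_n^1$. The trace $w_{xx}(\pi,t)=-\sum n^2\varphi_n(\pi)w_n(t)$ is understood as a limit in $L^2(0,\tau)$ of partial sums. Weak solution: $u\in C([0,T];X_{N,0}^0)\cap C^1([0,T];X_{N,0}^{-2})$ with $u(\cdot,0)=u^0$, $u_t(\cdot,0)=u^1$, such that for every $\tau\in(0,T]$ and all $(w^0,w^1)\in X_{N,0}^2\times X_{N,0}^0$, $$0=\langle w^1-\rho A_N^\alpha w^0,u(\cdot,\tau)\rangle-\langle w^0,u_t(\cdot,\tau)\rangle-\langle w_t(\cdot,0)-\rho A_N^\alpha w(\cdot,0),u^0\rangle+\langle w(\cdot,0),u^1\rangle-\int_0^\tau w_{xx}(\pi,t)f(t)\,dt .$$ For given $u^0,u^1,f$ the weak solution is unique. *)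

(* Defs.v *)
From HB Require Import structures.
From mathcomp Require Import all_boot all_order all_algebra.
From mathcomp Require Import all_classical all_reals all_analysis.

Set Implicit Arguments.
Unset Strict Implicit.
Unset Printing Implicit Defensive.

Import Order.TTheory GRing.Theory Num.Theory.
Import numFieldNormedType.Exports.

Local Open Scope classical_set_scope.
Local Open Scope ring_scope.

(* A generalized cosine series \sum_(n >= 1) a_n phi_n is encoded by its       *)
(* coefficient sequence a : nat -> R, where a n is the coefficient of phi_n;   *)
(* having zero mean means a 0 = 0.                                             *)

Definition phiN (R : realType) (n : nat) (x : R) : R :=
  if n is 0%N then (Num.sqrt pi)^-1 else Num.sqrt (2 / pi) * cos (n%:R * x).

Definition normsqX (R : realType) (p : R) (a : nat -> R) : \bar R :=
  (\sum_(1 <= n <oo) ((n%:R `^ (2 * p)) * `|a n| ^+ 2)%:E)%E.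

Definition XN0 (R : realType) (p : R) : set (nat -> R) :=
  [set a | a 0%N = 0 /\ (normsqX p a < +oo)%E].

(* Meaningful only on XN0 p, since fine +oo = 0. *)
Definition normX (R : realType) (p : R) (a : nat -> R) : R :=
  Num.sqrt (fine (normsqX p a)).

Definition pairing (R : realType) (a b : nat -> R) : R :=
  limn (fun N => \sum_(1 <= n < N) a n * b n).

Definition ANpow (R : realType) (alpha : R) (a : nat -> R) : nat -> R :=
  fun n => n%:R `^ (2 * alpha) * a n.

(* Functions on (0, T) are total functions of which only the values on ]0, T[  *)
(* matter, and two functions equal almost everywhere are not identified.       *)
Definition L2 (R : realType) (T : R) : set (R -> R) :=
  [set f | f \_ `]0, T[ \in Lfun (@lebesgue_measure R) 2%:E].

Definition L2norm (R : realType) (T : R) (f : R -> R) : R :=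
  fine (Lnorm (@lebesgue_measure R) 2%:E (EFin \o (f \_ `]0, T[))).

Definition CX (R : realType) (p T : R) (u : R -> nat -> R) : Prop :=
  forall t : R, t \in `[0, T] ->
    XN0 p (u t) /\
    normX p (u s - u t) @[s --> within `[0, T] (nbhs t)] --> (0 : R).

(* On [0, T], u is differentiable in the norm of X^p with derivative ut; the   *)
(* derivative is one-sided at 0 and at T.                                      *)
Definition is_derivX (R : realType) (p T : R) (u ut : R -> nat -> R)
  : Prop :=
  forall t : R, t \in `[0, T] ->
    normX p ((s - t)^-1 *: (u s - u t) - ut t)
      @[s --> within `[0, T] t^'] --> (0 : R).

Definition deriv_on (R : realType) (T : R) (g g' : R -> R) : Prop :=
  forall t : R, t \in `[0, T] ->
    (s - t)^-1 * (g s - g t) @[s --> within `[0, T] t^'] --> g' t.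

Definition adjoint_solution (R : realType) (alpha rho tau : R)
    (w0 w1 : nat -> R) (w wt : R -> nat -> R) : Prop :=
  (forall t : R, t \in `[0, tau] -> w t 0%N = 0 /\ wt t 0%N = 0) /\
  forall n : nat, (0 < n)%N ->
    [/\ deriv_on tau (fun t => w t n) (fun t => wt t n),
        deriv_on tau (fun t => wt t n)
          (fun t => rho * n%:R `^ (2 * alpha) * wt t n - n%:R ^+ 4 * w t n),
        w tau n = w0 n & wt tau n = w1 n].

(* g is the trace w_xx(pi, .): the L^2(0, tau) limit of the partial sums.      *)
Definition is_trace_xx (R : realType) (tau : R) (w : R -> nat -> R)
    (g : R -> R) : Prop :=
  let S N t := - \sum_(1 <= n < N) n%:R ^+ 2 * phiN n (pi : R) * w t n in
  [/\ L2 tau g, forall N, L2 tau (S N) &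
      (fun N : nat => L2norm tau (g - S N)) @ \oo --> (0 : R)].

(* The second component ut stands for u_t; it is determined by u on [0, T].    *)
Definition weak_solution (R : realType) (alpha rho T : R) (u0 u1 : nat -> R)
    (f : R -> R) (u ut : R -> nat -> R) : Prop :=
  [/\ CX 0 T u, CX (-2) T ut /\ is_derivX (-2) T u ut, u 0 = u0, ut 0 = u1 &
   forall tau : R, 0 < tau <= T ->
   forall w0 w1 : nat -> R, XN0 2 w0 -> XN0 0 w1 ->
   forall w wt : R -> nat -> R, adjoint_solution alpha rho tau w0 w1 w wt ->
   exists2 wxx : R -> R, is_trace_xx tau w wxx &
     0 = pairing (w1 - rho *: ANpow alpha w0) (u tau)
         - pairing w0 (ut tau)
         - pairing (wt 0 - rho *: ANpow alpha (w 0)) u0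
         + pairing (w 0) u1
         - \int[@lebesgue_measure R]_(t in `]0, tau[) (wxx t * f t)].

(* Main.v *)
(* Expanding in eigenfunctions, the state vanishes at time T iff, for all n,
   the integrals over [0, T] of f e^(sg_n t) cos(om_n t) and of
   f e^(sg_n t) sin(om_n t) take values prescribed by the initial data, where
   sg_n = rho n^(2 alpha) / 2 and om_n = sqrt(n^4 - sg_n^2).  The functions
   2 e^(-sg_n t) cos(om_n t) G_n(t) and 2 e^(-sg_n t) sin(om_n t) G_n(t) form a
   biorthogonal family as soon as G_n has integral one and annihilates the
   exponentials with exponents (sg_m - sg_n) + i (om_m +- om_n), except
   sg_n - sg_n + i (om_n - om_n) = 0.  Convolving with the probability measure
   on {0, pi / w} with weights proportional to 1 and e^(- r pi / w) annihilates
   e^((r + i w) t) and increases neither sup norms nor Lipschitz constants, so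
   G_n can be an infinite convolution of such measures with a bump.  As the sum
   over m of 1 / |om_m - om_n| is O(n^(-1/2)), for large n the total shift is
   small enough for G_n to be supported in [T/2, T]; for the remaining n,
   finitely many frequencies are treated by three-point measures with
   arbitrarily small shifts.  Hence the G_n are bounded uniformly in n, and the
   factor e^(-sg_n T/2), smaller than any power of n, makes the series of f
   converge to a Lipschitz function.

   For Lipschitz f the mode coefficients of the solution are dominated by a
   fixed sequence of the right weighted l2 space.  The traces of adjoint
   solutions exist in L2 by a Bessel inequality, which is a Schur test for the
   Gram matrix of the damped exponentials based on the same gap sums.  Testing
   with single modes shows that the final state is unique. *)

Require Import Defs.
From mathcomp Require Import all_boot all_order all_algebra.
From mathcomp Require Import all_classical all_reals all_analysis.
From mathcomp Require Import measurable_realfun.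
From mathcomp Require Import ring lra zify.

Import Order.TTheory GRing.Theory Num.Theory.
Import numFieldNormedType.Exports.

Local Open Scope classical_set_scope.
Local Open Scope ring_scope.

Set Implicit Arguments.
Unset Strict Implicit.
Unset Printing Implicit Defensive.

(** * Integrals of continuous functions *)

(** The damping rates [sg n] grow like n^(2 alpha), possibly almost as fast as the frequencies. They
    are harmless because the shift [pi / w] depends only on the frequency: the real part [r] enters
    through the weight e^(- r pi / w) alone, and however unbalanced the two weights are, they still
    form a convex combination. So separation of the imaginary parts suffices, and [rho < 2] keeps
    [om n] of order n^2.

    The multipliers live on [T/2, T] because e^(-sg_n t) is uniformly small only away from 0. Since
    this decay beats the growth of the data, the moment problem needs no more than bounded moments
    and yields a Lipschitz control.

    That regularity replaces a forward estimate for square integrable controls: the control enters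
    mode n with a coefficient that is merely bounded, and cancellation over half periods gains the
    factor 1 / om_n that makes the mode coefficients square summable. The traces of adjoint
    solutions leave no smoothness to spend, hence their separate Bessel inequality.

    All functions are real, so each exponent comes with its conjugate; this is why both differences
    and sums of frequencies have to be annihilated. *)

Definition itg (R : realType) (a b : R) (f : R -> R) : R :=
  \int[@lebesgue_measure R]_(x in `[a, b]) f x.

Lemma continuous_itv_integrable (R : realType) (f : R -> R) (a b : R) :
  continuous f -> (@lebesgue_measure R).-integrable `[a, b] (EFin \o f).
Proof.
move=> cf; apply: continuous_compact_integrable; first exact: segment_compact.
exact: continuous_subspaceT.
Qed.

Lemma is_derive_continuous (R : realType) (F f : R -> R) :
  (forall x, is_derive x (1 : R) F (f x)) -> continuous F.
Proof.
by move=> dF x; apply/differentiable_continuous/derivable1_diffP; case: (dF x).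
Qed.

Lemma itg_FTC (R : realType) (F f : R -> R) (a b : R) : a <= b ->
  continuous f -> (forall x, is_derive x (1 : R) F (f x)) -> itg a b f = F b - F a.
Proof.
rewrite le_eqVlt => /predU1P[<- _ _|ab cf dF].
  by rewrite /itg set_itv1 Rintegral_set1 subrr.
have cF := is_derive_continuous dF.
rewrite /itg /Rintegral (@continuous_FTC2 _ f F) //.
- exact: continuous_subspaceT.
- split; first by move=> x _; case: (dF x).
  + by apply: cvg_at_right_filter; exact: cF.
  + by apply: cvg_at_left_filter; exact: cF.
- by move=> x _; rewrite derive1E; exact: derive_val.
Qed.

Lemma derive0_cst_right (R : realType) (D : R -> R) (a x y : R) :
  (forall z, a < z -> is_derive z (1 : R) D 0) -> a < x -> a < y -> D x = D y.
Proof.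
move=> dD; wlog xy : x y / x <= y.
  move=> H ax ay; case: (leP x y) => [xy|/ltW yx]; first exact: H.
  by symmetry; apply: H.
move=> ax ay; move: xy; rewrite le_eqVlt => /predU1P[->//|xy].
have [||c _] := @MVT R D (fun=> 0) x y xy.
- by move=> z; rewrite in_itv/= => /andP[/(lt_trans ax) az _]; exact: dD.
- apply: derivable_within_continuous => z; rewrite in_itv/= => /andP[xz _].
  by case: (dD z (lt_le_trans ax xz)).
by rewrite mul0r => /eqP; rewrite subr_eq0 => /eqP.
Qed.

Lemma is_derive_itg (R : realType) (f : R -> R) (a x : R) :
  continuous f -> a < x -> is_derive x (1 : R) (fun y => itg a y f) (f x).
Proof.
move=> cf ax.
have [||||d e] := @continuous_FTC1_closed R f a x (x + 1); rewrite ?ltrDl//.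
- exact: continuous_itv_integrable.
- exact: cf.
- by apply: DeriveDef => //; rewrite -derive1E.
Qed.

(** An integral from [- A] is differentiated only to the right of [- A]. The primitives from
    different base points, normalized to vanish at 0, agree where they overlap and are glued by
    letting the base point move with [x]. *)
Lemma antiderivative_ex (R : realType) (f : R -> R) : continuous f ->
  exists F : R -> R, forall x, is_derive x (1 : R) F (f x).
Proof.
move=> cf.
pose P A x := itg (- A) x f - itg (- A) 0 f.
have dP (A x : R) : - A < x -> is_derive x (1 : R) (P A) (f x).
  move=> Ax; rewrite -[f x]subr0; apply: is_deriveB; exact: is_derive_itg.
have PE (A B x : R) : 0 < A -> A <= B -> - A < x -> P A x = P B x.
  move=> A0 AB Ax.
  have := @derive0_cst_right R (fun y => P A y - P B y) (- A) x 0.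
  have P0 C : P C 0 = 0 by rewrite /P subrr.
  rewrite /= !P0 subrr => H; apply/eqP; rewrite -subr_eq0; apply/eqP.
  apply: H => //; last by rewrite oppr_lt0.
  move=> z Az; rewrite -(subrr (f z)); apply: is_deriveB; apply: dP => //.
  by rewrite (le_lt_trans _ Az)// lerN2.
exists (fun x => P (`|x| + 1) x) => x.
have h (y : R) : - (`|y| + 1) < y.
  rewrite ltrNl (le_lt_trans (ler_norm _))// normrN; lra.
(* Near [x] the moving base point may be frozen at [- (|x| + 2)], because [|y| + 1 <= |x| + 2]
   there. *)
apply: (@near_eq_is_derive R R R (P (`|x| + 2))).
- near=> y; symmetry.
  apply: PE => //; rewrite -[2]/(1 + 1) addrA lerD2r.
  near: y; exists 1 => //= y /= xy.
  have := ler_normD (y - x) x; rewrite subrK distrC; lra.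
- by apply: dP; have := h x; lra.
Unshelve. all: by end_near. Qed.

Lemma itg_antiderivative (R : realType) (f : R -> R) : continuous f ->
  exists2 F : R -> R, (forall x, is_derive x (1 : R) F (f x)) &
    forall a b, a <= b -> itg a b f = F b - F a.
Proof.
move=> cf; have [F dF] := antiderivative_ex cf.
by exists F => // a b ab; exact: itg_FTC.
Qed.

Section continuity.
Context {R : realType}.
Implicit Types f g : R -> R.

Lemma contD f g : continuous f -> continuous g ->
  continuous (fun x => f x + g x).
Proof. by move=> cf cg x; apply: continuousD; [exact: cf|exact: cg]. Qed.

Lemma contM f g : continuous f -> continuous g ->
  continuous (fun x => f x * g x).
Proof. by move=> cf cg x; apply: continuousM; [exact: cf|exact: cg]. Qed.

Lemma contB f g : continuous f -> continuous g ->
  continuous (fun x => f x - g x).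
Proof. by move=> cf cg x; apply: continuousB; [exact: cf|exact: cg]. Qed.

Lemma contN f : continuous f -> continuous (fun x => - f x).
Proof. by move=> cf x; apply: continuousN; exact: cf. Qed.

Lemma cont_cst (c : R) : continuous (fun _ : R => c).
Proof. by move=> x; exact: cvg_cst. Qed.

Lemma contZ (c : R) f : continuous f -> continuous (fun x => c * f x).
Proof. by move=> cf; apply: contM => //; exact: cont_cst. Qed.

Lemma cont_sum (I : Type) (r : seq I) (P : pred I) (f : I -> R -> R) :
  (forall i, continuous (f i)) -> continuous (fun x => \sum_(i <- r | P i) f i x).
Proof.
move=> cf; elim: r => [|i r IHr].
  by rewrite (_ : (fun _ => _) = fun=> 0)//; [exact: cont_cst|];
     apply/funext => x; rewrite big_nil.
case Pi : (P i).
  rewrite (_ : (fun _ => _) = fun x => f i x + \sum_(j <- r | P j) f j x).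
    exact: contD.
  by apply/funext => x; rewrite big_cons Pi.
rewrite (_ : (fun _ => _) = fun x => \sum_(j <- r | P j) f j x)//.
by apply/funext => x; rewrite big_cons Pi.
Qed.

Lemma cont_shift f (c : R) : continuous f -> continuous (fun x => f (x + c)).
Proof.
move=> cf x; apply: (@continuous_comp _ _ _ (fun x => x + c) f); last exact: cf.
by apply: continuousD; [exact: cvg_id|exact: cvg_cst].
Qed.

End continuity.

Section itg_theory.
Context {R : realType}.
Implicit Types (f g : R -> R) (a b c k : R).

Lemma eq_itg a b f g : {in `[a, b], f =1 g} -> itg a b f = itg a b g.
Proof.
by move=> fg; apply: eq_Rintegral => x; rewrite inE => xab; exact: fg.
Qed.

Lemma itgD a b f g : continuous f -> continuous g ->
  itg a b (fun x => f x + g x) = itg a b f + itg a b g.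
Proof.
by move=> cf cg; apply: RintegralD => //; exact: continuous_itv_integrable.
Qed.

Lemma itgB a b f g : continuous f -> continuous g ->
  itg a b (fun x => f x - g x) = itg a b f - itg a b g.
Proof.
by move=> cf cg; apply: RintegralB => //; exact: continuous_itv_integrable.
Qed.

Lemma itgZ a b k f : continuous f -> itg a b (fun x => k * f x) = k * itg a b f.
Proof.
by move=> cf; apply: RintegralZl => //; exact: continuous_itv_integrable.
Qed.

Lemma itg_cst0 a b : itg a b (fun=> 0) = 0.
Proof. by rewrite /itg Rintegral_cst// mul0r. Qed.

Lemma itg_sum a b (I : Type) (r : seq I) (f : I -> R -> R) :
  (forall i, continuous (f i)) ->
  itg a b (fun x => \sum_(i <- r) f i x) = \sum_(i <- r) itg a b (f i).
Proof.
move=> cf; elim: r => [|i r IHr].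
  rewrite big_nil -[RHS](itg_cst0 a b); apply: eq_itg => x _.
  by rewrite big_nil.
rewrite big_cons -IHr -itgD//; last exact: cont_sum.
by apply: eq_itg => x _; rewrite big_cons.
Qed.

Lemma itg_chasles a b c f : continuous f -> a <= b -> b <= c ->
  itg a c f = itg a b f + itg b c f.
Proof.
move=> cf ab bc; have [F dF FE] := itg_antiderivative cf.
by rewrite !FE//; [ring|exact: le_trans bc].
Qed.

Lemma itg_shift a b c f : continuous f -> a <= b ->
  itg a b (fun x => f (x + c)) = itg (a + c) (b + c) f.
Proof.
move=> cf ab; have [F dF FE] := itg_antiderivative cf.
rewrite FE ?lerD2r//; apply: (@itg_FTC R (fun x => F (x + c))) => //.
  exact: cont_shift.
move=> x; rewrite -[f (x + c)]mulr1.
exact: (@is_derive1_comp R F (shift c) x _ 1 (dF _) (is_derive_shift _ _ _)).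
Qed.

Lemma itg_ge0 a b f : {in `[a, b], forall x, 0 <= f x} -> 0 <= itg a b f.
Proof. by move=> f0; apply: Rintegral_ge0 => x xab; exact: f0. Qed.

Lemma le_itg a b f g : continuous f -> continuous g ->
  {in `[a, b], forall x, f x <= g x} -> itg a b f <= itg a b g.
Proof.
by move=> cf cg fg; apply: le_Rintegral => //; exact: continuous_itv_integrable.
Qed.

Lemma itg_cst a b k : a <= b -> itg a b (fun=> k) = k * (b - a).
Proof.
move=> ab; rewrite mulrBr; apply: (@itg_FTC R (fun x => k * x)) => //.
- exact: cont_cst.
- by move=> x; apply: is_derive_eq; rewrite /GRing.scale/= mulr1.
Qed.

Lemma itg_norm_le a b k f : continuous f -> a <= b ->
  {in `[a, b], forall x, `|f x| <= k} -> `|itg a b f| <= k * (b - a).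
Proof.
move=> cf ab fk; rewrite -itg_cst//.
have h : {in `[a, b], forall x, - k <= f x <= k}.
  by move=> x xab; rewrite -ler_norml; exact: fk.
rewrite ler_norml; apply/andP; split; last first.
  by apply: le_itg => //; [exact: cont_cst|move=> x /h/andP[]].
rewrite -[- itg _ _ _]mulN1r -itgZ; last exact: cont_cst.
apply: le_itg => //; first exact/contZ/cont_cst.
by move=> x /h; rewrite mulN1r => /andP[].
Qed.

End itg_theory.

(** * Real and imaginary parts of complex exponentials *)

Section damped_oscillations.
Context {R : realType}.
Implicit Types r w t a : R.

(* Real and imaginary parts of [exp ((r + i w) t)]. *)
Definition ecos r w t := expR (r * t) * cos (w * t).
Definition esin r w t := expR (r * t) * sin (w * t).

Lemma is_derive_linear (k x : R) : is_derive x (1 : R) (fun y => k * y) k.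
Proof. by apply: is_derive_eq; rewrite /GRing.scale/= mulr1. Qed.

Lemma is_derive_expRM r t :
  is_derive t (1 : R) (fun y => expR (r * y)) (r * expR (r * t)).
Proof.
rewrite mulrC.
exact: (@is_derive1_comp R expR (fun y => r * y) t _ r (is_derive_expR _) (is_derive_linear _ _)).
Qed.

Lemma is_derive_cosM r t :
  is_derive t (1 : R) (fun y => cos (r * y)) (- (r * sin (r * t))).
Proof.
rewrite mulrC -mulNr.
exact: (@is_derive1_comp R (@cos R) (fun y => r * y) t _ r (is_derive_cos _) (is_derive_linear _ _)).
Qed.

Lemma is_derive_sinM r t :
  is_derive t (1 : R) (fun y => sin (r * y)) (r * cos (r * t)).
Proof.
rewrite mulrC.
exact: (@is_derive1_comp R (@sin R) (fun y => r * y) t _ r (is_derive_sin _) (is_derive_linear _ _)).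
Qed.

Lemma is_derive_mul (f g : R -> R) (x df dg : R) :
  is_derive x (1 : R) f df -> is_derive x (1 : R) g dg ->
  is_derive x (1 : R) (fun y => f y * g y) (df * g x + f x * dg).
Proof.
move=> Df Dg; have := @is_deriveM R R f g x 1 df dg Df Dg.
rewrite /GRing.scale/= => H; apply: is_derive_eq; rewrite /GRing.scale/=.
by rewrite addrC [df * _]mulrC.
Qed.

Lemma is_derive_ecos r w t :
  is_derive t (1 : R) (ecos r w) (r * ecos r w t - w * esin r w t).
Proof.
have := is_derive_mul (is_derive_expRM r t) (is_derive_cosM w t).
by congr (is_derive _ _ _ _); rewrite /ecos /esin; ring.
Qed.

Lemma is_derive_esin r w t :
  is_derive t (1 : R) (esin r w) (r * esin r w t + w * ecos r w t).
Proof.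
have := is_derive_mul (is_derive_expRM r t) (is_derive_sinM w t).
by congr (is_derive _ _ _ _); rewrite /ecos /esin; ring.
Qed.

Lemma cont_ecos r w : continuous (ecos r w).
Proof. exact: is_derive_continuous (is_derive_ecos r w). Qed.

Lemma cont_esin r w : continuous (esin r w).
Proof. exact: is_derive_continuous (is_derive_esin r w). Qed.

Lemma ecosD r w t a : ecos r w (t + a) =
  ecos r w a * ecos r w t - esin r w a * esin r w t.
Proof. rewrite /ecos /esin !mulrDr expRD cosD; ring. Qed.

Lemma esinD r w t a : esin r w (t + a) =
  ecos r w a * esin r w t + esin r w a * ecos r w t.
Proof. rewrite /ecos /esin !mulrDr expRD sinD; ring. Qed.

Lemma ecosM r w r' w' t : 2 * (ecos r w t * ecos r' w' t) =
  ecos (r + r') (w - w') t + ecos (r + r') (w + w') t.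
Proof. rewrite /ecos !mulrDl mulNr expRD cosB cosD; ring. Qed.

Lemma esinM r w r' w' t : 2 * (esin r w t * esin r' w' t) =
  ecos (r + r') (w - w') t - ecos (r + r') (w + w') t.
Proof. rewrite /ecos /esin !mulrDl mulNr expRD cosB cosD; ring. Qed.

Lemma esincosM r w r' w' t : 2 * (esin r w t * ecos r' w' t) =
  esin (r + r') (w - w') t + esin (r + r') (w + w') t.
Proof. rewrite /ecos /esin !mulrDl mulNr expRD sinB sinD; ring. Qed.

Lemma norm_ecos_le r w t : `|ecos r w t| <= expR (r * t).
Proof.
rewrite /ecos normrM ger0_norm ?expR_ge0// ler_piMr ?expR_ge0//.
by rewrite ler_norml cos_geN1 cos_le1.
Qed.

Lemma norm_esin_le r w t : `|esin r w t| <= expR (r * t).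
Proof.
rewrite /esin normrM ger0_norm ?expR_ge0// ler_piMr ?expR_ge0//.
by rewrite ler_norml sin_geN1 sin_le1.
Qed.

Lemma ecos0 r w : ecos r w 0 = 1.
Proof. by rewrite /ecos !mulr0 expR0 cos0 mulr1. Qed.

Lemma esin0 r w : esin r w 0 = 0.
Proof. by rewrite /esin !mulr0 sin0 mulr0. Qed.

End damped_oscillations.

(** * Spectral gaps *)

Section inverse_gap_series.
Context {R : realType}.

(** This is k^(-3/2), with the value 1 at 0 so that the diagonal [m = n] obeys the same gap
    bound. *)
Definition inv32 (k : nat) : R :=
  if k is 0 then 1 else (k%:R * Num.sqrt k%:R)^-1.

Arguments inv32 : simpl never.

Lemma inv32_gt0 k : 0 < inv32 k.
Proof.
by rewrite /inv32; case: k => [|k]//; rewrite invr_gt0 mulr_gt0// ?sqrtr_gt0 ltr0n.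
Qed.

(** With s = sqrt k and t = sqrt (k + 1) the difference on the right is 1 / (s t (s + t)), and t^2 =
    s^2 + 1 <= 2 s^2 compares it with s^(-3). *)
Lemma inv32_telescope k : (0 < k)%N ->
  inv32 k <= 4 * ((Num.sqrt k%:R)^-1 - (Num.sqrt k.+1%:R)^-1).
Proof.
case: k => // k _; rewrite /inv32.
set s := Num.sqrt k.+1%:R; set t := Num.sqrt k.+2%:R.
have s0 : 0 < s by rewrite sqrtr_gt0 ltr0n.
have t0 : 0 < t by rewrite sqrtr_gt0 ltr0n.
have s2 : k.+1%:R = s ^+ 2 by rewrite sqr_sqrtr.
have t2 : t ^+ 2 = s ^+ 2 + 1 by rewrite -s2 sqr_sqrtr// -natr1.
have s1 : 1 <= s ^+ 2 by rewrite -s2 ler1n.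
have st : s <= t by rewrite ler_sqrt ?ltr0n// ler_nat.
have u : (t - s) * (t + s) = 1 by rewrite -subr_sqr t2; ring.
rewrite s2 (_ : s^-1 - t^-1 = (s * t * (t + s))^-1); last first.
  rewrite -[LHS](mulr1) -[in LHS](divff (lt0r_neq0 (addr_gt0 t0 s0))).
  apply/eqP; rewrite -subr_eq0; apply/eqP.
  transitivity (((t - s) * (t + s) - 1) / (s * t * (t + s))).
    by field; rewrite !lt0r_neq0// addr_gt0.
  by rewrite u subrr mul0r.
have st0 : 0 < s * t * (t + s) by rewrite !mulr_gt0// addr_gt0.
rewrite ler_pdivlMr// mulrC ler_pdivrMr ?mulr_gt0 ?exprn_gt0//.
rewrite (_ : 4 * _ = s * (4 * s ^+ 2)); last by ring.
rewrite -[s * t * _]mulrA ler_pM2l//; nra.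
Qed.

Lemma sum_inv32_le N : \sum_(0 <= k < N) inv32 k <= 5.
Proof.
(* The strengthened bound starts with the equality [1 = 5 - 4]: the 1 is the term at 0, the 4 the
   telescoped rest. *)
suff H M : \sum_(0 <= k < M.+1) inv32 k <= 5 - 4 * (Num.sqrt M.+1%:R)^-1.
  case: N => [|N]; first by rewrite big_nil.
  have : 0 <= (Num.sqrt N.+1%:R)^-1 :> R by rewrite invr_ge0 sqrtr_ge0.
  by have := H N; lra.
elim: M => [|M IH]; first by rewrite big_nat1 /inv32 sqrtr1 invr1; lra.
rewrite big_nat_recr//; apply: le_trans (lerD IH (inv32_telescope _)) _ => //.
by rewrite mulrBr addrA subrK.
Qed.

Lemma sum_inv32_dist_le (n N : nat) :
  \sum_(0 <= m < N) inv32 `|m - n|%N <= 10.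
Proof.
apply: (@le_trans _ _ (\sum_(0 <= m < n + N) inv32 `|m - n|%N)).
  rewrite [leRHS](@big_cat_nat _ _ _ N)//= ?leq_addl// lerDl.
  by apply: sumr_ge0 => m _; exact/ltW/inv32_gt0.
rewrite (@big_cat_nat _ _ _ n)//= ?leq_addr// (_ : 10 = 5 + 5); last by ring.
apply: lerD.
  rewrite big_nat_rev/= add0n.
  apply: le_trans (sum_inv32_le n.+1); rewrite big_nat_recl//=.
  apply: ler_wpDl => //; rewrite le_eqVlt; apply/orP; left; apply/eqP.
  by apply: eq_big_nat => k /andP[_ kn]; congr (inv32 _); lia.
rewrite -{1}[n]add0n big_addn addKn.
apply: le_trans (sum_inv32_le N); rewrite le_eqVlt; apply/orP; left; apply/eqP.
by apply: eq_big_nat => k _; congr (inv32 _); lia.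
Qed.

End inverse_gap_series.

Section spectrum.
Context {R : realType} (alpha rho : R).
Hypotheses (halpha : 0 < alpha < 1) (hrho : 0 < rho < 2).

Definition sg (n : nat) : R := rho / 2 * n%:R `^ (2 * alpha).
Definition om (n : nat) : R := Num.sqrt (n%:R ^+ 4 - sg n ^+ 2).
(** A lower bound for (om n / n^2)^2, because [sg n <= rho / 2 * n^2]; as [c0 <= 1], it bounds
    [om n / n^2] from below as well. *)
Let c0 : R := 1 - rho ^+ 2 / 4.

Lemma gapconst_gt0 : 0 < c0.
Proof. by case/andP: hrho => r0 r2; rewrite /c0; nra. Qed.
Lemma gapconst_le1 : c0 <= 1.
Proof. by rewrite /c0 lerBlDr lerDl divr_ge0 ?sqr_ge0. Qed.

Lemma natpow_le (n : nat) : (0 < n)%N -> n%:R `^ (2 * alpha) <= n%:R ^+ 2 :> R.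
Proof.
move=> n0; rewrite -powR_mulrn// ler_powR ?ler1n//.
by case/andP: halpha; lra.
Qed.

Lemma sg_ge0 n : 0 <= sg n.
Proof. by rewrite mulr_ge0 ?powR_ge0//; case/andP: hrho; lra. Qed.

Lemma sg_le n : (0 < n)%N -> sg n <= n%:R ^+ 2.
Proof.
move=> n0; apply: le_trans (natpow_le n0); rewrite /sg ler_piMl ?powR_ge0//.
by case/andP: hrho; lra.
Qed.

Let om2_ge n : (0 < n)%N -> c0 * n%:R ^+ 4 <= n%:R ^+ 4 - sg n ^+ 2.
Proof.
move=> n0; have h := natpow_le n0; have h0 := powR_ge0 (n%:R : R) (2 * alpha).
rewrite /c0 /sg mulrBl mul1r lerD2l lerN2 exprMn.
rewrite (_ : (rho / 2) ^+ 2 = rho ^+ 2 / 4); last by field.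
rewrite ler_wpM2l//; first by rewrite divr_ge0// exprn_ge0//; case/andP: hrho; lra.
by rewrite -[4%N]/(2 * 2)%N exprM lerXn2r// nnegrE// exprn_ge0.
Qed.

Lemma om_sqr n : (0 < n)%N -> om n ^+ 2 = n%:R ^+ 4 - sg n ^+ 2.
Proof.
move=> n0; rewrite sqr_sqrtr//; apply: le_trans (om2_ge n0).
by rewrite mulr_ge0// ?exprn_ge0// ltW// gapconst_gt0.
Qed.

Lemma om_ge n : (0 < n)%N -> c0 * n%:R ^+ 2 <= om n.
Proof.
move=> n0; rewrite -(@ler_pXn2r _ 2)//; last 2 first.
- by rewrite nnegrE mulr_ge0// ltW// gapconst_gt0.
- by rewrite nnegrE sqrtr_ge0.
rewrite om_sqr//; apply: le_trans (om2_ge n0).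
rewrite exprMn -exprM ler_wpM2r ?exprn_ge0// expr2 ler_piMl ?gapconst_le1//.
by rewrite ltW// gapconst_gt0.
Qed.

Lemma om_gt0 n : (0 < n)%N -> 0 < om n.
Proof.
move=> n0; apply: lt_le_trans (om_ge n0).
by rewrite mulr_gt0 ?gapconst_gt0// exprn_gt0// ltr0n.
Qed.

Lemma om_le n : (0 < n)%N -> om n <= n%:R ^+ 2.
Proof.
move=> n0; rewrite -(@ler_pXn2r _ 2)//; last 2 first.
- by rewrite nnegrE sqrtr_ge0.
- by rewrite nnegrE.
by rewrite om_sqr// -exprM lerBlDr lerDl sqr_ge0.
Qed.

(* Since [om n ^ 2 = n^4 - rho^2 / 4 * n^(4 alpha)], it suffices that          *)
(* [x^4 - x^(4 alpha)] is nondecreasing on [1, +oo).                          *)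
Lemma om_gap n m : (0 < n)%N -> (n <= m)%N ->
  c0 * (m%:R ^+ 2 - n%:R ^+ 2) <= om m - om n.
Proof.
move=> n0 nm; have m0 : (0 < m)%N by exact: leq_trans nm.
have hn := om_gt0 n0; have hm := om_gt0 m0.
have key : c0 * (m%:R ^+ 4 - n%:R ^+ 4) <= om m ^+ 2 - om n ^+ 2.
  have sq (x : R) : (rho / 2 * x) ^+ 2 = rho ^+ 2 / 4 * x ^+ 2 by field.
  rewrite !om_sqr// /sg !sq.
  set X := (m%:R `^ (2 * alpha)) ^+ 2; set Y := (n%:R `^ (2 * alpha)) ^+ 2.
  have q0 : 0 <= rho ^+ 2 / 4 by rewrite divr_ge0// exprn_ge0//; case/andP: hrho; lra.
  suff : X - Y <= m%:R ^+ 4 - n%:R ^+ 4.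
    move=> H; have {H} := ler_wpM2l q0 H; rewrite /c0.
    move: (m%:R ^+ 4) (n%:R ^+ 4) X Y (rho ^+ 2 / 4) {q0} => a b x y q.
    by lra.
  (* In k^4 = k^(4 alpha) k^(4 - 4 alpha) the last factor is at least 1 and nondecreasing, so the
     increment of k^4 dominates that of k^(4 alpha). *)
  have E (k : nat) : (0 < k)%N -> k%:R ^+ 4 =
      (k%:R `^ (2 * alpha)) ^+ 2 * k%:R `^ (4 - 4 * alpha) :> R.
    move=> k0; rewrite -powR_mulrn// -[in RHS]powR_mulrn ?powR_ge0// -powRrM -powRD.
      by congr (_ `^ _); ring.
    by rewrite pnatr_eq0 -lt0n k0 implybT.
  rewrite !E// -/X -/Y.
  have a1 : 1 <= n%:R `^ (4 - 4 * alpha) :> R.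
    rewrite -{1}(powRr0 (n%:R : R)) ler_powR ?ler1n//; case/andP: halpha; lra.
  have a2 : n%:R `^ (4 - 4 * alpha) <= m%:R `^ (4 - 4 * alpha) :> R.
    rewrite ge0_ler_powR ?nnegrE ?ler_nat//; case/andP: halpha; lra.
  have XY : Y <= X.
    rewrite lerXn2r ?nnegrE ?powR_ge0// ge0_ler_powR ?nnegrE ?ler_nat//.
    by case/andP: halpha; lra.
  have Y0 : 0 <= Y by rewrite exprn_ge0// powR_ge0.
  nra.
have := om_le n0; have := om_le m0; have c := gapconst_gt0.
have mn : n%:R <= m%:R :> R by rewrite ler_nat.
have mn2 : (n%:R : R) ^+ 2 <= m%:R ^+ 2 by rewrite lerXn2r ?nnegrE.
move: key; rewrite -[4%N]/(2 * 2)%N !exprM.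
set a := m%:R ^+ 2 in mn2 *; set b := n%:R ^+ 2 in mn2 *.
move=> key ha hb.
have d0 : 0 < om m + om n by rewrite addr_gt0.
(* The difference of squares is divided by [om m + om n], which is at most m^2 + n^2. *)
rewrite -(ler_pM2r d0) -subr_sqr.
apply: le_trans key; rewrite (subr_sqr a) mulrA ler_wpM2l//.
  by apply: mulr_ge0; [exact: ltW|rewrite subr_ge0].
exact: lerD.
Qed.

(* On the diagonal: the distance between [om n] and [- om n]. *)
Definition gap (n m : nat) : R := if m == n then 2 * om n else `|om m - om n|.

(** For k = |m - n| > 0 one has |m^2 - n^2| = k (m + n), and (m + n)^2 >= k n turns this into
    k^(3/2) sqrt n. The loss against the exact gap is harmless: the bound is summable in k and keeps
    a factor that grows with n. *)
Lemma gap_ge n m : (0 < n)%N -> (0 < m)%N ->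
  c0 * Num.sqrt n%:R / inv32 `|m - n|%N <= gap n m.
Proof.
move=> n0 m0; rewrite /gap.
have c := gapconst_gt0.
have sq1 : 1 <= Num.sqrt n%:R :> R by rewrite -{1}sqrtr1 ler_sqrt ?ltr0n// ler1n.
have sqE : n%:R = Num.sqrt n%:R ^+ 2 :> R by rewrite sqr_sqrtr.
have [->|mn] := eqVneq m n.
  rewrite distnn /inv32 divr1.
  apply: le_trans (_ : c0 * n%:R ^+ 2 <= _).
    rewrite ler_wpM2l ?(ltW c)//; move: (Num.sqrt n%:R) sq1 sqE => s s1 ->.
    by rewrite -exprM ler_eXnr.
  apply: le_trans (om_ge n0) _.
  by rewrite ler_peMl// ?ler1n// ltW// om_gt0.
have main (a b : nat) : (0 < a)%N -> (a < b)%N -> (n <= a + b)%N ->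
    c0 * Num.sqrt n%:R / inv32 `|b - a|%N <= `|om b - om a|.
  move=> a0 ab nab; rewrite (le_trans _ (ler_norm _))//.
  apply: le_trans (om_gap a0 (ltnW ab)); rewrite -mulrA ler_wpM2l ?(ltW c)//.
  have [k kE] : exists k, `|b - a|%N = k.+1 by exists (b - a).-1; lia.
  rewrite kE /inv32 invrK.
  have -> : b%:R ^+ 2 - a%:R ^+ 2 = k.+1%:R * (a + b)%:R :> R.
    have -> : k.+1 = (b - a)%N by lia.
    rewrite natrD natrB; last exact: ltnW.
    ring.
  rewrite mulrCA ler_wpM2l// -sqrtrM//.
  rewrite -[leRHS](@ger0_norm R)// -[leRHS]sqrtr_sqr ler_wsqrtr//.
  rewrite -natrM -natrX ler_nat -mulnn leq_mul//; lia.
have [nm|nm] : (n < m)%N \/ (m < n)%N by lia.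
  by apply: main => //; lia.
by rewrite distrC distnC; apply: main => //; lia.
Qed.

Lemma gap_gt0 n m : (0 < n)%N -> (0 < m)%N -> 0 < gap n m.
Proof.
move=> n0 m0; apply: lt_le_trans (gap_ge n0 m0).
by rewrite divr_gt0 ?inv32_gt0// mulr_gt0 ?gapconst_gt0// sqrtr_gt0 ltr0n.
Qed.

(** Through this the sum frequencies inherit every estimate proved for the difference
    frequencies. *)
Lemma gap_le n m : (0 < n)%N -> (0 < m)%N -> gap n m <= om n + om m.
Proof.
move=> n0 m0; rewrite /gap; have := om_gt0 n0; have := om_gt0 m0.
case: eqVneq => [->|_] a b; first lra.
by rewrite ler_norml; apply/andP; split; lra.
Qed.

Lemma gap_sum n N : (0 < n)%N ->
  \sum_(1 <= m < N) (gap n m)^-1 <= 10 / c0 / Num.sqrt n%:R.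
Proof.
move=> n0; have c := gapconst_gt0.
have sq0 : 0 < Num.sqrt n%:R :> R by rewrite sqrtr_gt0 ltr0n.
apply: (@le_trans _ _ (\sum_(1 <= m < N) (c0 * Num.sqrt n%:R)^-1 * inv32 `|m - n|%N)).
  rewrite big_nat [leRHS]big_nat; apply: ler_sum => m /andP[m0 _].
  rewrite -[inv32 _]invrK -invfM lef_pV2 ?posrE ?gap_gt0 ?gap_ge//.
  by rewrite mulr_gt0 ?invr_gt0 ?inv32_gt0// mulr_gt0.
rewrite -mulr_sumr -[leRHS]mulrA -invfM mulrC ler_wpM2r//.
  by rewrite invr_ge0 ltW// mulr_gt0.
apply: le_trans (sum_inv32_dist_le n N).
case: N => [|N]; first by rewrite !big_geq.
rewrite [leRHS]big_nat_recl// big_add1 /= lerDr; exact/ltW/inv32_gt0.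
Qed.

End spectrum.

(** * Uniform limits of telescoping sequences *)

Section uniform_limits.
Context {R : realType}.

Lemma le0_of_le_eps (x : R) (e : nat -> R) : e @ \oo --> (0 : R) ->
  (\forall n \near \oo, x <= e n) -> x <= 0.
Proof.
move=> e0 xe; rewrite -(cvg_lim _ e0)//; apply: limr_ge => //.
by apply/cvg_ex; exists 0.
Qed.

(** The Weierstrass test, with the majorant given by its partial sums [A] and the error by
    [limn A - A N]. It serves for infinite convolutions, for the series of the control and, with [I]
    a singleton, for the trace at a fixed time. *)
Lemma dominated_telescope_lim (I : Type) (F : nat -> I -> R) (A : nat -> R)
    (K : R) :
  (forall N, A N <= K) -> (forall N, A N <= A N.+1) ->
  (forall N t, `|F N.+1 t - F N t| <= A N.+1 - A N) ->
  exists G : I -> R, exists e : nat -> R, [/\ e @ \oo --> (0 : R),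
    forall N t, `|G t - F N t| <= e N & forall t, F N t @[N --> \oo] --> G t].
Proof.
move=> AK ndA FA.
have FAM N k t : `|F (N + k)%N t - F N t| <= A (N + k)%N - A N.
  elim: k => [|k IH]; first by rewrite addn0 !subrr normr0.
  rewrite addnS -(subrK (F (N + k)%N t) (F _.+1 t)) -addrA.
  rewrite (le_trans (ler_normD _ _))// -(subrK (A (N + k)%N) (A _.+1)) -addrA.
  exact: lerD.
have cA : cvgn A.
  apply: nondecreasing_is_cvgn; first exact/nondecreasing_seqP.
  by exists K => _ [N _ <-].
have cF t : cvgn (fun N => F N t).
  have h : cvgn (series (telescope (fun N => F N t))).
    apply: normed_cvg; apply: nondecreasing_is_cvgn.
      apply/nondecreasing_seqP => N; rewrite /series [leRHS]big_nat_recr//=.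
      by rewrite lerDl.
    exists (K - A 0%N) => _ [N _ <-].
    apply: (@le_trans _ _ (A N - A 0%N)); last by rewrite lerB.
    change (\sum_(0 <= k < N) `|F k.+1 t - F k t| <= A N - A 0%N).
    by rewrite -(telescope_sumr A)//; apply: ler_sum => k _; exact: FA.
  rewrite [X in cvgn X](_ : _ =
    (fun=> F 0%N t) + series (telescope (fun N => F N t))).
    apply: is_cvgD => //; apply/cvg_ex; exists (F 0%N t); exact: cvg_cst.
  by apply/funext => N /=; rewrite (eq_sum_telescope (fun N => F N t)).
exists (fun t => limn (fun N => F N t)), (fun N => limn A - A N).
split=> //.
  by rewrite -(subrr (limn A)); apply: cvgB => //; exact: cvg_cst.
move=> N t; have hF : `|F M t - F N t| @[M --> \oo] -->
    `|limn (fun N => F N t) - F N t|.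
  by apply: cvg_norm; apply: cvgB; [exact: cF|exact: cvg_cst].
have hA : A M - A N @[M --> \oo] --> limn A - A N.
  by apply: cvgB => //; exact: cvg_cst.
apply: ler_cvg_to hF hA _; near=> M.
have NM : (N <= M)%N by near: M; exact: nbhs_infty_ge.
by rewrite -(subnKC NM).
Unshelve. all: by end_near. Qed.

Lemma itg_norm_le_norm (a b : R) (f : R -> R) : continuous f ->
  `|itg a b f| <= itg a b (fun x => `|f x|).
Proof.
by move=> cf; apply: le_normr_Rintegral => //; exact: continuous_itv_integrable.
Qed.

Lemma cont_norm (f : R -> R) : continuous f -> continuous (fun x => `|f x|).
Proof. by move=> cf x; apply: cvg_norm; exact: cf. Qed.

Lemma itg_unif_lim (a b c : R) (f : nat -> R -> R) (G g : R -> R)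
    (e : nat -> R) :
  (forall N, continuous (f N)) -> continuous G -> continuous g ->
  e @ \oo --> (0 : R) -> (forall N t, `|G t - f N t| <= e N) ->
  (\forall N \near \oo, itg a b (fun t => f N t * g t) = c) ->
  itg a b (fun t => G t * g t) = c.
Proof.
move=> cf cG cg e0 Ge fc; apply/eqP; rewrite -subr_eq0 -normr_le0.
have h : e N * itg a b (fun t => `|g t|) @[N --> \oo] --> (0 : R).
  by rewrite -(mul0r (itg a b (fun t => `|g t|))); apply: cvgMl.
apply: le0_of_le_eps h _; near=> N.
have <- : itg a b (fun t => f N t * g t) = c by near: N.
rewrite -itgB; [|exact: contM|exact: contM].
apply: le_trans (itg_norm_le_norm _ _ _) _; first by apply: contB; exact: contM.
have cng := cont_norm cg; rewrite -itgZ//; apply: le_itg.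
- by apply: cont_norm; apply: contB; exact: contM.
- exact: contZ.
- by move=> t _; rewrite -mulrBl normrM ler_wpM2r.
Unshelve. all: by end_near. Qed.

Lemma lipschitz_cont (L : R) (F : R -> R) :
  (forall x y, `|F x - F y| <= L * `|x - y|) -> continuous F.
Proof.
move=> LF x; apply/cvgrPdist_le => /= eps e0.
have L1 : 0 < `|L| + 1 by rewrite ltr_wpDl.
exists (eps / (`|L| + 1)) => /=; first exact: divr_gt0.
move=> y /= xy; apply: le_trans (LF _ _) _.
apply: le_trans (_ : (`|L| + 1) * `|x - y| <= _).
  by rewrite ler_wpM2r// (le_trans (ler_norm L))// lerDl.
by rewrite mulrC -ler_pdivlMr// ltW.
Qed.

End uniform_limits.

(** * Annihilating exponentials by averages of translates *)

Section annihilation.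
Context {R : realType} (T a0 : R).
Hypotheses (a00 : 0 < a0).
Implicit Types (L M b c q a r w t : R) (F G : R -> R).

(** The right end [b] of the support is a budget: every averaging moves it to the right, and the
    moment identities require it to stay at most [T]. *)
Definition bump (L M b : R) (F : R -> R) : Prop :=
  [/\ forall x y, `|F x - F y| <= L * `|x - y|, forall x, `|F x| <= M,
      forall x, x <= a0 -> F x = 0 & forall x, b <= x -> F x = 0].

(* The moment of [F] against [exp ((r + i w) t)] vanishes. *)
Definition kills (F : R -> R) (r w : R) : Prop :=
  itg 0 T (fun t => F t * ecos r w t) = 0 /\
  itg 0 T (fun t => F t * esin r w t) = 0.

Lemma bump_cont L M b F : bump L M b F -> continuous F.
Proof. by case=> LF _ _ _; exact: lipschitz_cont LF. Qed.

Lemma itg_eq0 (a b : R) (f : R -> R) :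
  {in `[a, b], forall x, f x = 0} -> itg a b f = 0.
Proof. by move=> f0; rewrite (eq_itg f0) itg_cst0. Qed.

Lemma bump_itg_shift L M b F c (g : R -> R) : bump L M b F -> continuous g ->
  0 <= c -> b + c <= T -> 0 <= T ->
  itg 0 T (fun t => F (t - c) * g t) = itg 0 T (fun t => F t * g (t + c)).
Proof.
move=> bF cg c0 bcT T0; have cF := bump_cont bF; case: bF => _ _ F0 Fb.
pose f t := F t * g (t + c).
have cf : continuous f by apply: contM => //; exact: cont_shift.
have -> : itg 0 T (fun t => F (t - c) * g t) = itg (0 - c) (T - c) f.
  rewrite -itg_shift//; apply: eq_itg => t _; by rewrite /f subrK.
rewrite sub0r -[RHS]/(itg 0 T f).
have [Tc|Tc] := lerP 0 (T - c).
  rewrite (@itg_chasles _ (- c) 0)//; last by rewrite oppr_le0.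
  rewrite (@itg_chasles _ 0 (T - c) T)//; last by rewrite lerBlDr lerDl.
  rewrite (@itg_eq0 (- c) 0) ?add0r; last first.
    move=> x; rewrite in_itv/= => /andP[_ x0].
    by rewrite /f F0 ?mul0r// (le_trans x0)// ltW.
  rewrite (@itg_eq0 (T - c) T) ?addr0// => x; rewrite in_itv/= => /andP[Tx _].
  by rewrite /f Fb ?mul0r//; lra.
(* Here [b <= T - c < 0 < a0], so [F] vanishes identically. *)
rewrite !itg_eq0// => x; rewrite in_itv/= => /andP[x0 x1].
- by rewrite /f Fb ?mul0r//; lra.
- by rewrite /f F0 ?mul0r// (le_trans x1)// (le_trans (ltW Tc))// ltW.
Qed.

Lemma bump_shift L M b F c : bump L M b F -> 0 <= c ->
  bump L M (b + c) (fun t => F (t - c)).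
Proof.
case=> LF MF F0 Fb c0; split => [x y|x|x xa|x xb]; last 2 first.
- by apply: F0; lra.
- by apply: Fb; lra.
- by apply: le_trans (LF _ _) _; rewrite opprB addrA subrK.
- exact: MF.
Qed.

Lemma bumpW L M b b' F : b <= b' -> bump L M b F -> bump L M b' F.
Proof. by move=> bb [? ? ? Fb]; split => // x xb; apply: Fb; lra. Qed.

Lemma bumpD L M L' M' b F G : bump L M b F -> bump L' M' b G ->
  bump (L + L') (M + M') b (fun t => F t + G t).
Proof.
move=> [LF MF F0 Fb] [LG MG G0 Gb]; split => [x y|x|x xa|x xb].
- rewrite opprD addrACA (le_trans (ler_normD _ _))// mulrDl; exact: lerD.
- by rewrite (le_trans (ler_normD _ _))//; exact: lerD.
- by rewrite F0// G0// addr0.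
- by rewrite Fb// Gb// addr0.
Qed.

Lemma bumpZ L M b F k : bump L M b F ->
  bump (`|k| * L) (`|k| * M) b (fun t => k * F t).
Proof.
move=> [LF MF F0 Fb]; split => [x y|x|x xa|x xb].
- by rewrite -mulrBr normrM -mulrA ler_wpM2l.
- by rewrite normrM ler_wpM2l.
- by rewrite F0// mulr0.
- by rewrite Fb// mulr0.
Qed.

(* Shifting multiplies the moment against [exp ((r + i w) t)] by              *)
(* [exp ((r + i w) c)].                                                       *)
Lemma moment_shift L M b F c r w : bump L M b F -> 0 <= c -> b + c <= T ->
  0 <= T ->
  itg 0 T (fun t => F (t - c) * ecos r w t) =
    ecos r w c * itg 0 T (fun t => F t * ecos r w t) -
    esin r w c * itg 0 T (fun t => F t * esin r w t) /\
  itg 0 T (fun t => F (t - c) * esin r w t) =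
    ecos r w c * itg 0 T (fun t => F t * esin r w t) +
    esin r w c * itg 0 T (fun t => F t * ecos r w t).
Proof.
move=> bF c0 bcT T0; have cF := bump_cont bF.
rewrite !(bump_itg_shift bF _ c0 bcT T0); [|exact: cont_esin|exact: cont_ecos].
have c1 := contM cF (@cont_ecos _ r w); have c2 := contM cF (@cont_esin _ r w).
rewrite -!itgZ// -itgB; [|exact: contZ|exact: contZ].
rewrite -itgD; [|exact: contZ|exact: contZ].
by split; apply: eq_itg => t _ /=; rewrite ?ecosD ?esinD; ring.
Qed.

Lemma ecos00 t : ecos 0 0 t = 1.
Proof. by rewrite /ecos !mul0r expR0 cos0 mulr1. Qed.

Lemma esin00 t : esin 0 0 t = 0.
Proof. by rewrite /esin !mul0r sin0 mulr0. Qed.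

Lemma itgF_moment F : itg 0 T F = itg 0 T (fun t => F t * ecos 0 0 t).
Proof. by apply: eq_itg => t _; rewrite ecos00 mulr1. Qed.

Definition avg (q a : R) (F : R -> R) (t : R) : R :=
  (1 + q)^-1 * (F t + q * F (t - a)).

Lemma avg_bump q a L M b F : 0 < q -> 0 <= a -> bump L M b F ->
  bump L M (b + a) (avg q a F).
Proof.
move=> q0 a_0 bF; have q1 : 0 < 1 + q by rewrite addr_gt0.
have bF' : bump L M (b + a) F by apply: bumpW bF; rewrite lerDl.
have := bumpZ (1 + q)^-1 (bumpD bF' (bumpZ q (bump_shift bF a_0))).
rewrite (gtr0_norm q0) gtr0_norm ?invr_gt0//.
rewrite (_ : L + q * L = (1 + q) * L); last by ring.
rewrite (_ : M + q * M = (1 + q) * M); last by ring.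
by rewrite !mulKf// lt0r_neq0.
Qed.

(** Makes the increments of iterated averages summable as soon as the shifts are. *)
Lemma avg_dist q a L M b F t : 0 < q -> 0 <= a -> bump L M b F ->
  `|avg q a F t - F t| <= L * a.
Proof.
move=> q0 a_0 [LF _ _ _]; have q1 : 0 < 1 + q by rewrite addr_gt0.
have L0 : 0 <= L by have := le_trans (normr_ge0 _) (LF 1 0); rewrite subr0 normr1 mulr1.
have -> : avg q a F t - F t = q / (1 + q) * (F (t - a) - F t).
  by rewrite /avg; field; rewrite lt0r_neq0.
have qq : 0 <= q / (1 + q) by rewrite divr_ge0 ?(ltW q0) ?(ltW q1).
rewrite normrM ger0_norm// -[leRHS]mul1r; apply: ler_pM => //.
  by rewrite ler_pdivrMr// mul1r lerDr.
apply: le_trans (LF _ _) _.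
by rewrite addrAC subrr sub0r normrN ger0_norm.
Qed.

(** In complex form the moment is multiplied by (1 + q z) / (1 + q) with z = e^((r + i w) a). Hence
    moments that vanish stay zero, and the mass, which has z = 1, is preserved. *)
Lemma avg_moment q a L M b F r w : bump L M b F -> 0 <= a -> b + a <= T ->
  0 <= T ->
  itg 0 T (fun t => avg q a F t * ecos r w t) = (1 + q)^-1 *
    ((1 + q * ecos r w a) * itg 0 T (fun t => F t * ecos r w t) -
     q * esin r w a * itg 0 T (fun t => F t * esin r w t)) /\
  itg 0 T (fun t => avg q a F t * esin r w t) = (1 + q)^-1 *
    ((1 + q * ecos r w a) * itg 0 T (fun t => F t * esin r w t) +
     q * esin r w a * itg 0 T (fun t => F t * ecos r w t)).
Proof.
move=> bF a_0 baT T0; have [mc ms] := moment_shift r w bF a_0 baT T0.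
have cF := bump_cont bF; have cFs := bump_cont (bump_shift bF a_0).
have E (g : R -> R) : continuous g -> itg 0 T (fun t => avg q a F t * g t) =
    (1 + q)^-1 * (itg 0 T (fun t => F t * g t) +
                  q * itg 0 T (fun t => F (t - a) * g t)).
  move=> cg; have h1 := contM cF cg; have h2 := contM cFs cg.
  rewrite -itgZ// -itgD; [|exact: h1|exact: contZ].
  rewrite -itgZ; last by apply: contD => //; exact: contZ.
  by apply: eq_itg => t _; rewrite /avg; ring.
rewrite !E; [|exact: cont_esin|exact: cont_ecos].
by rewrite mc ms; split; ring.
Qed.

Lemma avg_kills_stable q a L M b F r w : bump L M b F -> 0 <= a ->
  b + a <= T -> 0 <= T -> kills F r w -> kills (avg q a F) r w.
Proof.
move=> bF a_0 baT T0 [kc ks]; rewrite /kills.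
have [-> ->] := avg_moment q r w bF a_0 baT T0.
by rewrite kc ks !mulr0 subrr addr0 mulr0.
Qed.

Lemma avg_mass q a L M b F : 0 < q -> bump L M b F -> 0 <= a ->
  b + a <= T -> 0 <= T -> itg 0 T (avg q a F) = itg 0 T F.
Proof.
move=> q0 bF a_0 baT T0; rewrite (itgF_moment F) (itgF_moment (avg _ _ _)).
have [-> _] := avg_moment q 0 0 bF a_0 baT T0.
rewrite ecos00 esin00 mulr1 mulr0 mul0r subr0.
by rewrite mulKf// lt0r_neq0// addr_gt0.
Qed.

(* With [a = pi / w] the factor [1 + q exp ((r + i w) a)] vanishes for        *)
(* [q = exp (- r a)].                                                         *)
Lemma avg_kills r w L M b F : 0 < w -> bump L M b F -> b + pi / w <= T ->
  0 <= T -> kills (avg (expR (- (r * (pi / w)))) (pi / w) F) r w.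
Proof.
move=> w0 bF baT T0.
have a_0 : 0 <= pi / w by rewrite divr_ge0 ?pi_ge0// ltW.
rewrite /kills; have [-> ->] := avg_moment (expR (- (r * (pi / w)))) r w bF a_0 baT T0.
have wa : w * (pi / w) = pi by rewrite mulrC divfK// lt0r_neq0.
rewrite /ecos /esin wa cospi sinpi mulr0 mulrN1 mulrN.
rewrite [expR (- _) * expR _]mulrC expRxMexpNx_1 subrr !mulr0 !mul0r.
by rewrite subrr addr0 mulr0.
Qed.

(** Convolution with a measure on {0, a, 2a} whose middle weight may be negative. The bounds in
    [bump] may therefore grow, but the step [a] is no longer tied to [pi / w] and can be arbitrarily
    small. *)
Definition avg3 (k q c a : R) (F : R -> R) (t : R) : R :=
  k * (F t + (- (2 * q * c) * F (t - a) + q ^+ 2 * F (t - (a + a)))).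

Lemma avg3_bump k q c a L M b F : 0 <= a -> bump L M b F ->
  exists L' M', bump L' M' (b + (a + a)) (avg3 k q c a F).
Proof.
move=> a_0 bF.
have bF0 : bump L M (b + (a + a)) F by apply: bumpW bF; lra.
have bF1 : bump L M (b + (a + a)) (fun t => F (t - a)).
  by apply: bumpW (bump_shift bF a_0); lra.
have bF2 := bump_shift bF (addr_ge0 a_0 a_0).
by do 2 eexists; exact: bumpZ k (bumpD bF0
  (bumpD (bumpZ (- (2 * q * c)) bF1) (bumpZ (q ^+ 2) bF2))).
Qed.

Lemma avg3_moment k q c a L M b F r w : bump L M b F -> 0 <= a ->
  b + (a + a) <= T -> 0 <= T ->
  let C := itg 0 T (fun t => F t * ecos r w t) in
  let S := itg 0 T (fun t => F t * esin r w t) in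
  let x := 1 - 2 * q * c * ecos r w a + q ^+ 2 * ecos r w (a + a) in
  let y := - (2 * q * c * esin r w a) + q ^+ 2 * esin r w (a + a) in
  itg 0 T (fun t => avg3 k q c a F t * ecos r w t) = k * (x * C - y * S) /\
  itg 0 T (fun t => avg3 k q c a F t * esin r w t) = k * (x * S + y * C).
Proof.
move=> bF a_0 baT T0 C S x y; have aa0 := addr_ge0 a_0 a_0.
have baT1 : b + a <= T by lra.
have [mc ms] := moment_shift r w bF a_0 baT1 T0.
have [mc2 ms2] := moment_shift r w bF aa0 baT T0.
have cF := bump_cont bF; have cF1 := bump_cont (bump_shift bF a_0).
have cF2 := bump_cont (bump_shift bF aa0).
have E (g : R -> R) : continuous g -> itg 0 T (fun t => avg3 k q c a F t * g t) =
    k * (itg 0 T (fun t => F t * g t) +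
      (- (2 * q * c) * itg 0 T (fun t => F (t - a) * g t) +
       q ^+ 2 * itg 0 T (fun t => F (t - (a + a)) * g t))).
  move=> cg; have h0 := contM cF cg; have h1 := contM cF1 cg.
  have h2 := contM cF2 cg.
  have h1' := @contZ _ (- (2 * q * c)) _ h1; have h2' := @contZ _ (q ^+ 2) _ h2.
  rewrite -[q ^+ 2 * itg _ _ _]itgZ// -[_ * itg _ _ (fun t => F (t - a) * _)]itgZ//.
  rewrite -itgD// -itgD//; last exact: contD.
  rewrite -itgZ; last by apply: contD => //; exact: contD.
  by apply: eq_itg => t _; rewrite /avg3; ring.
rewrite !E; [|exact: cont_esin|exact: cont_ecos].
by rewrite mc ms mc2 ms2 -/C -/S /x /y; split; ring.
Qed.

Lemma avg3_kills_stable k q c a L M b F r w : bump L M b F -> 0 <= a ->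
  b + (a + a) <= T -> 0 <= T -> kills F r w -> kills (avg3 k q c a F) r w.
Proof.
move=> bF a_0 baT T0 [kc ks]; rewrite /kills.
have /= [-> ->] := avg3_moment k q c r w bF a_0 baT T0.
by rewrite kc ks !mulr0 subrr addr0 mulr0.
Qed.

(* The symbol [1 - 2 q cos(w a) z + q^2 z^2] vanishes at                      *)
(* [z = exp ((r + i w) a)], and is positive at [z = 1] as [a < pi / w].       *)
Lemma annihilate_mode L M b b' F r w : 0 < w -> b < b' -> b' <= T -> 0 <= T ->
  bump L M b F -> exists L' M' F', [/\ bump L' M' b' F',
    kills F' r w, forall r' w', kills F r' w' -> kills F' r' w' &
    itg 0 T F' = itg 0 T F].
Proof.
move=> w0 bb b'T T0 bF.
(* Less than [pi / w], so that [sin (w * a)] is positive, and so small that the double shift fits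
   between [b] and [b']. *)
pose a := Num.min (pi / w / 2) ((b' - b) / 2).
have pw : 0 < pi / w by rewrite divr_gt0 ?pi_gt0.
have a_0 : 0 < a by rewrite lt_min; apply/andP; split; lra.
have [a1 a2] : a < pi / w /\ a + a <= b' - b.
  have : a <= pi / w / 2 by rewrite ge_min lexx.
  have : a <= (b' - b) / 2 by rewrite ge_min lexx orbT.
  by split; lra.
have wa : 0 < w * a < pi.
  by rewrite mulr_gt0//= mulrC -ltr_pdivlMr.
have s0 : 0 < sin (w * a) by exact: sin_gt0_pi.
pose q := expR (- (r * a)); pose c := cos (w * a).
have q0 : 0 < q by exact: expR_gt0.
have ss : sin (w * a) * sin (w * a) = 1 - c * c.
  by rewrite -(cos2Dsin2 (w * a)) -/c; ring.
(* The symbol at z = 1 is |q - e^(i w a)|^2; dividing by it preserves the mass. *)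
have D0 : 0 < 1 - 2 * q * c + q ^+ 2.
  rewrite (_ : _ + _ = (q - c) ^+ 2 + sin (w * a) ^+ 2); last first.
    by rewrite [sin _ ^+ 2]expr2 ss; ring.
  by rewrite ltr_wpDl ?sqr_ge0// exprn_gt0.
have [L' [M' bF']] := avg3_bump (1 - 2 * q * c + q ^+ 2)^-1 q c (ltW a_0) bF.
have baT : b + (a + a) <= T by lra.
exists L', M', (avg3 (1 - 2 * q * c + q ^+ 2)^-1 q c a F); split.
- by apply: bumpW bF'; lra.
- rewrite /kills.
  have /= [-> ->] := avg3_moment (1 - 2 * q * c + q ^+ 2)^-1 q c r w bF (ltW a_0) baT T0.
  have qe : q * expR (r * a) = 1 by rewrite mulrC expRxMexpNx_1.
  have hx : 1 - 2 * q * c * ecos r w a + q ^+ 2 * ecos r w (a + a) = 0.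
    rewrite ecosD /ecos /esin -/c.
    transitivity (1 - 2 * (q * expR (r * a)) * (c * c) +
      (q * expR (r * a)) ^+ 2 * (c * c - sin (w * a) * sin (w * a))); first by ring.
    by rewrite qe ss; ring.
  have hy : - (2 * q * c * esin r w a) + q ^+ 2 * esin r w (a + a) = 0.
    rewrite esinD /ecos /esin -/c.
    transitivity (- (2 * (q * expR (r * a)) * (c * sin (w * a))) +
      (q * expR (r * a)) ^+ 2 * (2 * (c * sin (w * a)))); first by ring.
    rewrite qe; ring.
  by rewrite hx hy !mul0r subrr addr0 mulr0.
- by move=> r' w'; apply: avg3_kills_stable bF _ _ _ => //; exact: ltW.
- rewrite (itgF_moment F) (itgF_moment (avg3 _ _ _ _ _)).
  have /= [-> _] := avg3_moment (1 - 2 * q * c + q ^+ 2)^-1 q c 0 0 bF (ltW a_0) baT T0.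
  rewrite !ecos00 !esin00 !mulr1 !mulr0 oppr0 addr0 mul0r subr0.
  by rewrite mulKf// lt0r_neq0.
Qed.

Lemma annihilate_finitely (r w : nat -> R) (N : nat) L M b b' F :
  (forall j, 0 < w j) -> b < b' -> b' <= T -> 0 <= T -> bump L M b F ->
  exists L' M' F', [/\ bump L' M' b' F',
    forall j, (j < N)%N -> kills F' (r j) (w j),
    forall r' w', kills F r' w' -> kills F' r' w' & itg 0 T F' = itg 0 T F].
Proof.
move=> w0 + + T0 bF; elim: N b' => [|N IH] b' bb b'T.
  by exists L, M, F; split => //; apply: bumpW bF; exact: ltW.
(* The first [N] frequencies share one half of the available length; the last one gets the other
   half. *)
have [||L1 [M1 [F1 [bF1 k1 s1 m1]]]] := IH ((b + b') / 2); [lra|lra|].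
have [|L2 [M2 [F2 [bF2 k2 s2 m2]]]] :=
  @annihilate_mode _ _ _ b' _ (r N) (w N) (w0 N) _ b'T T0 bF1; first lra.
exists L2, M2, F2; split => //.
- move=> j; rewrite ltnS leq_eqVlt => /predU1P[->//|jN].
  by apply: s2; exact: k1.
- by move=> r' w' k; apply/s2/s1.
- by rewrite m2 m1.
Qed.

Lemma kills_unif_lim (f : nat -> R -> R) (G : R -> R) (e : nat -> R) r w :
  (forall N, continuous (f N)) -> continuous G -> e @ \oo --> (0 : R) ->
  (forall N t, `|G t - f N t| <= e N) ->
  (\forall N \near \oo, kills (f N) r w) -> kills G r w.
Proof.
move=> cf cG e0 Ge kf; split.
  apply: itg_unif_lim cf cG (@cont_ecos _ r w) e0 Ge _.
  by apply: filterS kf => N [].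
apply: itg_unif_lim cf cG (@cont_esin _ r w) e0 Ge _.
by apply: filterS kf => N [].
Qed.

Lemma bump_lim L M b (f : nat -> R -> R) G : (forall N, bump L M b (f N)) ->
  (forall t, f N t @[N --> \oo] --> G t) -> bump L M b G.
Proof.
move=> bf fG; split => [x y|x|x xa|x xb].
- have h : `|f N x - f N y| @[N --> \oo] --> `|G x - G y|.
    by apply: cvg_norm; apply: cvgB; exact: fG.
  rewrite -(cvg_lim _ h)//; apply: limr_le; first by apply/cvg_ex; eexists; exact: h.
  by near=> N; case: (bf N).
- have h : `|f N x| @[N --> \oo] --> `|G x| by apply: cvg_norm; exact: fG.
  rewrite -(cvg_lim _ h)//; apply: limr_le; first by apply/cvg_ex; eexists; exact: h.
  by near=> N; case: (bf N).
- have fE : (fun N => f N x) = cst 0.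
    by apply/funext => N; case: (bf N) => _ _ ->.
  by have := fG x; rewrite fE => h; rewrite -(cvg_lim _ h)//; exact: lim_cst.
- have fE : (fun N => f N x) = cst 0.
    by apply/funext => N; case: (bf N) => _ _ _ ->.
  by have := fG x; rewrite fE => h; rewrite -(cvg_lim _ h)//; exact: lim_cst.
Unshelve. all: by end_near. Qed.

Fixpoint avgs (r w : nat -> R) (F : R -> R) (N : nat) : R -> R :=
  if N is N'.+1 then
    avg (expR (- (r N' * (pi / w N')))) (pi / w N') (avgs r w F N')
  else F.

(* Two-point averages are contractions for the bounds in [bump], so their     *)
(* infinite composition costs nothing but the total length of the shifts.     *)
Lemma annihilate_summable (r w : nat -> R) L M b b' F :
  (forall j, 0 < w j) -> 0 <= T -> b' <= T ->
  (forall N, b + \sum_(0 <= j < N) pi / w j <= b') -> bump L M b F ->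
  exists G, [/\ bump L M b' G, forall j, kills G (r j) (w j),
    forall r' w', kills F r' w' -> kills G r' w' & itg 0 T G = itg 0 T F].
Proof.
move=> w0 T0 b'T sT bF; pose f := avgs r w F.
pose A (N : nat) : R := \sum_(0 <= j < N) pi / w j.
have a_0 j : 0 <= pi / w j by rewrite divr_ge0 ?pi_ge0 ?(ltW (w0 j)).
have AS N : A N.+1 = A N + pi / w N by rewrite /A big_nat_recr.
have bfN N : bump L M (b + A N) (f N).
  elim: N => [|N IH]; first by rewrite /A big_geq// addr0.
  by rewrite AS addrA; apply: avg_bump => //; exact: expR_gt0.
have bfT N : bump L M b' (f N) by apply: bumpW (bfN N); exact: sT.
have step N : b + A N + pi / w N <= T.
  by rewrite -addrA -AS (le_trans (sT _)).
have L0 : 0 <= L.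
  by case: bF => LF _ _ _; have := le_trans (normr_ge0 _) (LF 1 0);
     rewrite subr0 normr1 mulr1.
have [|||G [e [e0 Ge fG]]] :=
  @dominated_telescope_lim R R f (fun N => L * A N) (L * (b' - b)).
- by move=> N; rewrite ler_wpM2l// lerBrDl sT.
- by move=> N; rewrite ler_wpM2l// AS lerDl.
- move=> N t; rewrite -mulrBr AS addrAC subrr add0r.
  by apply: avg_dist (bfN N) => //; exact: expR_gt0.
have bG : bump L M b' G by apply: bump_lim bfT fG.
have stab j N k r' w' : kills (f j) r' w' -> (N = j + k)%N -> kills (f N) r' w'.
  move=> kj; elim: k N => [|k IH] N; first by rewrite addn0 => ->.
  rewrite addnS => ->.
  by apply: avg_kills_stable (bfN _) _ _ _ _ => //; exact: IH.
have cf N := bump_cont (bfN N).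
exists G; split => //.
- move=> j; apply: kills_unif_lim cf (bump_cont bG) e0 Ge _; near=> N.
  apply: (stab j.+1 N (N - j.+1)%N); first exact: avg_kills (w0 j) (bfN j) (step j) T0.
  by rewrite subnKC//; near: N; exact: nbhs_infty_ge.
- move=> r' w' k; apply: kills_unif_lim cf (bump_cont bG) e0 Ge _; near=> N.
  exact: (stab 0%N N N).
- have mf N : itg 0 T (f N) = itg 0 T F.
    elim: N => [//|N IH].
    by rewrite -IH; apply: avg_mass (bfN N) _ _ _ => //; exact: expR_gt0.
  rewrite (itgF_moment G).
  apply: itg_unif_lim cf (bump_cont bG) (@cont_ecos _ 0 0) e0 Ge _.
  by apply: nearW => N; rewrite -(itgF_moment (f N)).
Unshelve. all: by end_near. Qed.

End annihilation.

Section bump_facts.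
Context {R : realType}.
Implicit Types (L M b c T a : R) (F G : R -> R).

Lemma bumpLM (a0 : R) L M L' M' b F : L <= L' -> M <= M' ->
  bump a0 L M b F -> bump a0 L' M' b F.
Proof.
move=> LL MM [LF MF F0 Fb]; split => // [x y|x].
  by apply: le_trans (LF x y) _; rewrite ler_wpM2r.
exact: le_trans (MF x) MM.
Qed.

(** A tent function divided by its mass; taking the maximum with 0 does not increase the Lipschitz
    constant. *)
Lemma exists_bump T (a0 : R) b : 0 < a0 -> a0 < b -> b <= T ->
  exists L M F, bump a0 L M b F /\ itg 0 T F = 1.
Proof.
move=> a00 ab bT; pose h := (b - a0) / 2; pose c := (a0 + b) / 2.
have h0 : 0 < h by rewrite /h; lra.
pose F (t : R) := Num.max 0 (h - `|t - c|).
have FE t : F t = Num.max 0 (h - `|t - c|) by [].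
have LF x y : `|F x - F y| <= 1 * `|x - y|.
  have mx (u v : R) : `|Num.max 0 u - Num.max 0 v| <= `|u - v|.
    rewrite !maxEle; have [u0|u0] := lerP 0 u; have [v0|v0] := lerP 0 v => //.
    - by rewrite subr0 !ger0_norm//; lra.
    - by rewrite sub0r normrN ger0_norm// ler0_norm; lra.
    - by rewrite subrr normr0.
  rewrite !FE mul1r (le_trans (mx _ _))//.
  rewrite (_ : _ - _ = `|y - c| - `|x - c|); last by ring.
  by rewrite distrC (le_trans (ler_dist_dist _ _))// opprB addrA subrK.
have bF : bump a0 1 h b F.
  split => // [x|x xa|x xb].
  - rewrite ger0_norm ?le_max ?lexx// FE ge_max (ltW h0)/=.
    by rewrite lerBlDr lerDl.
  - rewrite FE; apply/max_idPl; rewrite ler0_norm; rewrite /h /c; lra.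
  - rewrite FE; apply/max_idPl; rewrite ger0_norm; rewrite /h /c; lra.
have cF : continuous F by exact: lipschitz_cont LF.
have m0 : 0 < itg 0 T F.
  (* The tent is at least [h / 2] on the interval of length [h] centred at [c]. *)
  apply: lt_le_trans (_ : h / 2 * (c + h / 2 - (c - h / 2)) <= _).
    by rewrite mulr_gt0; lra.
  have o1 : 0 <= c - h / 2 by rewrite /h /c; lra.
  have o2 : c - h / 2 <= c + h / 2 by lra.
  have o3 : c + h / 2 <= T by rewrite /h /c; lra.
  rewrite (itg_chasles cF o1 (le_trans o2 o3)) (itg_chasles cF o2 o3).
  have F_0 t : 0 <= F t by rewrite le_max lexx.
  apply: le_trans (_ : itg (c - h / 2) (c + h / 2) F <= _).
    rewrite -itg_cst//; apply: le_itg => //; first exact: cont_cst.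
    move=> x; rewrite in_itv/= => /andP[x1 x2].
    rewrite FE le_max; apply/orP; right.
    suff : `|x - c| <= h / 2 by lra.
    by rewrite ler_norml; apply/andP; split; lra.
  rewrite -[leLHS]add0r; apply: lerD; first exact: itg_ge0.
  by rewrite lerDl; exact: itg_ge0.
do 2 eexists; exists (fun t => (itg 0 T F)^-1 * F t); split.
  exact: bumpZ bF.
by rewrite itgZ// mulVf// lt0r_neq0.
Qed.

End bump_facts.

(** * Multipliers with bounds uniform in the mode *)

Section biorthogonal.
Context {R : realType} (alpha rho T : R).
Hypotheses (halpha : 0 < alpha < 1) (hrho : 0 < rho < 2) (hT : 0 < T).
Local Notation sg := (sg alpha rho).
Local Notation om := (om alpha rho).
Local Notation gap := (gap alpha rho).
Local Notation bump := (bump (T / 2)).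
Local Notation kills := (kills T).

(** Index [j] stands for the mode m = j + 1. At m = n the entry [wm] is the sum frequency again
    instead of 0: all entries stay positive, and the zero exponent, which carries the mass, is not
    annihilated. *)
Let r (n j : nat) : R := sg j.+1 - sg n.
Let wm (n j : nat) : R := gap n j.+1.
Let wp (n j : nat) : R := om j.+1 + om n.

Let wm_gt0 n j : (0 < n)%N -> 0 < wm n j.
Proof. by move=> n0; exact: gap_gt0. Qed.

Let wp_gt0 n j : (0 < n)%N -> 0 < wp n j.
Proof. by move=> n0; rewrite addr_gt0// om_gt0. Qed.

(** The last quarter of [0, T] is split into two eighths, one for the shifts of the difference
    frequencies and one for those of the sum frequencies. The first [K] frequencies of either kind
    are assumed to be treated already. *)
Let biorthogonal_tail (n K : nat) (L M : R) F : (0 < n)%N ->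
  bump L M (3 * T / 4) F ->
  (forall j, (j < K)%N -> kills F (r n j) (wm n j)) ->
  (forall j, (j < K)%N -> kills F (r n j) (wp n j)) ->
  (forall N, \sum_(0 <= j < N) pi / wm n (K + j)%N <= T / 8) ->
  exists G, [/\ bump L M T G, itg 0 T G = itg 0 T F,
    forall j, kills G (r n j) (wm n j) & forall j, kills G (r n j) (wp n j)].
Proof.
move=> n0 bF km kp sK; have T2 : 0 < T / 2 by rewrite divr_gt0.
have T0 := hT.
have sKp N : \sum_(0 <= j < N) pi / wp n (K + j)%N <= T / 8.
  apply: le_trans (sK N); apply: ler_sum => j _.
  rewrite ler_wpM2l ?pi_ge0// lef_pV2 ?posrE ?wm_gt0 ?wp_gt0//.
  by rewrite /wm /wp addrC gap_le.
have [||||G1 [bG1 k1 s1 m1]] :=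
  @annihilate_summable _ T (T / 2) T2 (fun j => r n (K + j)%N)
    (fun j => wm n (K + j)%N) L M (3 * T / 4) (7 * T / 8) F _ _ _ _ bF.
- by move=> j; exact: wm_gt0.
- exact: ltW.
- by lra.
- by move=> N; have := sK N; lra.
have [||||G [bG k s m]] :=
  @annihilate_summable _ T (T / 2) T2 (fun j => r n (K + j)%N)
    (fun j => wp n (K + j)%N) L M (7 * T / 8) T G1 _ _ _ _ bG1.
- by move=> j; exact: wp_gt0.
- exact: ltW.
- by [].
- by move=> N; have := sKp N; lra.
exists G; split; [exact: bG|by rewrite m m1| |].
- move=> j; apply: s; have [jK|Kj] := ltnP j K; first by apply: s1; exact: km.
  by rewrite -(subnKC Kj); exact: k1.
- move=> j; have [jK|Kj] := ltnP j K; first by apply/s/s1; exact: kp.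
  by rewrite -(subnKC Kj); exact: k.
Qed.

Let biorth n (L M : R) G := [/\ bump L M T G, itg 0 T G = 1,
    forall j, kills G (r n j) (wm n j) & forall j, kills G (r n j) (wp n j)].

Let wm_sum n N : (0 < n)%N ->
  \sum_(0 <= j < N) pi / wm n j <=
    pi * (10 / (1 - rho ^+ 2 / 4) / Num.sqrt n%:R).
Proof.
move=> n0; rewrite -mulr_sumr ler_wpM2l ?pi_ge0//.
by have := gap_sum halpha hrho N.+1 n0; rewrite big_add1.
Qed.

(** The bounds may depend on [n]. The support ends at 5T/8 for the tent, and at 11T/16 and 3T/4
    after the finitely many differences and sums have been annihilated with three-point measures. *)
Let biorthogonal_one (n : nat) : (0 < n)%N -> exists L M G, biorth n L M G.
Proof.
move=> n0; have T2 : 0 < T / 2 by rewrite divr_gt0. have T0 := hT.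
have [|||L0 [M0 [F0 [bF0 m0]]]] := @exists_bump R T (T / 2) (5 * T / 8); [lra|lra|lra|].
(* The total shift is finite, so a tail of it is at most [T / 8]. *)
have [K sK] : exists K, forall N, \sum_(0 <= j < N) pi / wm n (K + j)%N <= T / 8.
  pose A N := \sum_(0 <= j < N) pi / wm n j.
  have A0 j : 0 <= pi / wm n j by rewrite divr_ge0 ?pi_ge0 ?(ltW (wm_gt0 _ _)).
  have ndA : nondecreasing_seq A.
    by apply/nondecreasing_seqP => N; rewrite /A [leRHS]big_nat_recr//= lerDl.
  have cA : cvgn A.
    apply: nondecreasing_is_cvgn => //.
    by eexists => _ [N _ <-]; exact: wm_sum.
  have T8 : 0 < T / 8 by lra.
  have /cvgrPdist_le /(_ _ T8) [K _ HK] := cA.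
  exists K => N; have := HK K (leqnn _); rewrite ger0_norm; last first.
    by rewrite subr_ge0; exact: nondecreasing_cvgn_le.
  have : A (K + N)%N <= limn A by exact: nondecreasing_cvgn_le.
  have -> : A (K + N)%N = A K + \sum_(0 <= j < N) pi / wm n (K + j)%N.
    rewrite /A (big_cat_nat (leq0n K) (leq_addr N K)) /=; congr (_ + _).
    rewrite -{1}[K]add0n big_addn addKn.
    by apply: eq_bigr => j _; rewrite addnC.
  by move=> h1 h2; lra.
have [||||L1 [M1 [F1 [bF1 k1 s1 m1]]]] := @annihilate_finitely _ T (T / 2) T2
  (r n) (wm n) K L0 M0 (5 * T / 8) (11 * T / 16) F0 _ _ _ _ bF0.
- by move=> j; exact: wm_gt0.
- by lra.
- by lra.
- exact: ltW.
have [||||L2 [M2 [F2 [bF2 k2 s2 m2]]]] := @annihilate_finitely _ T (T / 2) T2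
  (r n) (wp n) K L1 M1 (11 * T / 16) (3 * T / 4) F1 _ _ _ _ bF1.
- by move=> j; exact: wp_gt0.
- by lra.
- by lra.
- exact: ltW.
have [|G [bG mG km kp]] := biorthogonal_tail n0 bF2 _ k2 sK.
  by move=> j jK; apply: s2; exact: k1.
by exists L2, M2, G; split; [exact: bG|rewrite mG m2 m1|exact: km|exact: kp].
Qed.

Let biorthogonal_large : exists L M N0, forall n, (N0 < n)%N ->
  exists G, biorth n L M G.
Proof.
have T2 : 0 < T / 2 by rewrite divr_gt0. have T0 := hT.
have [|||L0 [M0 [F0 [bF0 m0]]]] := @exists_bump R T (T / 2) (3 * T / 4); [lra|lra|lra|].
(* From [sqrt n >= X] on, the bound in [wm_sum] is at most [T / 8]. Then no frequency needs a
   three-point measure, and the bounds of the tent survive for all these [n]. *)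
pose X := pi * (10 / (1 - rho ^+ 2 / 4)) / (T / 8).
have X0 : 0 <= X.
  rewrite divr_ge0//; last lra.
  by rewrite mulr_ge0 ?pi_ge0// divr_ge0// (ltW (gapconst_gt0 hrho)).
exists L0, M0, (Num.bound (X ^+ 2)) => n Nn.
have n0 : (0 < n)%N by exact: leq_trans Nn.
have Xn : X <= Num.sqrt n%:R.
  rewrite -(ger0_norm X0) -sqrtr_sqr ler_wsqrtr// ltW//.
  apply: lt_le_trans (archi_boundP (sqr_ge0 X)) _.
  by rewrite ler_nat ltnW.
have sn : 0 < Num.sqrt n%:R :> R by rewrite sqrtr_gt0 ltr0n.
have [|||G [bG mG km kp]] := @biorthogonal_tail n 0%N L0 M0 F0 n0 bF0.
- by [].
- by [].
- move=> N; apply: le_trans (wm_sum N n0) _.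
  rewrite mulrA ler_pdivrMr// [leRHS]mulrC -ler_pdivrMr; [exact: Xn|lra].
by exists G; split; [exact: bG|rewrite mG m0|exact: km|exact: kp].
Qed.

Let biorthogonal_uniform : exists L M, forall n, (0 < n)%N ->
  exists G, biorth n L M G.
Proof.
have [L [M [N0 H0]]] := biorthogonal_large.
have [L' [M' H']] : exists L' M', forall n, (0 < n)%N -> (n <= N0)%N ->
    exists G, biorth n L' M' G.
  elim: N0 {H0} => [|N [L1 [M1 H1]]].
    by exists 0, 0 => n n0 nn; move: n0; rewrite ltnNge nn.
  have [L2 [M2 [G2 [bG2 m2 km2 kp2]]]] := @biorthogonal_one N.+1 isT.
  exists (Num.max L1 L2), (Num.max M1 M2) => n n0.
  rewrite leq_eqVlt => /predU1P[->|nN].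
    exists G2; split; [|exact: m2|exact: km2|exact: kp2].
    by apply: bumpLM bG2; rewrite le_max lexx orbT.
  have [G [bG m km kp]] := H1 n n0 nN.
  exists G; split; [|exact: m|exact: km|exact: kp].
  by apply: bumpLM bG; rewrite le_max lexx.
exists (Num.max L L'), (Num.max M M') => n n0.
have [nN|Nn] := leqP n N0.
  have [G [bG m km kp]] := H' n n0 nN.
  exists G; split; [|exact: m|exact: km|exact: kp].
  by apply: bumpLM bG; rewrite le_max lexx orbT.
have [G [bG m km kp]] := H0 n Nn.
exists G; split; [|exact: m|exact: km|exact: kp].
by apply: bumpLM bG; rewrite le_max lexx.
Qed.

Lemma killsNw (F : R -> R) (s w : R) : continuous F -> kills F s w -> kills F s (- w).
Proof.
move=> cF [kc ks]; split.
  by rewrite -[RHS]kc; apply: eq_itg => t _; rewrite /ecos mulNr cosN.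
transitivity (-1 * itg 0 T (fun t => F t * esin s w t)).
  2: by rewrite ks mulr0.
rewrite -itgZ.
  by apply: eq_itg => t _; rewrite /esin mulNr sinN; ring.
by apply: contM => //; exact: cont_esin.
Qed.

Lemma biorthogonal_multipliers : exists L M, forall n, (0 < n)%N ->
  exists G, [/\ bump L M T G, itg 0 T G = 1,
    forall m, (0 < m)%N -> kills G (sg m - sg n) (om m + om n) &
    forall m, (0 < m)%N -> m != n -> kills G (sg m - sg n) (om m - om n)].
Proof.
have [L [M H]] := biorthogonal_uniform; exists L, M => n n0.
have [G [bG m km kp]] := H n n0; exists G; split; [exact: bG|exact: m| |].
- by case=> // j _; exact: kp.
- case=> // j _ jn; have := km j; rewrite /r /wm /gap (negbTE jn).
  case: (lerP 0 (om j.+1 - om n)) => o; first by rewrite ger0_norm.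
  rewrite ltr0_norm// => k; rewrite -[om _ - om _]opprK.
  by apply: killsNw k; case: bG => LG _ _ _; exact: lipschitz_cont LG.
Qed.

End biorthogonal.

Section products_and_series.
Context {R : realType}.
Implicit Types (L M b c T x y z s w r : R) (F G E : R -> R).

(** The factor [E] is controlled only to the right of [a0], as a decaying exponential is large on
    the left. When one point lies left of [a0], [G] vanishes there and its Lipschitz bound alone
    gives the estimate. *)
Lemma bump_mul (a0 : R) L M b G E (l e : R) : bump a0 L M b G -> 0 <= e -> 0 <= l ->
  (forall x, a0 <= x -> `|E x| <= e) ->
  (forall x y, a0 <= x -> a0 <= y -> `|E x - E y| <= l * `|x - y|) ->
  bump a0 (L * e + M * l) (M * e) b (fun t => G t * E t).
Proof.
move=> [LG MG G0 Gb] e0 l0 Ee El.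
have L0 : 0 <= L.
  by have := le_trans (normr_ge0 _) (LG 1 0); rewrite subr0 normr1 mulr1.
have M0 : 0 <= M by exact: le_trans (MG 0).
have main x y : a0 <= y -> `|G x * E x - G y * E y| <= (L * e + M * l) * `|x - y|.
  move=> ay; have [ax|xa] := lerP a0 x; last first.
    rewrite (G0 _ (ltW xa)) mul0r sub0r normrN normrM.
    have h : `|G y| <= L * `|x - y|.
      by have := LG x y; rewrite (G0 _ (ltW xa)) sub0r normrN.
    apply: le_trans (ler_pM _ _ h (Ee _ ay)) _ => //.
    by rewrite mulrAC ler_wpM2r// lerDl mulr_ge0.
  rewrite (_ : _ - _ = (G x - G y) * E x + G y * (E x - E y)); last by ring.
  rewrite (le_trans (ler_normD _ _))// !normrM mulrDl; apply: lerD.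
    by rewrite mulrAC; apply: ler_pM => //; exact: Ee.
  by rewrite -mulrA; apply: ler_pM => //; exact: El.
split => [x y|x|x xa|x xb].
- have [ay|ya] := lerP a0 y; first exact: main.
  have [ax|xa] := lerP a0 x; first by rewrite distrC [`|x - y|]distrC; exact: main.
  by rewrite !G0 ?(ltW xa) ?(ltW ya)// !mul0r subrr normr0 mulr_ge0// addr_ge0// mulr_ge0.
- have [ax|xa] := lerP a0 x; first by rewrite normrM ler_pM//; exact: Ee.
  by rewrite (G0 _ (ltW xa)) mul0r normr0 mulr_ge0.
- by rewrite G0// mul0r.
- by rewrite Gb// mul0r.
Qed.

Lemma lipschitz_of_derive (E dE : R -> R) (a0 l : R) :
  (forall x, is_derive x (1 : R) E (dE x)) ->
  (forall x, a0 <= x -> `|dE x| <= l) ->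
  forall x y, a0 <= x -> a0 <= y -> `|E x - E y| <= l * `|x - y|.
Proof.
move=> DE dEl x y; wlog xy : x y / x <= y.
  move=> H ax ay; have [xy|/ltW yx] := leP x y; first exact: H.
  by rewrite distrC [`|x - y|]distrC; exact: H.
move=> ax ay.
have [|c] := @MVT_segment R E dE x y xy (fun z _ => DE z).
  exact/continuous_subspaceT/(is_derive_continuous DE).
rewrite in_itv/= => /andP[xc _] Exy.
rewrite distrC Exy normrM [`|x - y|]distrC ler_wpM2r//.
by apply: dEl; exact: le_trans xc.
Qed.

Lemma expRN_decay s x (a0 : R) : 0 <= s -> a0 <= x ->
  expR (- s * x) <= expR (- s * a0).
Proof. by move=> s0 ax; rewrite ler_expR !mulNr lerN2 ler_wpM2l. Qed.

(** The support starts at [a0], which gains e^(- s a0); the derivative of the oscillation costs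
    [s + |w|]. *)
Lemma bump_mul_ecos (a0 : R) L M b G s w : bump a0 L M b G -> 0 <= s ->
  let e := expR (- s * a0) in
  bump a0 (L * e + M * ((s + `|w|) * e)) (M * e) b (fun t => G t * ecos (- s) w t) /\
  bump a0 (L * e + M * ((s + `|w|) * e)) (M * e) b (fun t => G t * esin (- s) w t).
Proof.
move=> bG s0 e; have e0 : 0 <= e by exact: expR_ge0.
have bc x : a0 <= x -> `|ecos (- s) w x| <= e.
  by move=> ax; exact: le_trans (norm_ecos_le _ _ _) (expRN_decay s0 ax).
have bs x : a0 <= x -> `|esin (- s) w x| <= e.
  by move=> ax; exact: le_trans (norm_esin_le _ _ _) (expRN_decay s0 ax).
have sw0 : 0 <= (s + `|w|) * e by rewrite mulr_ge0// addr_ge0.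
split; apply: bump_mul => //.
- apply: (lipschitz_of_derive (is_derive_ecos (- s) w)) => x ax.
  rewrite (le_trans (ler_normB _ _))// (normrM (- s)) (normrM w) normrN (ger0_norm s0) mulrDl.
  by apply: lerD; apply: ler_wpM2l => //; [exact: bc|exact: bs].
- apply: (lipschitz_of_derive (is_derive_esin (- s) w)) => x ax.
  rewrite (le_trans (ler_normD _ _))// (normrM (- s)) (normrM w) normrN (ger0_norm s0) mulrDl.
  by apply: lerD; apply: ler_wpM2l => //; [exact: bs|exact: bc].
Qed.

Lemma sum_inv_sqr_le N : \sum_(1 <= n < N) (n%:R ^+ 2)^-1 <= 2 :> R.
Proof.
suff H K : \sum_(1 <= n < K.+2) (n%:R ^+ 2)^-1 <= 2 - K.+1%:R^-1 :> R.
  case: N => [|[|N]]; [by rewrite big_geq|by rewrite big_geq|].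
  by apply: le_trans (H N) _; rewrite lerBlDr lerDl invr_ge0.
elim: K => [|K IH]; first by rewrite big_nat1 expr1n invr1; lra.
rewrite big_nat_recr//=; apply: le_trans (lerD IH (lexx _)) _.
have k0 : 0 < K.+1%:R :> R by rewrite ltr0n.
rewrite -[K.+2%:R]natr1; move: (K.+1%:R : R) k0 => k k0.
have k1 : 0 < k + 1 by rewrite ltr_wpDr.
rewrite -subr_ge0.
have -> : 2 - (k + 1)^-1 - (2 - k^-1 + ((k + 1) ^+ 2)^-1) = (k * (k + 1) ^+ 2)^-1.
  by field; rewrite !lt0r_neq0.
by rewrite invr_ge0 mulr_ge0 ?exprn_ge0 ?ltW.
Qed.

End products_and_series.

Section decay.
Context {R : realType} (alpha rho : R).
Hypotheses (halpha : 0 < alpha < 1) (hrho : 0 < rho < 2).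
Local Notation sg := (sg alpha rho).

(** From e^x >= x^(j+1) / (j+1)! with j so large that 2 alpha (j + 1) >= 4. Of the fourth power, n^2
    pays for the derivative of the oscillation and n^2 for summability over the modes. *)
Lemma expR_sg_decay (t : R) : 0 < t -> exists K : R, 0 < K /\
  forall n, (0 < n)%N -> expR (- sg n * t) <= K / n%:R ^+ 4.
Proof.
move=> t0; have [a0 _] := andP halpha; have [r0 _] := andP hrho.
pose c := rho / 2 * t; have c0 : 0 < c by rewrite !mulr_gt0.
pose j := Num.bound (2 / alpha).
have ja : 4 <= 2 * alpha * j.+1%:R.
  have : 2 / alpha < j.+1%:R.
    apply: lt_trans (_ : j%:R < _); last by rewrite ltr_nat.
    by apply: archi_boundP; rewrite divr_ge0// ltW.
  by rewrite ltr_pdivrMr// => h; lra.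
exists (j.+1`!%:R / c ^+ j.+1); split.
  by rewrite divr_gt0 ?exprn_gt0// ltr0n fact_gt0.
move=> n n0; have n1 : 1 <= n%:R :> R by rewrite ler1n.
rewrite mulNr expRN.
have x0 : 0 <= sg n * t by rewrite mulr_ge0 ?(ltW t0)// sg_ge0.
have f0 : 0 < (j.+1)`!%:R :> R by rewrite ltr0n fact_gt0.
have lb : (c ^+ j.+1 * n%:R ^+ 4) / j.+1`!%:R <= expR (sg n * t).
  apply: le_trans (_ : (sg n * t) ^+ j.+1 / j.+1`!%:R <= _); last first.
    by apply: le_trans (expR_ge1Dxn j x0); rewrite lerDr.
  rewrite ler_wpM2r ?invr_ge0 ?(ltW f0)//.
  have -> : sg n * t = c * n%:R `^ (2 * alpha) by rewrite /sg /c; ring.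
  rewrite [(c * _) ^+ _]exprMn ler_wpM2l ?exprn_ge0 ?(ltW c0)//.
  rewrite -[in leRHS]powR_mulrn ?powR_ge0// -powRrM.
  by rewrite -[leLHS]powR_mulrn// ler_powR.
have p0 : 0 < c ^+ j.+1 * n%:R ^+ 4 / j.+1`!%:R.
  by rewrite divr_gt0// mulr_gt0 ?exprn_gt0// ltr0n.
apply: le_trans (_ : (c ^+ j.+1 * n%:R ^+ 4 / j.+1`!%:R)^-1 <= _).
  by rewrite lef_pV2// posrE// expR_gt0.
rewrite le_eqVlt; apply/orP; left; apply/eqP.
have A0 : c ^+ j.+1 != 0 by rewrite lt0r_neq0 ?exprn_gt0.
have B0 : n%:R ^+ 4 != 0 :> R by rewrite lt0r_neq0 ?exprn_gt0 ?ltr0n.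
move: (c ^+ j.+1) (n%:R ^+ 4) (j.+1`!%:R : R) A0 B0 f0 => A B D A0 B0 /lt0r_neq0 D0.
by field; rewrite A0 B0 D0.
Qed.

End decay.

(** * The moment problem *)

Section moment_problem.
Context {R : realType} (alpha rho T : R).
Hypotheses (halpha : 0 < alpha < 1) (hrho : 0 < rho < 2) (hT : 0 < T).
Local Notation sg := (sg alpha rho).
Local Notation om := (om alpha rho).

Lemma cossinM (r w r' w' t : R) : 2 * (ecos r w t * esin r' w' t) =
  esin (r + r') (w + w') t - esin (r + r') (w - w') t.
Proof. rewrite /ecos /esin !mulrDl mulNr expRD sinB sinD; ring. Qed.

Lemma bump_sum (a0 b : R) (f : nat -> R -> R) (l m : nat -> R) (N : nat) :
  (forall n, (0 < n)%N -> bump a0 (l n) (m n) b (f n)) ->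
  bump a0 (\sum_(1 <= n < N.+1) l n) (\sum_(1 <= n < N.+1) m n) b
    (fun t => \sum_(1 <= n < N.+1) f n t).
Proof.
move=> bf; elim: N => [|N IH].
  rewrite !big_geq//; split => [x y|x|x _|x _]; rewrite ?big_geq//.
    by rewrite subrr normr0 mul0r.
  by rewrite normr0.
have -> : (fun t => \sum_(1 <= n < N.+2) f n t) =
    (fun t => \sum_(1 <= n < N.+1) f n t + f N.+1 t).
  by apply/funext => t; rewrite big_nat_recr.
rewrite [\sum_(1 <= n < N.+2) l n]big_nat_recr//.
rewrite [\sum_(1 <= n < N.+2) m n]big_nat_recr//=.
by apply: bumpD; [exact: IH|exact: bf].
Qed.

Variables (L M : R) (G : nat -> R -> R).
Hypothesis HG : forall n, (0 < n)%N -> [/\ bump (T / 2) L M T (G n),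
  itg 0 T (G n) = 1,
  forall m, (0 < m)%N -> kills T (G n) (sg m - sg n) (om m + om n) &
  forall m, (0 < m)%N -> m != n -> kills T (G n) (sg m - sg n) (om m - om n)].

Let psic n t := 2 * (G n t * ecos (- sg n) (om n) t).
Let psis n t := 2 * (G n t * esin (- sg n) (om n) t).

Let cG n : (0 < n)%N -> continuous (G n).
Proof. by move=> /HG[bG _ _ _]; exact: bump_cont bG. Qed.

Let itg_split2 (f g h k : R -> R) (x y : R) : continuous g -> continuous h ->
  continuous k ->
  (forall t, 2 * f t = h t + k t) ->
  itg 0 T (fun t => g t * h t) = x -> itg 0 T (fun t => g t * k t) = y ->
  itg 0 T (fun t => 2 * (g t * f t)) = x + y.
Proof.
move=> cg ch ck E <- <-; rewrite -itgD; [|exact: contM|exact: contM].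
by apply: eq_itg => t _; rewrite mulrCA E mulrDr.
Qed.

(** The product formulas reduce each moment to two moments of [G n], with exponent [sg m - sg n] and
    frequencies [om m - om n] and [om m + om n]. Only the zero exponent at [m = n] survives, with
    the mass 1. *)
Lemma psi_moments n m : (0 < n)%N -> (0 < m)%N ->
  [/\ itg 0 T (fun t => psic n t * ecos (sg m) (om m) t) = (m == n)%:R,
      itg 0 T (fun t => psic n t * esin (sg m) (om m) t) = 0,
      itg 0 T (fun t => psis n t * ecos (sg m) (om m) t) = 0 &
      itg 0 T (fun t => psis n t * esin (sg m) (om m) t) = (m == n)%:R].
Proof.
move=> n0 m0; have [bG mG kp km] := HG n0.
have cg := cG n0.
pose r := sg m - sg n.
have [pc ps] := kp m m0.
have [mc ms] : itg 0 T (fun t => G n t * ecos r (om m - om n) t) = (m == n)%:R /\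
               itg 0 T (fun t => G n t * esin r (om m - om n) t) = 0.
  have [mn|mn] := eqVneq m n; last by have [] := km m m0 mn.
  rewrite /r mn !subrr -itgF_moment mG; split => //.
  by apply: itg_eq0 => t _; rewrite esin00 mulr0.
have ce s w := @cont_ecos R s w; have cs s w := @cont_esin R s w.
have cNe (s w : R) : continuous (fun t => - ecos s w t) by apply: contN; exact: ce.
have cNs (s w : R) : continuous (fun t => - esin s w t) by apply: contN; exact: cs.
have neg (f g : R -> R) x : continuous f -> continuous g ->
    itg 0 T (fun t => f t * g t) = x -> itg 0 T (fun t => f t * - g t) = - x.
  move=> cf cg' <-; rewrite -mulN1r -itgZ; last exact: contM.
  by apply: eq_itg => t _; rewrite mulN1r mulrN.
split.
- rewrite -[RHS]addr0.
  rewrite -(@itg_split2 (fun t => ecos (sg m) (om m) t * ecos (- sg n) (om n) t)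
    (G n) (ecos r (om m - om n)) (ecos r (om m + om n)) _ _ cg _ _ _ mc pc)//.
  + by apply: eq_itg => t _; rewrite /psic; ring.
  + by move=> t; rewrite ecosM.
- rewrite -[RHS]addr0.
  rewrite -(@itg_split2 (fun t => esin (sg m) (om m) t * ecos (- sg n) (om n) t)
    (G n) (esin r (om m - om n)) (esin r (om m + om n)) _ _ cg _ _ _ ms ps)//.
  + by apply: eq_itg => t _; rewrite /psic; ring.
  + by move=> t; rewrite esincosM.
- rewrite -[RHS]addr0 -[X in _ + X]oppr0.
  rewrite -(@itg_split2 (fun t => ecos (sg m) (om m) t * esin (- sg n) (om n) t)
    (G n) (esin r (om m + om n)) (fun t => - esin r (om m - om n) t) _ _ cg _ _ _ ps
    (neg _ _ _ cg (cs _ _) ms))//.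
  + by apply: eq_itg => t _; rewrite /psis; ring.
  + by move=> t; rewrite cossinM.
- rewrite -[RHS]addr0 -[X in _ + X]oppr0.
  rewrite -(@itg_split2 (fun t => esin (sg m) (om m) t * esin (- sg n) (om n) t)
    (G n) (ecos r (om m - om n)) (fun t => - ecos r (om m + om n) t) _ _ cg _ _ _ mc
    (neg _ _ _ cg (ce _ _) pc))//.
  + by apply: eq_itg => t _; rewrite /psis; ring.
  + by move=> t; rewrite esinM.
Qed.

Lemma psi_bump : exists K : R, 0 <= K /\ forall n, (0 < n)%N ->
  bump (T / 2) (K / n%:R ^+ 2) (K / n%:R ^+ 2) T (psic n) /\
  bump (T / 2) (K / n%:R ^+ 2) (K / n%:R ^+ 2) T (psis n).
Proof.
have T2 : 0 < T / 2 by rewrite divr_gt0.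
have [K [K0 HK]] := expR_sg_decay halpha hrho T2.
have [bG1 _ _ _] := @HG 1%N isT.
have L0 : 0 <= L.
  by case: bG1 => LF _ _ _; have := le_trans (normr_ge0 _) (LF 1 0);
     rewrite subr0 normr1 mulr1.
have M0 : 0 <= M by case: bG1 => _ MG _ _; exact: le_trans (MG 0).
have L2M : 0 <= L + 2 * M by rewrite addr_ge0// mulr_ge0.
have LM0 : 0 <= 2 * (K * (L + 2 * M)) by rewrite !mulr_ge0// ltW.
exists (2 * (K * (L + 2 * M))); split => // n n0.
have [bG _ _ _] := HG n0.
have := bump_mul_ecos (om n) bG (sg_ge0 alpha hrho n).
move: (HK n n0); set e := expR _ => eK [bc bs].
have n1 : 1 <= n%:R :> R by rewrite ler1n.
have n2 : 1 <= n%:R ^+ 2 :> R by rewrite exprn_ege1.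
have e0 : 0 <= e by exact: expR_ge0.
have eK2 : e * n%:R ^+ 2 <= K / n%:R ^+ 2.
  apply: le_trans (ler_wpM2r _ eK) _; first by rewrite exprn_ge0.
  rewrite -[4%N]/(2 * 2)%N exprM le_eqVlt; apply/orP; left; apply/eqP.
  by field; rewrite pnatr_eq0 -lt0n.
have so : sg n + `|om n| <= 2 * n%:R ^+ 2.
  rewrite (gtr0_norm (om_gt0 halpha hrho n0)).
  by have := sg_le halpha hrho n0; have := om_le halpha hrho n0; lra.
have le1 : L * e + M * ((sg n + `|om n|) * e) <= K * (L + 2 * M) / n%:R ^+ 2.
  rewrite [leRHS]mulrAC.
  apply: le_trans (_ : (e * n%:R ^+ 2) * (L + 2 * M) <= _); last by rewrite ler_wpM2r.
  rewrite mulrDr; apply: lerD.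
    by rewrite mulrC ler_wpM2r// ler_peMr.
  rewrite (_ : _ * (2 * M) = M * ((2 * n%:R ^+ 2) * e)); last by ring.
  by rewrite ler_wpM2l// ler_wpM2r.
have le2 : M * e <= K * (L + 2 * M) / n%:R ^+ 2.
  rewrite [leRHS]mulrAC.
  apply: le_trans (_ : (e * n%:R ^+ 2) * (L + 2 * M) <= _); last by rewrite ler_wpM2r.
  rewrite mulrC; apply: ler_pM => //; first by rewrite ler_peMr.
  by lra.
split; [have := bumpZ 2 bc|have := bumpZ 2 bs]; rewrite ger0_norm//;
  by apply: bumpLM; rewrite -[leRHS]mulrA ler_wpM2l.
Qed.

(** A sup bound on the prescribed moments is enough: the bounds of the biorthogonal functions decay
    like n^(-2), so the series converges absolutely in Lipschitz norm. *)
Lemma moment_problem_aux : exists C : R, 0 <= C /\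
  forall (D : R) (al be : nat -> R), 0 <= D ->
  (forall n, (0 < n)%N -> `|al n| <= D /\ `|be n| <= D) ->
  exists f : R -> R, bump (T / 2) (C * D) (C * D) T f /\
    forall n, (0 < n)%N ->
      itg 0 T (fun t => f t * ecos (sg n) (om n) t) = al n /\
      itg 0 T (fun t => f t * esin (sg n) (om n) t) = be n.
Proof.
have [K [K0 HK]] := psi_bump.
(* A factor 2 for the cosine and sine parts, and a factor 2 from [sum_inv_sqr_le]. *)
exists (4 * K); split; first by rewrite mulr_ge0.
move=> D al be D0 abD.
pose term n t := al n * psic n t + be n * psis n t.
pose F N t := \sum_(1 <= n < N.+1) term n t.
have bterm n : (0 < n)%N ->
    bump (T / 2) (2 * K * D / n%:R ^+ 2) (2 * K * D / n%:R ^+ 2) T (term n).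
  move=> n0; have [aD bD] := abD n n0; have [bc bs] := HK n n0.
  have Kn : 0 <= K / n%:R ^+ 2 by rewrite divr_ge0// exprn_ge0.
  have E : `|al n| * (K / n%:R ^+ 2) + `|be n| * (K / n%:R ^+ 2) <=
      2 * K * D / n%:R ^+ 2.
    rewrite (_ : 2 * K * D / n%:R ^+ 2 =
      D * (K / n%:R ^+ 2) + D * (K / n%:R ^+ 2)); last by ring.
    by apply: lerD; rewrite ler_wpM2r.
  exact: (bumpLM E E (bumpD (bumpZ (al n) bc) (bumpZ (be n) bs))).
have KD : 0 <= 2 * K * D by rewrite !mulr_ge0.
have sumK N : \sum_(1 <= n < N.+1) (2 * K * D / n%:R ^+ 2) <= 4 * K * D.
  rewrite -mulr_sumr (_ : 4 * K * D = 2 * K * D * 2); last by ring.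
  by rewrite ler_wpM2l// sum_inv_sqr_le.
have bF N : bump (T / 2) (4 * K * D) (4 * K * D) T (F N).
  by apply: bumpLM (bump_sum N bterm); exact: sumK.
have [|||f [e [e0 fe fF]]] := @dominated_telescope_lim R R F
    (fun N => \sum_(1 <= n < N.+1) (2 * K * D / n%:R ^+ 2)) (4 * K * D).
- exact: sumK.
- by move=> N; rewrite [leRHS]big_nat_recr//= lerDl divr_ge0// exprn_ge0.
- move=> N t; rewrite /F [\sum_(1 <= n < N.+2) term n t]big_nat_recr//.
  rewrite [\sum_(1 <= n < N.+2) (_ / _)]big_nat_recr//=.
  rewrite addrAC subrr add0r addrAC subrr add0r.
  by have [_ H _ _] := bterm N.+1 isT; exact: H.
have bf : bump (T / 2) (4 * K * D) (4 * K * D) T f by exact: bump_lim bF fF.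
exists f; split=> // n n0.
have cF N := bump_cont (bF N).
have cterm m : (0 < m)%N -> continuous (term m) by move=> /bterm; exact: bump_cont.
have cpc m : (0 < m)%N -> continuous (psic m) by move=> /HK[/bump_cont].
have cps m : (0 < m)%N -> continuous (psis m) by move=> /HK[_ /bump_cont].
have itgF (g : R -> R) N : continuous g -> itg 0 T (fun t => F N t * g t) =
    \sum_(1 <= m < N.+1) (al m * itg 0 T (fun t => psic m t * g t) +
                          be m * itg 0 T (fun t => psis m t * g t)).
  move=> cg; elim: N => [|N IH].
    by rewrite big_geq//; apply: itg_eq0 => t _; rewrite /F big_geq// mul0r.
  have c1 := contM (cpc N.+1 isT) cg; have c2 := contM (cps N.+1 isT) cg.
  have c1' := @contZ _ (al N.+1) _ c1; have c2' := @contZ _ (be N.+1) _ c2.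
  have c3 := contD c1' c2'; have c4 := contM (@cF N) cg.
  rewrite big_nat_recr//= -IH -(itgZ _ _ _ c1) -(itgZ _ _ _ c2) -(itgD _ _ c1' c2').
  rewrite -(itgD _ _ c4 c3).
  by apply: eq_itg => t _; rewrite /F big_nat_recr//= /term; ring.
have pick (c : nat -> R) N : (n <= N)%N ->
    \sum_(1 <= m < N.+1) c m * (n == m)%:R = c n.
  move=> nN; rewrite (bigD1_seq n) ?mem_index_iota ?iota_uniq ?n0//=.
  rewrite eqxx mulr1 big1 ?addr0// => m /negbTE; rewrite eq_sym => ->.
  by rewrite mulr0.
split.
- apply: (itg_unif_lim cF (bump_cont bf) (@cont_ecos _ _ _) e0 fe).
  near=> N; rewrite itgF; last exact: cont_ecos.
  rewrite -[RHS](@pick al N); last by near: N; exact: nbhs_infty_ge.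
  apply: eq_big_nat => m /andP[m0 _].
  by have [-> _ -> _] := psi_moments m0 n0; rewrite mulr0 addr0.
- apply: (itg_unif_lim cF (bump_cont bf) (@cont_esin _ _ _) e0 fe).
  near=> N; rewrite itgF; last exact: cont_esin.
  rewrite -[RHS](@pick be N); last by near: N; exact: nbhs_infty_ge.
  apply: eq_big_nat => m /andP[m0 _].
  by have [_ -> _ ->] := psi_moments m0 n0; rewrite mulr0 add0r.
Unshelve. all: by end_near. Qed.

End moment_problem.

Lemma moment_problem {R : realType} (alpha rho T : R) :
  0 < alpha < 1 -> 0 < rho < 2 -> 0 < T -> exists C : R, 0 <= C /\
  forall (D : R) (al be : nat -> R), 0 <= D ->
  (forall n, (0 < n)%N -> `|al n| <= D /\ `|be n| <= D) ->
  exists f : R -> R, bump (T / 2) (C * D) (C * D) T f /\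
    forall n, (0 < n)%N ->
      itg 0 T (fun t => f t * ecos (sg alpha rho n) (om alpha rho n) t) = al n /\
      itg 0 T (fun t => f t * esin (sg alpha rho n) (om alpha rho n) t) = be n.
Proof.
move=> halpha hrho hT.
have [L [M H]] := biorthogonal_multipliers halpha hrho hT.
have [n|G HG] := @choice nat (R -> R) (fun n G => (0 < n)%N -> [/\
    bump (T / 2) L M T G, itg 0 T G = 1,
    forall m, (0 < m)%N -> kills T G (sg alpha rho m - sg alpha rho n) (om alpha rho m + om alpha rho n) &
    forall m, (0 < m)%N -> m != n -> kills T G (sg alpha rho m - sg alpha rho n) (om alpha rho m - om alpha rho n)]).
  have [n0|] := boolP (0 < n)%N; last by exists (fun=> 0).
  by have [G HG] := H n n0; exists G.
exact: (moment_problem_aux halpha hrho hT HG).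
Qed.

(** * Damped modes *)

Section deriv_on_theory.
Context {R : realType}.
Implicit Types (g dg : R -> R) (t s x y c r w tau : R).

Lemma deriv_onP tau g dg : deriv_on tau g dg <->
  forall t, t \in `[0, tau] -> forall e : R, 0 < e -> exists2 d : R, 0 < d &
    forall s, s \in `[0, tau] -> s != t -> `|s - t| < d ->
      `|dg t - (s - t)^-1 * (g s - g t)| <= e.
Proof.
split=> H t tI.
  move=> e e0; have /cvgrPdist_le /(_ _ e0) := H t tI.
  rewrite near_withinE => -[d /= d0 Hd]; exists d => // s sI st sd.
  by apply: Hd => //=; rewrite distrC.
apply/cvgrPdist_le => /= e e0; have [d d0 Hd] := H t tI e e0.
rewrite near_withinE; exists d => //= s /= sd st sI.
by apply: Hd => //; rewrite distrC.
Qed.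

Lemma deriv_on_interior tau g dg t : deriv_on tau g dg -> t \in `]0, tau[ ->
  is_derive t (1 : R) g (dg t).
Proof.
move=> /deriv_onP H; rewrite in_itv/= => /andP[t0 tt].
have h : (fun h : R => h^-1 *: (g (h *: 1 + t) - g t)) @ 0^' --> dg t.
  apply/cvgrPdist_le => /= e e0.
  have [|d d0 Hd] := H t _ e e0; first by rewrite in_itv/= !ltW.
  exists (Num.min d (Num.min t (tau - t))) => /=.
    by rewrite !lt_min d0 t0 subr_gt0.
  move=> h /=; rewrite sub0r normrN !lt_min => /and3P[hd ht htau] h0.
  have hE : h *: 1 + t = h + t by rewrite /GRing.scale/= mulr1.
  rewrite hE; have := Hd (h + t); rewrite addrK; apply => //.
    move: ht htau; rewrite !ltr_norml in_itv/= => /andP[a1 a2] /andP[b1 b2].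
    by apply/andP; split; lra.
  by rewrite -subr_eq0 addrK.
apply: DeriveDef; first by apply/cvg_ex; exists (dg t).
exact: cvg_lim h.
Qed.

Lemma deriv_on_continuous tau g dg : deriv_on tau g dg ->
  {within `[0, tau], continuous g}.
Proof.
move=> /deriv_onP H; apply/subspace_continuousP => t /= tI.
have [d d0 Hd] := H t tI 1 ltr01.
have K0 : 0 < `|dg t| + 1 by rewrite ltr_wpDl.
apply/cvgrPdist_le => /= e e0.
rewrite near_withinE; exists (Num.min d (e / (`|dg t| + 1))) => /=.
  by rewrite lt_min d0 divr_gt0.
move=> s /=; rewrite lt_min => /andP[sd se] sI.
have [->|st] := eqVneq s t; first by rewrite subrr normr0 ltW.
rewrite distrC in sd se.
have := Hd s sI st sd.
have st0 : s - t != 0 by rewrite subr_eq0.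
set q := _^-1 * _ => hq.
have -> : g t - g s = - ((s - t) * q) by rewrite /q mulVKf// opprB.
have q1 : `|q| <= `|dg t| + 1.
  rewrite -[q](subrK (dg t)) addrC (le_trans (ler_normD _ _))//.
  by rewrite lerD2l distrC.
rewrite normrN normrM; apply: le_trans (_ : e / (`|dg t| + 1) * (`|dg t| + 1) <= _).
  by apply: ler_pM => //; exact: ltW.
by rewrite divfK// lt0r_neq0.
Qed.

Lemma is_derive_deriv_on tau g dg :
  (forall t, is_derive t (1 : R) g (dg t)) -> deriv_on tau g dg.
Proof.
move=> H; apply/deriv_onP => t tI e e0.
have [cg lg] := H t; move: cg => /cvg_ex[l hl].
have El : l = dg t by rewrite -lg; symmetry; exact: cvg_lim hl.
move: hl; rewrite El => /cvgrPdist_le /(_ _ e0) [d /= d0 Hd].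
exists d => // s sI st sd.
have := Hd (s - t); rewrite /= sub0r normrN subr_eq0 => /(_ sd st).
by rewrite /GRing.scale/= mulr1 subrK.
Qed.

Lemma cst_on_segment tau (D : R -> R) :
  {within `[0, tau], continuous D} ->
  (forall t, t \in `]0, tau[ -> is_derive t (1 : R) D 0) ->
  forall t, t \in `[0, tau] -> D t = D tau.
Proof.
move=> cD dD t; rewrite in_itv/= => /andP[t0 ttau].
have dd x : x \in `]t, tau[ -> is_derive x (1 : R) D ((fun=> 0) x).
  rewrite in_itv/= => /andP[tx xt]; apply: dD.
  by rewrite in_itv/= xt (le_lt_trans t0).
have cc : {within `[t, tau], continuous D}.
  apply: continuous_subspaceW cD => x /=; rewrite !in_itv/= => /andP[tx ->].
  by rewrite (le_trans t0).
have [c _] := MVT_segment ttau dd cc.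
by rewrite mul0r => /eqP; rewrite subr_eq0 => /eqP.
Qed.

Lemma is_derive_shifted g dg c t : (forall x, is_derive x (1 : R) g (dg x)) ->
  is_derive t (1 : R) (fun x => g (x + c)) (dg (t + c)).
Proof.
move=> H; rewrite -[dg _]mulr1.
exact: (@is_derive1_comp R g (shift c) t _ 1 (H _) (is_derive_shift _ _ _)).
Qed.

Lemma is_derive_add (f g : R -> R) (df dg0 t : R) : is_derive t (1 : R) f df ->
  is_derive t (1 : R) g dg0 -> is_derive t (1 : R) (fun x => f x + g x) (df + dg0).
Proof. by move=> h1 h2; exact: is_deriveD. Qed.

Lemma is_derive_sub (f g : R -> R) (df dg0 t : R) : is_derive t (1 : R) f df ->
  is_derive t (1 : R) g dg0 -> is_derive t (1 : R) (fun x => f x - g x) (df - dg0).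
Proof. by move=> h1 h2; exact: is_deriveB. Qed.

Lemma is_derive_scale (f : R -> R) (k df t : R) : is_derive t (1 : R) f df ->
  is_derive t (1 : R) (fun x => k * f x) (k * df).
Proof. by move=> h1; exact: is_deriveZ. Qed.

Lemma within_contM tau (f g : R -> R) : {within `[0, tau], continuous f} ->
  {within `[0, tau], continuous g} ->
  {within `[0, tau], continuous (fun x => f x * g x)}.
Proof. by move=> cf cg x; apply: cvgM; [exact: cf|exact: cg]. Qed.

Lemma within_contB tau (f g : R -> R) : {within `[0, tau], continuous f} ->
  {within `[0, tau], continuous g} ->
  {within `[0, tau], continuous (fun x => f x - g x)}.
Proof. by move=> cf cg x; apply: cvgB; [exact: cf|exact: cg]. Qed.

Lemma within_contD tau (f g : R -> R) : {within `[0, tau], continuous f} ->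
  {within `[0, tau], continuous g} ->
  {within `[0, tau], continuous (fun x => f x + g x)}.
Proof. by move=> cf cg x; apply: cvgD; [exact: cf|exact: cg]. Qed.

(* Undamping and unrotating the first-order system [w' = s w + o v],          *)
(* [v' = s v - o w] gives two constants of motion.                            *)
Lemma rotation_system (tau s o : R) (w v : R -> R) :
  {within `[0, tau], continuous w} -> {within `[0, tau], continuous v} ->
  (forall t, t \in `]0, tau[ -> is_derive t (1 : R) w (s * w t + o * v t)) ->
  (forall t, t \in `]0, tau[ -> is_derive t (1 : R) v (s * v t - o * w t)) ->
  forall t, t \in `[0, tau] ->
    w t = w tau * ecos s o (t - tau) + v tau * esin s o (t - tau) /\
    v t = v tau * ecos s o (t - tau) - w tau * esin s o (t - tau).
Proof.
move=> cw cv dw dv.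
pose ec t := ecos (- s) o (t - tau); pose es t := esin (- s) o (t - tau).
have dec t : is_derive t (1 : R) ec (- s * ec t - o * es t).
  exact: (is_derive_shifted (- tau) t (is_derive_ecos (- s) o)).
have des t : is_derive t (1 : R) es (- s * es t + o * ec t).
  exact: (is_derive_shifted (- tau) t (is_derive_esin (- s) o)).
have cec := continuous_subspaceT (A := `[0, tau]) (is_derive_continuous dec).
have ces := continuous_subspaceT (A := `[0, tau]) (is_derive_continuous des).
have c1 := within_contB (within_contM cw cec) (within_contM cv ces).
have c2 := within_contD (within_contM cw ces) (within_contM cv cec).
have d1 t : t \in `]0, tau[ ->
    is_derive t (1 : R) (fun x => w x * ec x - v x * es x) 0.
  move=> tI; have := is_derive_sub (is_derive_mul (dw t tI) (dec t))
    (is_derive_mul (dv t tI) (des t)).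
  by congr (is_derive _ _ _ _); ring.
have d2 t : t \in `]0, tau[ ->
    is_derive t (1 : R) (fun x => w x * es x + v x * ec x) 0.
  move=> tI; have := is_derive_add (is_derive_mul (dw t tI) (des t))
    (is_derive_mul (dv t tI) (dec t)).
  by congr (is_derive _ _ _ _); ring.
move=> t tI; have := cst_on_segment c1 d1 tI; have := cst_on_segment c2 d2 tI.
rewrite /= /ec /es !subrr ecos0 esin0 !mulr1 !mulr0 add0r subr0 => e2 e1.
(* [E] and [E2] are the real and imaginary parts of the statement that e^((s + i o) x) times the
   conjugate of e^((- s + i o) x) is 1. *)
have E : ecos s o (t - tau) * ecos (- s) o (t - tau) +
         esin s o (t - tau) * esin (- s) o (t - tau) = 1.
  have := cos2Dsin2 (o * (t - tau)) => h.
  transitivity ((expR (s * (t - tau)) * expR (- (s * (t - tau)))) *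
    (cos (o * (t - tau)) ^+ 2 + sin (o * (t - tau)) ^+ 2)).
    by rewrite /ecos /esin mulNr; ring.
  by rewrite expRxMexpNx_1 h mulr1.
have E2 : ecos s o (t - tau) * esin (- s) o (t - tau) =
         esin s o (t - tau) * ecos (- s) o (t - tau).
  by rewrite /ecos /esin mulNr; ring.
rewrite -e1 -e2; move: E E2.
move: (ecos s o _) (esin s o _) (ecos (- s) o _) (esin (- s) o _) => a b c d E E2.
split.
  by rewrite (_ : _ + _ = w t * (a * c + b * d) + v t * (b * c - a * d));
    [rewrite E E2 subrr|]; ring.
by rewrite (_ : _ - _ = v t * (a * c + b * d) + w t * (a * d - b * c));
    [rewrite E E2 subrr|]; ring.
Qed.

End deriv_on_theory.

(** * Forced modes and cancellation over half periods *)

Section forced_oscillation.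
Context {R : realType}.
Implicit Types (f g : R -> R) (t x y k s o L M p : R).

(** Variation of constants, with [y] the scaled velocity (x' + s x) / o. Once damping and rotation
    are undone, the amplitudes [P] and [Q] move only under the forcing, so the state at a given time
    vanishes when two moments of [f] have the right values. *)
Lemma forced_mode s o k x0 y0 f : continuous f ->
  exists x y : R -> R, [/\ x 0 = x0 /\ y 0 = y0,
    forall t, is_derive t (1 : R) x (- s * x t + o * y t),
    forall t, is_derive t (1 : R) y (- s * y t - o * x t + k * f t) &
    forall t, 0 <= t ->
      let S := itg 0 t (fun z => f z * esin s o z) in
      let C := itg 0 t (fun z => f z * ecos s o z) in
      x t = (x0 - k * S) * ecos (- s) o t + (y0 + k * C) * esin (- s) o t /\
      y t = (y0 + k * C) * ecos (- s) o t - (x0 - k * S) * esin (- s) o t].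
Proof.
move=> cf.
have [S dS SE] := itg_antiderivative (contM cf (@cont_esin _ s o)).
have [C dC CE] := itg_antiderivative (contM cf (@cont_ecos _ s o)).
pose P t := x0 - k * (S t - S 0); pose Q t := y0 + k * (C t - C 0).
have dP t : is_derive t (1 : R) P (- (k * (f t * esin s o t))).
  have := is_derive_sub (is_derive_cst x0 t 1) (is_derive_scale k
    (is_derive_sub (dS t) (is_derive_cst (S 0) t 1))).
  by congr (is_derive _ _ _ _); ring.
have dQ t : is_derive t (1 : R) Q (k * (f t * ecos s o t)).
  have := is_derive_add (is_derive_cst y0 t 1) (is_derive_scale k
    (is_derive_sub (dC t) (is_derive_cst (C 0) t 1))).
  by congr (is_derive _ _ _ _); ring.
have dec := is_derive_ecos (- s) o; have des := is_derive_esin (- s) o.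
have E t : ecos s o t * ecos (- s) o t + esin s o t * esin (- s) o t = 1.
  transitivity ((expR (s * t) * expR (- (s * t))) *
    (cos (o * t) ^+ 2 + sin (o * t) ^+ 2)).
    by rewrite /ecos /esin mulNr; ring.
  by rewrite expRxMexpNx_1 cos2Dsin2 mulr1.
have E2 t : ecos s o t * esin (- s) o t = esin s o t * ecos (- s) o t.
  by rewrite /ecos /esin mulNr; ring.
exists (fun t => P t * ecos (- s) o t + Q t * esin (- s) o t).
exists (fun t => Q t * ecos (- s) o t - P t * esin (- s) o t).
split.
- by rewrite ecos0 esin0 /P /Q !subrr !mulr0 subr0 !addr0 subr0 !mulr1.
- move=> t; have := is_derive_add (is_derive_mul (dP t) (dec t))
    (is_derive_mul (dQ t) (des t)).
  congr (is_derive _ _ _ _); have := E2 t.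
  move: (ecos s o t) (esin s o t) (ecos (- s) o t) (esin (- s) o t) => a b c d h.
  apply/eqP; rewrite -subr_eq0; apply/eqP.
  transitivity (k * f t * (a * d - b * c)); first by ring.
  by rewrite h subrr mulr0.
- move=> t; have := is_derive_sub (is_derive_mul (dQ t) (dec t))
    (is_derive_mul (dP t) (des t)).
  congr (is_derive _ _ _ _); have := E t.
  move: (ecos s o t) (esin s o t) (ecos (- s) o t) (esin (- s) o t) => a b c d h.
  apply/eqP; rewrite -subr_eq0; apply/eqP.
  transitivity (k * f t * (a * c + b * d - 1)); first by ring.
  by rewrite h subrr mulr0.
- by move=> t t0 S' C'; rewrite /S' /C' (SE _ _ t0) (CE _ _ t0).
Qed.

(* Cancellation over half periods: [g] changes sign, up to the damping        *)
(* factor, under the shift by [p].                                            *)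
Lemma half_period_bound s p L M f g t : 0 <= s -> 0 <= p -> 0 <= t ->
  continuous g -> (forall z, g (z + p) = - (expR (s * p) * g z)) ->
  (forall z, `|g z| <= expR (s * z)) ->
  (forall x y, `|f x - f y| <= L * `|x - y|) -> (forall x, `|f x| <= M) ->
  `|itg 0 t (fun z => f z * g z)| <= expR (s * t) * (p * (t * L + 2 * M)).
Proof.
move=> s0 p0 t0 cg gp ge LF MF; have cf := lipschitz_cont LF.
have M0 : 0 <= M by exact: le_trans (MF 0).
have L0 : 0 <= L.
  by have := le_trans (normr_ge0 _) (LF 1 0); rewrite subr0 normr1 mulr1.
have cfg := contM cf cg.
have ch : continuous (fun z => f (z + p) * g z).
  by apply: contM => //; exact: cont_shift.
set I := itg _ _ _.
have [H _ HE] := itg_antiderivative ch.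
pose q := expR (- (s * p)); have q0 : 0 < q by exact: expR_gt0.
have qI : q * I = - itg (- p) (t - p) (fun z => f (z + p) * g z).
  have ptp : - p <= t - p by rewrite lerBrDl subrr.
  have IE : I = itg (- p) (t - p) (fun z => f (z + p) * g (z + p)).
    by have := @itg_shift _ (- p) (t - p) p _ cfg ptp; rewrite addNr subrK => ->.
  have cs : continuous (fun z => f (z + p) * g (z + p)) by exact: (cont_shift cfg).
  rewrite IE -(itgZ _ _ _ cs) -[RHS]mulN1r -(itgZ _ _ _ ch).
  apply: eq_itg => z _; rewrite gp.
  transitivity (- (expR (s * p) * q) * (f (z + p) * g z)); first by ring.
  by rewrite /q expRxMexpNx_1.
(* Adding [q * I], a translated copy of [I], replaces [f z] by the difference [f z - f (z + p)], of
   size at most [L * p], up to two boundary intervals of length [p]. The factor [1 + q >= 1] can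
   then be dropped. *)
have key : (1 + q) * I = itg 0 t (fun z => f z * g z - f (z + p) * g z) +
    (itg (t - p) t (fun z => f (z + p) * g z) -
     itg (- p) 0 (fun z => f (z + p) * g z)).
  rewrite itgB// mulrDl mul1r qI -/I !HE//.
  - ring.
  - by rewrite oppr_le0.
  - by rewrite lerBlDr lerDl.
  - by rewrite lerBrDl subrr.
have et0 : 0 <= expR (s * t) by exact: expR_ge0.
have mono z : z <= t -> expR (s * z) <= expR (s * t).
  by move=> zt; rewrite ler_expR ler_wpM2l.
have hb z : z <= t -> `|f (z + p) * g z| <= M * expR (s * t).
  move=> zt; rewrite normrM ler_pM//.
  by apply: le_trans (ge z) _; exact: mono.
have b1 : `|itg 0 t (fun z => f z * g z - f (z + p) * g z)| <=
    L * p * expR (s * t) * t.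
  rewrite -[X in _ * X](subr0 t); apply: itg_norm_le => //; first exact: contB.
  move=> z; rewrite in_itv/= => /andP[z0 zt]; rewrite -mulrBl normrM ler_pM//.
    apply: le_trans (LF _ _) _.
    by rewrite opprD addrA subrr sub0r normrN ger0_norm.
  by apply: le_trans (ge z) _; exact: mono.
have b2 : `|itg (t - p) t (fun z => f (z + p) * g z)| <= M * expR (s * t) * p.
  rewrite -[X in _ <= _ * X](subKr t p); apply: itg_norm_le => //.
    by rewrite lerBlDr lerDl.
  by move=> z; rewrite in_itv/= => /andP[z0 zt]; exact: hb.
have b3 : `|itg (- p) 0 (fun z => f (z + p) * g z)| <= M * expR (s * t) * p.
  rewrite -[X in _ <= _ * X]opprK -[X in _ <= _ * X]sub0r.
  apply: itg_norm_le => //; first by rewrite oppr_le0.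
  by move=> z; rewrite in_itv/= => /andP[z0 zt]; apply: hb; exact: le_trans t0.
apply: le_trans (_ : (1 + q) * `|I| <= _).
  by rewrite ler_peMl// lerDl ltW.
rewrite -{1}(gtr0_norm (_ : 0 < 1 + q)) ?addr_gt0// -normrM key.
apply: le_trans (ler_normD _ _) _; apply: le_trans (lerD b1 (ler_normB _ _)) _.
apply: le_trans (lerD (lexx _) (lerD b2 b3)) _.
by rewrite le_eqVlt; apply/orP; left; apply/eqP; ring.
Qed.

Lemma ecos_half_period s o z : 0 < o ->
  ecos s o (z + pi / o) = - (expR (s * (pi / o)) * ecos s o z).
Proof.
move=> o0; rewrite ecosD /ecos /esin.
have -> : o * (pi / o) = pi by rewrite mulrC divfK// lt0r_neq0.
by rewrite cospi sinpi; ring.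
Qed.

Lemma esin_half_period s o z : 0 < o ->
  esin s o (z + pi / o) = - (expR (s * (pi / o)) * esin s o z).
Proof.
move=> o0; rewrite esinD /ecos /esin.
have -> : o * (pi / o) = pi by rewrite mulrC divfK// lt0r_neq0.
by rewrite cospi sinpi; ring.
Qed.

(** The growth e^(s t) of the moments cancels the damping of the homogeneous solution, and the half
    period [pi / o] remains as a gain. *)
Lemma forced_mode_bound s o k x0 y0 L M f t T : 0 <= s -> 0 < o ->
  (forall x y, `|f x - f y| <= L * `|x - y|) -> (forall x, `|f x| <= M) ->
  0 <= t <= T ->
  let S := itg 0 t (fun z => f z * esin s o z) in
  let C := itg 0 t (fun z => f z * ecos s o z) in
  let B := `|x0| + `|y0| + 2 * (`|k| * (pi / o * (T * L + 2 * M))) in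
  `|(x0 - k * S) * ecos (- s) o t + (y0 + k * C) * esin (- s) o t| <= B /\
  `|(y0 + k * C) * ecos (- s) o t - (x0 - k * S) * esin (- s) o t| <= B.
Proof.
move=> s0 o0 LF MF /andP[t0 tT] S C B.
have L0 : 0 <= L.
  by have := le_trans (normr_ge0 _) (LF 1 0); rewrite subr0 normr1 mulr1.
have p0 : 0 <= pi / o by rewrite divr_ge0 ?pi_ge0// ltW.
have hS : `|S| <= expR (s * t) * (pi / o * (t * L + 2 * M)).
  apply: half_period_bound => //; [exact: cont_esin| |exact: norm_esin_le].
  by move=> z; exact: esin_half_period.
have hC : `|C| <= expR (s * t) * (pi / o * (t * L + 2 * M)).
  apply: half_period_bound => //; [exact: cont_ecos| |exact: norm_ecos_le].
  by move=> z; exact: ecos_half_period.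
have e1 : expR (- s * t) <= 1.
  by rewrite mulNr -expR0 ler_expR oppr_le0 mulr_ge0.
have hb (h I : R) : `|h| <= expR (- s * t) ->
    `|I| <= expR (s * t) * (pi / o * (t * L + 2 * M)) ->
    `|k * I * h| <= `|k| * (pi / o * (T * L + 2 * M)).
  move=> hh hI; rewrite -mulrA normrM ler_wpM2l// normrM.
  apply: le_trans (ler_pM (normr_ge0 _) (normr_ge0 _) hI hh) _.
  rewrite mulrAC mulNr expRxMexpNx_1 mul1r ler_wpM2l// lerD2r.
  by rewrite ler_wpM2r.
have hc := norm_ecos_le (- s) o t; have hs := norm_esin_le (- s) o t.
have hx (h z : R) : `|h| <= expR (- s * t) -> `|z * h| <= `|z|.
  by move=> hh; rewrite normrM ler_piMr// (le_trans hh).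
have four (a b c d A1 A2 A3 : R) : `|a| <= A1 -> `|b| <= A2 -> `|c| <= A3 ->
    `|d| <= A3 -> `|a + b + c + d| <= A1 + A2 + 2 * A3.
  move=> ha hb' hc' hd; rewrite mulrDl mul1r addrA.
  apply: le_trans (ler_normD _ _) (lerD _ hd).
  apply: le_trans (ler_normD _ _) (lerD _ hc').
  exact: le_trans (ler_normD _ _) (lerD ha hb').
split.
- rewrite (_ : _ + _ = x0 * ecos (- s) o t + y0 * esin (- s) o t +
    - (k * S * ecos (- s) o t) + k * C * esin (- s) o t); last by ring.
  by apply: four; rewrite ?normrN; [exact: hx|exact: hx|exact: hb|exact: hb].
- rewrite (_ : _ - _ = - (x0 * esin (- s) o t) + y0 * ecos (- s) o t +
    k * C * ecos (- s) o t + k * S * esin (- s) o t); last by ring.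
  by apply: four; rewrite ?normrN; [exact: hx|exact: hx|exact: hb|exact: hb].
Qed.

(** The form [v x - w y] has derivative [- k w f], as damping and rotation of [(w, v)] cancel those
    of [(x, y)]. Up to the factor [om n] this is the weak identity for one mode. *)
Lemma duality_mode s o k tau f (w v x y : R -> R) : 0 <= tau ->
  continuous f ->
  (forall t, is_derive t (1 : R) w (s * w t + o * v t)) ->
  (forall t, is_derive t (1 : R) v (s * v t - o * w t)) ->
  (forall t, is_derive t (1 : R) x (- s * x t + o * y t)) ->
  (forall t, is_derive t (1 : R) y (- s * y t - o * x t + k * f t)) ->
  (v tau * x tau - w tau * y tau) - (v 0 * x 0 - w 0 * y 0) =
  - (k * itg 0 tau (fun t => w t * f t)).
Proof.
move=> tau0 cf dw dv dx dy; have cw := is_derive_continuous dw.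
have cwf := contM cw cf.
have -> : - (k * itg 0 tau (fun t => w t * f t)) =
    itg 0 tau (fun t => - k * (w t * f t)) by rewrite (itgZ _ _ _ cwf) mulNr.
symmetry; apply: (@itg_FTC R (fun t => v t * x t - w t * y t)) => //.
  exact: contZ.
move=> t; have := is_derive_sub (is_derive_mul (dv t) (dx t))
  (is_derive_mul (dw t) (dy t)).
by congr (is_derive _ _ _ _); ring.
Qed.

End forced_oscillation.

(** * Weighted sequence spaces and square integrable functions *)

Section weighted_l2.
Context {R : realType}.
Implicit Types (p K : R) (a d : nat -> R).

Definition psumX p a (N : nat) : R :=
  \sum_(1 <= n < N) n%:R `^ (2 * p) * `|a n| ^+ 2.

Lemma wterm_ge0 p a n : 0 <= n%:R `^ (2 * p) * `|a n| ^+ 2 :> R.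
Proof. by rewrite mulr_ge0 ?powR_ge0 ?exprn_ge0. Qed.

Lemma psumX_E p a N : (psumX p a N)%:E =
  (\sum_(1 <= n < N) (n%:R `^ (2 * p) * `|a n| ^+ 2)%:E)%E.
Proof. by rewrite /psumX -sumEFin. Qed.

Lemma psumX_le p a N N' : (N <= N')%N -> psumX p a N <= psumX p a N'.
Proof.
move=> NN; elim: N' NN => [|N' IH]; first by rewrite leqn0 => /eqP->.
rewrite leq_eqVlt => /predU1P[->//|]; rewrite ltnS => /IH/le_trans; apply.
case: N' {IH} => [|N']; first by rewrite /psumX !big_geq.
by rewrite /psumX [leRHS]big_nat_recr//= lerDl wterm_ge0.
Qed.

Lemma psumX_normsq p a N : ((psumX p a N)%:E <= normsqX p a)%E.
Proof.
rewrite psumX_E /normsqX; apply: nneseries_lim_ge => n _ _.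
by rewrite lee_fin wterm_ge0.
Qed.

Lemma normsqX_le p a K : (forall N, psumX p a N <= K) -> (normsqX p a <= K%:E)%E.
Proof.
move=> H; rewrite /normsqX; apply: lime_le.
  by apply: is_cvg_nneseries => n _ _; rewrite lee_fin wterm_ge0.
by apply: nearW => N; rewrite -psumX_E lee_fin.
Qed.

Lemma normsqX_ge0 p a : (0 <= normsqX p a)%E.
Proof. by apply: nneseries_ge0 => n _ _; rewrite lee_fin wterm_ge0. Qed.

Lemma XN0_intro p a K : a 0%N = 0 -> (forall N, psumX p a N <= K) -> XN0 p a.
Proof.
move=> a0 H; split => //; apply: le_lt_trans (normsqX_le H) _; exact: ltry.
Qed.

Lemma normX_le p a K : 0 <= K -> (forall N, psumX p a N <= K ^+ 2) ->
  normX p a <= K.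
Proof.
move=> K0 H; rewrite /normX -[leRHS](ger0_norm K0) -sqrtr_sqr ler_wsqrtr//.
have h := normsqX_le H; rewrite -lee_fin fineK//.
by rewrite ge0_fin_numE ?normsqX_ge0// (le_lt_trans h)// ltry.
Qed.

Lemma normX_ge0 p a : 0 <= normX p a.
Proof. exact: sqrtr_ge0. Qed.

Lemma psumX_le_normX p a N : XN0 p a -> psumX p a N <= normX p a ^+ 2.
Proof.
move=> [_ fa]; rewrite /normX sqr_sqrtr; last by rewrite fine_ge0// normsqX_ge0.
rewrite -lee_fin fineK ?psumX_normsq//.
by rewrite ge0_fin_numE ?normsqX_ge0.
Qed.

Lemma coef_le_normX p a n : XN0 p a -> (0 < n)%N ->
  n%:R `^ p * `|a n| <= normX p a.
Proof.
move=> Xa n0.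
have x0 : 0 <= n%:R `^ p * `|a n| by rewrite mulr_ge0 ?powR_ge0.
rewrite -(@ler_pXn2r _ 2) ?nnegrE ?normX_ge0//.
apply: le_trans (psumX_le_normX n.+1 Xa).
case: n n0 x0 => // n _ _; rewrite /psumX big_nat_recr//=.
rewrite exprMn -[(_ `^ p) ^+ 2]powR_mulrn ?powR_ge0// -powRrM [p * 2]mulrC lerDr.
by apply: sumr_ge0 => k _; exact: wterm_ge0.
Qed.

Lemma psumX_mono p a d N :
  (forall n, (0 < n)%N -> `|a n| <= `|d n|) -> psumX p a N <= psumX p d N.
Proof.
move=> ad; rewrite /psumX big_nat [leRHS]big_nat; apply: ler_sum => n /andP[n0 _].
by rewrite ler_wpM2l ?powR_ge0// lerXn2r ?nnegrE// ad.
Qed.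

Lemma psumX_tail p d K e : (forall N, psumX p d N <= K) -> 0 < e ->
  exists N0, forall N, (N0 <= N)%N -> psumX p d N <= psumX p d N0 + e.
Proof.
move=> H e0.
have nd : nondecreasing_seq (psumX p d) by move=> m n mn; exact: psumX_le.
have cA : cvgn (psumX p d).
  by apply: nondecreasing_is_cvgn => //; exists K => _ [N _ <-].
have /cvgrPdist_le /(_ _ e0) [N0 _ HN] := cA.
exists N0 => N _; have := HN N0 (leqnn _); rewrite ger0_norm; last first.
  by rewrite subr_ge0; exact: nondecreasing_cvgn_le.
have : psumX p d N <= limn (psumX p d) by exact: nondecreasing_cvgn_le.
by lra.
Qed.

(** Dominated convergence: the tail of [d] beyond some [N0] bounds all tails, and the finitely many
    remaining coefficients converge one by one. Continuity and differentiability in [X^p] are thus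
    reduced to single modes. *)
Lemma normX_dominated_cvg0 p d K (T : Type) (F : set_system T) {FF : Filter F}
    (v : T -> nat -> R) :
  (forall N, psumX p d N <= K) ->
  (\forall s \near F, forall n, (0 < n)%N -> `|v s n| <= `|d n|) ->
  (forall n, (0 < n)%N -> v s n @[s --> F] --> (0 : R)) ->
  normX p (v s) @[s --> F] --> (0 : R).
Proof.
move=> HK vd v0; apply/cvgrPdist_le => /= e e0.
have e2 : 0 < e ^+ 2 / 2 by rewrite divr_gt0// exprn_gt0.
have [N0 HN0] := psumX_tail HK e2.
have head N : psumX p (v s) N @[s --> F] --> (0 : R).
  elim: N => [|[|N] IH].
  - rewrite (_ : (fun s => psumX p (v s) 0) = cst 0); first exact: cvg_cst.
    by apply/funext => s; rewrite /psumX big_geq.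
  - rewrite (_ : (fun s => psumX p (v s) 1) = cst 0); first exact: cvg_cst.
    by apply/funext => s; rewrite /psumX big_geq.
  rewrite (_ : (fun s => psumX p (v s) N.+2) = (fun s => psumX p (v s) N.+1 +
     N.+1%:R `^ (2 * p) * `|v s N.+1| ^+ 2)); last first.
    by apply/funext => s; rewrite /psumX big_nat_recr.
  rewrite -[X in _ --> X]addr0; apply: cvgD; first exact: IH.
  rewrite -[X in _ --> X](mulr0 (N.+1%:R `^ (2 * p))); apply: cvgMr.
  have h := cvg_norm (v0 N.+1 isT); rewrite normr0 in h.
  have h2 := cvgM (h FF) (h FF); rewrite mulr0 in h2.
  by under eq_fun do rewrite expr2; exact: h2.
have /cvgrPdist_le /(_ _ e2) headn := head N0.
apply: filterS2 headn vd => s h1 h2.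
rewrite sub0r normrN ger0_norm ?normX_ge0//; apply: normX_le; first exact: ltW.
move: h1; rewrite sub0r normrN ger0_norm; last first.
  by apply: sumr_ge0 => n _; exact: wterm_ge0.
move=> h1 N; have [NN0|N0N] := leqP N N0.
  by apply: le_trans (psumX_le _ _ NN0) _; lra.
have := HN0 N (ltnW N0N).
(* The sums start at 1, so they can be split at [N0] only when it is positive. *)
have [N00|N00] := posnP N0.
  move=> h3; apply: le_trans (psumX_mono p N h2) _; apply: le_trans h3 _.
  by rewrite N00 /psumX big_geq//; lra.
rewrite /psumX (@big_cat_nat _ _ _ N0 1 N)//=; last exact: ltnW.
move=> h3; rewrite (@big_cat_nat _ _ _ N0 1 N)//=; last exact: ltnW.
have h4 : \sum_(N0 <= n < N) n%:R `^ (2 * p) * `|v s n| ^+ 2 <=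
          \sum_(N0 <= n < N) n%:R `^ (2 * p) * `|d n| ^+ 2.
  rewrite big_nat [leRHS]big_nat; apply: ler_sum => n /andP[n0 _].
  by rewrite ler_wpM2l ?powR_ge0// lerXn2r ?nnegrE// h2// (leq_trans N00).
by move: h1 h3 h4; rewrite /psumX; lra.
Qed.

Lemma psumX_D p a d N : psumX p (fun n => a n + d n) N <=
  2 * (psumX p a N + psumX p d N).
Proof.
rewrite /psumX -big_split/= mulr_sumr; apply: ler_sum => n _.
rewrite -mulrDr [leRHS]mulrCA ler_wpM2l ?powR_ge0//.
rewrite !real_normK ?num_real//; have := sqr_ge0 (a n - d n); nra.
Qed.

Lemma psumX_Z p (k : R) a N : psumX p (fun n => k * a n) N = k ^+ 2 * psumX p a N.
Proof.
rewrite /psumX mulr_sumr; apply: eq_bigr => n _.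
by rewrite normrM exprMn [`|k| ^+ 2]real_normK ?num_real//; ring.
Qed.

Lemma psumX_norm p a N : psumX p (fun n => `|a n|) N = psumX p a N.
Proof. by apply: eq_bigr => n _; rewrite normr_id. Qed.

Lemma psumX_shift p q a b (k : R) N : 
  (forall n, (0 < n)%N -> n%:R `^ p * `|a n| <= k * (n%:R `^ q * `|b n|)) ->
  psumX p a N <= k ^+ 2 * psumX q b N.
Proof.
move=> H; rewrite /psumX mulr_sumr big_nat [leRHS]big_nat.
apply: ler_sum => n /andP[n0 _].
have E (x y : R) : n%:R `^ (2 * x) * y ^+ 2 = (n%:R `^ x * y) ^+ 2.
  by rewrite exprMn -[(_ `^ x) ^+ 2]powR_mulrn ?powR_ge0// -powRrM [x * 2]mulrC.
rewrite (E p) (E q) -exprMn; apply: lerXn2r; rewrite ?nnegrE.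
- by rewrite mulr_ge0 ?powR_ge0.
- exact: le_trans (H n n0).
- exact: H.
Qed.

(** The weights n^p and n^(-p) cancel in the product, and x y <= x^2 + y^2 gives absolute
    convergence. *)
Lemma pairing_cvg p a b : XN0 p a -> XN0 (- p) b ->
  cvgn (fun N => \sum_(1 <= n < N) a n * b n).
Proof.
move=> Xa Xb.
pose u n := a n.+1 * b n.+1.
have cu : cvgn (series u).
  apply: normed_cvg; apply: nondecreasing_is_cvgn.
    apply/nondecreasing_seqP => N; rewrite /series [leRHS]big_nat_recr//=.
    by rewrite lerDl.
  exists (normX p a ^+ 2 + normX (- p) b ^+ 2) => _ [N _ <-].
  apply: le_trans (lerD (psumX_le_normX N.+1 Xa) (psumX_le_normX N.+1 Xb)).
  rewrite /psumX !big_add1/= -big_split/= /series/=.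
  apply: ler_sum => n _; rewrite /u normrM.
  have n0 : 0 < n.+1%:R :> R by rewrite ltr0n.
  have E (x y : R) : n.+1%:R `^ (2 * x) * y ^+ 2 = (n.+1%:R `^ x * y) ^+ 2.
    by rewrite exprMn -[(_ `^ x) ^+ 2]powR_mulrn ?powR_ge0// -powRrM [x * 2]mulrC.
  rewrite (E p) (E (- p)).
  have -> : `|a n.+1| * `|b n.+1| =
      (n.+1%:R `^ p * `|a n.+1|) * (n.+1%:R `^ (- p) * `|b n.+1|).
    rewrite mulrACA -powRD ?subrr ?powRr0 ?mul1r//.
    by rewrite lt0r_neq0// implybT.
  set x := _ * `|a _|; set y := _ * `|b _|.
  have x0 : 0 <= x by rewrite mulr_ge0 ?powR_ge0.
  have y0 : 0 <= y by rewrite mulr_ge0 ?powR_ge0.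
  by have := sqr_ge0 (x - y); nra.
have E : (fun N => \sum_(1 <= n < N.+1) a n * b n) = series u.
  by apply/funext => N; rewrite /series/= big_add1.
move: cu; rewrite -E => /cvg_ex[l hl]; apply/cvg_ex; exists l.
by rewrite -(cvg_shiftS (fun N => \sum_(1 <= n < N) a n * b n)).
Qed.

End weighted_l2.

(** * Square integrable functions on an open interval *)

Section L2_on_interval.
Context {R : realType}.
Implicit Types (tau k M : R) (f g h : R -> R).
Local Notation mu := (@lebesgue_measure R).
Local Notation D tau := (`]0, tau[%classic : set R).

Lemma Lnorm2_restrict tau h :
  Lnorm mu 2%:E (EFin \o (h \_ (D tau))) =
  ((\int[mu]_(x in D tau) (h x ^+ 2)%:E) `^ 2^-1)%E.
Proof.
rewrite unlock; congr (_ `^ _)%E; rewrite [RHS]integral_mkcond.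
apply: eq_integral => x _ /=; rewrite !patchE; case: ifPn => xD /=.
  by rewrite powR_mulrn// real_normK// num_real.
by rewrite normr0 powR0// pnatr_eq0.
Qed.

Lemma L2_intro tau k h : 0 <= k -> measurable_fun (D tau) h ->
  (\int[mu]_(x in D tau) (h x ^+ 2)%:E <= (k ^+ 2)%:E)%E ->
  L2 tau h /\ L2norm tau h <= k.
Proof.
move=> k0 mh hk.
have N : (Lnorm mu 2%:E (EFin \o (h \_ (D tau))) <= k%:E)%E.
  rewrite Lnorm2_restrict.
  have -> : (k%:E = (k ^+ 2)%:E `^ 2^-1)%E.
    by rewrite poweR_EFin powR12_sqrt ?sqr_ge0// sqrtr_sqr ger0_norm.
  have I0 : (0 <= \int[mu]_(x in D tau) (h x ^+ 2)%:E)%E.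
    by apply: integral_ge0 => x _; rewrite lee_fin sqr_ge0.
  rewrite gt0_ler_poweR//.
  - by rewrite in_itv/= leey I0.
  - by rewrite in_itv/= leey lee_fin sqr_ge0.
split; last first.
  rewrite /L2norm -lee_fin fineK// ge0_fin_numE ?Lnorm_ge0//.
  by rewrite (le_lt_trans N)// ltry.
rewrite /L2/= inE; apply/andP; split; rewrite inE/=.
  exact: (measurable_restrictT _ _).1.
by rewrite /finite_norm (le_lt_trans N)// ltry.
Qed.

Lemma integral_sqr_continuous tau h : 0 <= tau -> continuous h ->
  (\int[mu]_(x in D tau) (h x ^+ 2)%:E <= (itg 0 tau (fun x => h x ^+ 2))%:E)%E.
Proof.
move=> tau0 ch.
have ch2 : continuous (fun x => h x ^+ 2).
  by have := contM ch ch; under eq_fun do rewrite -expr2.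
have i2 := @continuous_itv_integrable _ _ 0 tau ch2.
rewrite /itg /Rintegral fineK; last exact: integrable_fin_num.
apply: ge0_subset_integral => //.
- by case/integrableP : i2.
- by move=> x _; rewrite lee_fin sqr_ge0.
- by move=> x /=; rewrite !in_itv/= => /andP[/ltW-> /ltW->].
Qed.

Lemma measurable_continuous tau h : continuous h -> measurable_fun (D tau) h.
Proof.
move=> ch; have /integrableP[/measurable_EFinP mh _] :=
  @continuous_itv_integrable _ h 0 tau ch.
apply: measurable_funS mh => // x /=.
by rewrite !in_itv/= => /andP[/ltW-> /ltW->].
Qed.

Lemma L2_continuous tau k h : 0 <= tau -> continuous h -> 0 <= k ->
  itg 0 tau (fun x => h x ^+ 2) <= k ^+ 2 -> L2 tau h /\ L2norm tau h <= k.
Proof.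
move=> tau0 ch k0 hk; apply: L2_intro => //; first exact: measurable_continuous.
by apply: le_trans (integral_sqr_continuous tau0 ch) _; rewrite lee_fin.
Qed.

Lemma restrict_eq tau f g : {in `]0, tau[, f =1 g} ->
  f \_ (D tau) = g \_ (D tau).
Proof.
by move=> fg; apply/funext => x; rewrite !patchE; case: ifPn => //; rewrite inE => /fg.
Qed.

Lemma L2_eq tau f g : {in `]0, tau[, f =1 g} -> L2 tau f -> L2 tau g.
Proof. by move=> /restrict_eq fg; rewrite /L2/= fg. Qed.

Lemma L2norm_eq tau f g : {in `]0, tau[, f =1 g} -> L2norm tau f = L2norm tau g.
Proof. by move=> /restrict_eq fg; rewrite /L2norm fg. Qed.

Lemma L2_D tau f g : L2 tau f -> L2 tau g -> L2 tau (f + g).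
Proof.
rewrite /L2/= => Lf Lg.
have -> : (f + g) \_ (D tau) = f \_ (D tau) + g \_ (D tau).
  by apply/funext => x; rewrite /= !fctE !patchE; case: ifPn => //; rewrite addr0.
have p1 : (1 <= 2%:E :> \bar R)%E by rewrite lee_fin; lra.
exact: (Lfun_addr_closed mu p1).2.
Qed.

(* Fatou's lemma turns the Cauchy property of [S] into convergence of its     *)
(* pointwise limit.                                                           *)
Lemma L2_pointwise_limit tau (S : nat -> R -> R) g (e : nat -> R) : 0 <= tau ->
  (forall N, continuous (S N)) ->
  (forall t, t \in `]0, tau[ -> S N t @[N --> \oo] --> g t) ->
  (forall N, 0 <= e N) -> e @ \oo --> (0 : R) ->
  (forall N M : nat, (N <= M)%N -> itg 0 tau (fun t => (S M t - S N t) ^+ 2) <= e N ^+ 2) ->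
  L2 tau g /\ L2norm tau (g - S N) @[N --> \oo] --> (0 : R).
Proof.
move=> tau0 cS Sg e0 ecv eS.
have mg : measurable_fun (D tau) g.
  apply/measurable_EFinP.
  apply: (emeasurable_fun_cvg (fun N t => (S N t)%:E)).
    by move=> N; apply/measurable_EFinP; exact: measurable_continuous.
  by move=> t tD; apply: cvg_EFin; [exact: nearW|exact: Sg].
have key N : L2 tau (g - S N) /\ L2norm tau (g - S N) <= e N.
  apply: L2_intro => //.
    by apply: measurable_funB => //; exact: measurable_continuous.
  pose fM (M : nat) (x : R) := ((S (N + M)%N x - S N x) ^+ 2)%:E.
  have cfM (M : nat) : continuous (fun x => S (N + M)%N x - S N x) by apply: contB; exact: cS.
  have mfM (M : nat) : measurable_fun (D tau) (fM M).
    by apply/measurable_EFinP; apply: measurable_funX; exact: measurable_continuous.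
  have fM0 (M : nat) x : D tau x -> (0 <= fM M x)%E by move=> _; rewrite lee_fin sqr_ge0.
  have := @fatou _ _ R mu (D tau) (measurable_itv _) fM mfM fM0.
  have -> : (\int[mu]_(x in D tau) limn_einf (fM^~ x) =
             \int[mu]_(x in D tau) ((g - S N) x ^+ 2)%:E)%E.
    apply: eq_integral => x; rewrite inE => xD.
    have h : fM M x @[M --> (\oo : set_system nat)] --> ((g - S N) x ^+ 2)%:E.
      apply: cvg_EFin; first exact: nearW.
      have h1 : S (N + M)%N x - S N x @[M --> (\oo : set_system nat)] --> g x - S N x.
        apply: cvgB; last exact: cvg_cst.
        have := Sg x xD; rewrite -(cvg_shiftn N (fun M : nat => S M x)).
        by under eq_fun do rewrite addnC.
      rewrite expr2; exact: (cvgM h1 h1).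
    by have [-> _] := cvg_limn_einf_sup h.
  move=> h; apply: le_trans h _; rewrite limn_einf_lim.
  apply: lime_le; first exact: is_cvg_einfs.
  apply: nearW => M.
  apply: (@le_trans _ _ (\int[mu]_(x in D tau) fM M x)%E).
    by apply: ereal_inf_lbound; exists M => /=.
  apply: le_trans (integral_sqr_continuous tau0 (cfM M)) _.
  by rewrite lee_fin eS// leq_addr.
split.
  have -> : g = (g - S 0%N) + S 0%N by rewrite subrK.
  apply: L2_D; first by case: (key 0%N).
  have I0 : 0 <= itg 0 tau (fun x => S 0%N x ^+ 2).
    by apply: itg_ge0 => x _; exact: sqr_ge0.
  have [] := @L2_continuous tau (Num.sqrt (itg 0 tau (fun x => S 0%N x ^+ 2))) (S 0%N) => //.
  by rewrite sqr_sqrtr.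
have N0 N : 0 <= L2norm tau (g - S N) by rewrite fine_ge0// Lnorm_ge0.
apply/cvgrPdist_le => /= eps eps0; have /cvgrPdist_le /(_ _ eps0) := ecv.
apply: filterS => N; rewrite !sub0r !normrN !ger0_norm//.
by apply: le_trans; case: (key N).
Qed.

Lemma L2_pairing_bound tau g f M : 0 <= tau -> L2 tau g -> continuous f ->
  (forall x, `|f x| <= M) ->
  mu.-integrable (D tau) (EFin \o (fun t => g t * f t)) /\
  `|\int[mu]_(t in D tau) (g t * f t)| <= L2norm tau g * (M * Num.sqrt tau).
Proof.
move=> tau0 Lg cf fM.
have M0 : 0 <= M by exact: le_trans (fM 0).
have [Lf Nf] : L2 tau f /\ L2norm tau f <= M * Num.sqrt tau.
  apply: L2_continuous => //; first by rewrite mulr_ge0 ?sqrtr_ge0.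
  rewrite exprMn sqr_sqrtr// -[X in _ * X](subr0 tau).
  apply: le_trans (ler_norm _) _; apply: itg_norm_le => //.
    by have := contM cf cf; under eq_fun do rewrite -expr2.
  by move=> x _; rewrite normrX lerXn2r ?nnegrE.
have E : (g \_ (D tau)) \* (f \_ (D tau)) = (fun t => g t * f t) \_ (D tau).
  by apply/funext => x /=; rewrite !patchE; case: ifPn => //; rewrite mulr0.
have I1 : (fun t => g t * f t) \_ (D tau) \in Lfun mu 1.
  by rewrite -E; apply: Lfun2_mul_Lfun1.
have I2 : mu.-integrable (D tau) (EFin \o (fun t => g t * f t)).
  apply/integrable_mkcond => //; rewrite restrict_EFin.
  by apply/Lfun1_integrable.
split=> //.
have gfin (h : R -> R) : L2 tau h -> (L2norm tau h)%:E =
    Lnorm mu 2%:E (EFin \o (h \_ (D tau))).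
  rewrite /L2/= /L2norm => /[!inE] /andP[_]; rewrite inE/= /finite_norm => hf.
  by rewrite fineK// ge0_fin_numE// Lnorm_ge0.
have mres (h : R -> R) : L2 tau h -> measurable_fun setT (h \_ (D tau)).
  by rewrite /L2/= => /[!inE] /andP[]; rewrite inE.
apply: le_trans (_ : L2norm tau g * L2norm tau f <= _); last first.
  by rewrite ler_wpM2l// fine_ge0// Lnorm_ge0.
rewrite -lee_fin EFinM (gfin _ Lg) (gfin _ Lf).
have p2 : (0 < 2 :> R) by lra.
have pq : (2 : R)^-1 + 2^-1 = 1 by lra.
apply: le_trans (hoelder mu (mres _ Lg) (mres _ Lf) p2 p2 pq).
rewrite Lnorm1 EFin_normr_Rintegral//.
apply: le_trans (le_abse_integral _ _ _) _ => //; first by case/integrableP : I2.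
rewrite le_eqVlt; apply/orP; left; apply/eqP.
rewrite integral_mkcond; apply: eq_integral => x _ /=.
by rewrite !patchE; case: ifPn => //= _; rewrite mulr0 normr0.
Qed.

Lemma Rintegral_oo_cc tau f : continuous f ->
  \int[mu]_(t in `]0, tau[) f t = itg 0 tau f.
Proof.
move=> cf; rewrite /itg.
have i0 := @continuous_itv_integrable _ f 0 tau cf.
rewrite Rintegral_itv_bndo_bndc.
  rewrite Rintegral_itv_obnd_cbnd//.
  apply: integrableS i0 => // x /=; rewrite !in_itv/= => /andP[/ltW-> ->] //.
by apply: integrableS i0 => // x /=; rewrite !in_itv/= => /andP[/ltW-> /ltW->].
Qed.

End L2_on_interval.

(** * Traces of adjoint solutions *)

Section oscillatory_integrals.
Context {R : realType}.
Implicit Types (r W tau t : R).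

(** These are the two parts of e^((r + i W) t) / (r + i W). The bound is uniform in the damping
    because (r + |W|) |W| <= 2 (r^2 + W^2). *)
Lemma osc_primitive_bound r W t : 0 <= r -> W != 0 -> t <= 0 ->
  `|(r * ecos r W t + W * esin r W t) / (r ^+ 2 + W ^+ 2)| <= 2 / `|W| /\
  `|(r * esin r W t - W * ecos r W t) / (r ^+ 2 + W ^+ 2)| <= 2 / `|W|.
Proof.
move=> r0 W0 t0; have w0 : 0 < `|W| by rewrite normr_gt0.
have WE : W ^+ 2 = `|W| ^+ 2 by rewrite real_normK// num_real.
have q0 : 0 < r ^+ 2 + W ^+ 2 by rewrite WE ltr_wpDl ?sqr_ge0// exprn_gt0.
have e1 : expR (r * t) <= 1 by rewrite -expR0 ler_expR mulr_ge0_le0.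
have hc := le_trans (norm_ecos_le r W t) e1.
have hs := le_trans (norm_esin_le r W t) e1.
have rw : (r + `|W|) / (r ^+ 2 + W ^+ 2) <= 2 / `|W|.
  rewrite ler_pdivrMr// mulrAC ler_pdivlMr// WE.
  by move: `|W| w0 => w w0; have := sqr_ge0 (r - w); nra.
have main (a b : R) : `|a| <= 1 -> `|b| <= 1 ->
    `|(r * a + W * b) / (r ^+ 2 + W ^+ 2)| <= 2 / `|W|.
  move=> ha hb; apply: le_trans rw.
  rewrite normrM [`|_^-1|]ger0_norm ?invr_ge0 ?(ltW q0)// ler_wpM2r ?invr_ge0 ?(ltW q0)//.
  apply: le_trans (ler_normD _ _) _; rewrite (normrM r) (normrM W) (ger0_norm r0).
  by apply: lerD; rewrite ler_piMr.
split; first exact: main.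
by rewrite -mulrN; apply: main => //; rewrite normrN.
Qed.

Lemma osc_itg r W tau : 0 <= r -> W != 0 -> 0 <= tau ->
  `|itg 0 tau (fun t => ecos r W (t - tau))| <= 4 / `|W| /\
  `|itg 0 tau (fun t => esin r W (t - tau))| <= 4 / `|W|.
Proof.
move=> r0 W0 tau0; have q0 : r ^+ 2 + W ^+ 2 != 0.
  by rewrite lt0r_neq0// ltr_wpDl ?sqr_ge0// exprn_even_gt0.
have dec t := is_derive_shifted (- tau) t (is_derive_ecos r W).
have des t := is_derive_shifted (- tau) t (is_derive_esin r W).
have b1 t : t <= tau -> t - tau <= 0 by rewrite subr_le0.
have fin (a b A : R) : `|a| <= 2 * A -> `|b| <= 2 * A -> `|a - b| <= 4 * A.
  move=> ha hb; apply: le_trans (ler_normB _ _) _; lra.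
split.
- pose F t := (r ^+ 2 + W ^+ 2)^-1 *
    (r * ecos r W (t - tau) + W * esin r W (t - tau)).
  have -> : itg 0 tau (fun t => ecos r W (t - tau)) = F tau - F 0.
    apply: itg_FTC => //; first exact: (cont_shift (@cont_ecos _ r W)).
    move=> t; have := is_derive_scale (r ^+ 2 + W ^+ 2)^-1
      (is_derive_add (is_derive_scale r (dec t)) (is_derive_scale W (des t))).
    by congr (is_derive _ _ _ _); field.
  rewrite /F ![(_ ^-1) * _]mulrC; apply: fin.
    by have [] := @osc_primitive_bound r W (tau - tau) r0 W0 (b1 _ (lexx _)).
  by have [] := @osc_primitive_bound r W (0 - tau) r0 W0 (b1 _ tau0).
- pose F t := (r ^+ 2 + W ^+ 2)^-1 *
    (r * esin r W (t - tau) - W * ecos r W (t - tau)).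
  have -> : itg 0 tau (fun t => esin r W (t - tau)) = F tau - F 0.
    apply: itg_FTC => //; first exact: (cont_shift (@cont_esin _ r W)).
    move=> t; have := is_derive_scale (r ^+ 2 + W ^+ 2)^-1
      (is_derive_sub (is_derive_scale r (des t)) (is_derive_scale W (dec t))).
    by congr (is_derive _ _ _ _); field.
  rewrite /F ![(_ ^-1) * _]mulrC; apply: fin.
    by have [] := @osc_primitive_bound r W (tau - tau) r0 W0 (b1 _ (lexx _)).
  by have [] := @osc_primitive_bound r W (0 - tau) r0 W0 (b1 _ tau0).
Qed.

End oscillatory_integrals.

(** * A Bessel inequality for damped waves *)

Section bessel.
Context {R : realType} (alpha rho tau : R).
Hypotheses (halpha : 0 < alpha < 1) (hrho : 0 < rho < 2) (htau : 0 <= tau).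
Local Notation sg := (sg alpha rho).
Local Notation om := (om alpha rho).
Local Notation gap := (gap alpha rho).
Variables (b c : nat -> R).

(** Written in [t - tau], which is nonpositive on [0, tau], so that the growing exponentials are
    bounded by 1. *)
Definition wave (n : nat) (t : R) : R :=
  b n * ecos (sg n) (om n) (t - tau) + c n * esin (sg n) (om n) (t - tau).

Lemma cont_wave n : continuous (wave n).
Proof.
by apply: contD; apply: contZ; apply: cont_shift; [exact: cont_ecos|exact: cont_esin].
Qed.

Let amp n : R := `|b n| + `|c n|.

Lemma wave_le n t : `|wave n t| <= (`|b n| + `|c n|) * expR (sg n * (t - tau)).
Proof.
rewrite /wave mulrDl (le_trans (ler_normD _ _))//.
rewrite (normrM (b n)) (normrM (c n)).
by apply: lerD; apply: ler_wpM2l => //; [exact: norm_ecos_le|exact: norm_esin_le].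
Qed.

Lemma gapC n m : gap n m = gap m n.
Proof.
by rewrite /gap eq_sym; case: eqVneq => [->//|_]; rewrite distrC.
Qed.

(** Off the diagonal the product oscillates with the frequencies [om n - om m] and [om n + om m],
    both at least [gap n m] in size. On the diagonal the waves are merely bounded, which costs the
    length [tau]. *)
Lemma wave_product_bound n m : (0 < n)%N -> (0 < m)%N ->
  `|itg 0 tau (fun t => wave n t * wave m t)| <=
  (4 / gap n m + tau * (n == m)%:R) * (amp n * amp m).
Proof.
move=> n0 m0; have g0 := gap_gt0 halpha hrho n0 m0.
have cw := contM (@cont_wave n) (@cont_wave m).
have [nm|nm] := eqVneq n m.
  apply: le_trans (_ : tau * (amp n * amp m) <= _); last first.
    rewrite ler_wpM2r ?mulr_ge0 ?addr_ge0// mulr1 lerDr divr_ge0// ltW//.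
  rewrite mulrC -[X in _ * X](subr0 tau); apply: itg_norm_le => //.
  have h k t : t <= tau -> `|wave k t| <= amp k.
    move=> tt'; apply: le_trans (wave_le k t) _; rewrite ler_piMr//.
    by rewrite -expR0 ler_expR mulr_ge0_le0 ?sg_ge0// subr_le0.
  by move=> t; rewrite in_itv/= => /andP[_ tt']; rewrite normrM ler_pM// h.
rewrite mulr0 addr0.
pose s := sg n + sg m.
have s0 : 0 <= s by rewrite addr_ge0 ?sg_ge0.
have o1 : om n - om m != 0.
  by have := g0; rewrite /gap eq_sym (negbTE nm) normr_gt0 -opprB oppr_eq0.
have o20 : 0 < om n + om m by rewrite addr_gt0 ?om_gt0.
have o2 : om n + om m != 0 by rewrite lt0r_neq0.
have [c1 s1] := osc_itg s0 o1 htau; have [c2 s2] := osc_itg s0 o2 htau.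
have g1 : 4 / `|om n - om m| = 4 / gap n m.
  by rewrite /gap eq_sym (negbTE nm) distrC.
have g2 : 4 / `|om n + om m| <= 4 / gap n m.
  rewrite ler_wpM2l// gtr0_norm// lef_pV2 ?posrE//; exact: gap_le.
rewrite g1 in c1 s1.
have {}c2 := le_trans c2 g2; have {}s2 := le_trans s2 g2.
have half (f g h1 h2 : R -> R) (A : R) : continuous f -> continuous g ->
    (forall t, 2 * (f t * g t) = h1 t + h2 t) -> continuous h1 -> continuous h2 ->
    `|itg 0 tau h1| <= A -> `|itg 0 tau h2| <= A ->
    `|itg 0 tau (fun t => f t * g t)| <= A.
  move=> cf cg E ch1 ch2 b1 b2.
  have e : 2 * itg 0 tau (fun t => f t * g t) = itg 0 tau h1 + itg 0 tau h2.
    by rewrite -(itgZ _ _ _ (contM cf cg)) -itgD//; apply: eq_itg => t _; exact: E.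
  have : `|2 * itg 0 tau (fun t => f t * g t)| <= A + A.
    by rewrite e (le_trans (ler_normD _ _))// lerD.
  rewrite normrM ger0_norm// => h; lra.
have ce r W : continuous (fun t => @ecos R r W (t - tau)).
  by apply: cont_shift; exact: cont_ecos.
have cs r W : continuous (fun t => @esin R r W (t - tau)).
  by apply: cont_shift; exact: cont_esin.
have neg (h : R -> R) A : continuous h -> `|itg 0 tau h| <= A ->
    `|itg 0 tau (fun t => - h t)| <= A.
  move=> ch hA; have -> : itg 0 tau (fun t => - h t) = - itg 0 tau h.
    by rewrite -[RHS]mulN1r -itgZ//; apply: eq_itg => t _; rewrite mulN1r.
  by rewrite normrN.
set A := 4 / gap n m in c1 s1 c2 s2 *.
have bcc := half _ _ _ _ A (ce (sg n) (om n)) (ce (sg m) (om m))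
  (fun t => ecosM _ _ _ _ (t - tau)) (ce _ _) (ce _ _) c1 c2.
have bss := half _ _ _ _ A (cs (sg n) (om n)) (cs (sg m) (om m))
  (fun t => esinM _ _ _ _ (t - tau)) (ce _ _) (contN (ce _ _)) c1
  (neg _ _ (ce _ _) c2).
have bsc := half _ _ _ _ A (cs (sg n) (om n)) (ce (sg m) (om m))
  (fun t => esincosM _ _ _ _ (t - tau)) (cs _ _) (cs _ _) s1 s2.
have bcs := half _ _ _ _ A (ce (sg n) (om n)) (cs (sg m) (om m))
  (fun t => cossinM _ _ _ _ (t - tau)) (cs _ _) (contN (cs _ _)) s2
  (neg _ _ (cs _ _) s1).
pose fcc t := ecos (sg n) (om n) (t - tau) * ecos (sg m) (om m) (t - tau).
pose fcs t := ecos (sg n) (om n) (t - tau) * esin (sg m) (om m) (t - tau).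
pose fsc t := esin (sg n) (om n) (t - tau) * ecos (sg m) (om m) (t - tau).
pose fss t := esin (sg n) (om n) (t - tau) * esin (sg m) (om m) (t - tau).
have k1 : continuous fcc by apply: contM; exact: ce.
have k2 : continuous fcs by apply: contM; [exact: ce|exact: cs].
have k3 : continuous fsc by apply: contM; [exact: cs|exact: ce].
have k4 : continuous fss by apply: contM; exact: cs.
have E : itg 0 tau (fun t => wave n t * wave m t) =
    (b n * b m) * itg 0 tau fcc + (b n * c m) * itg 0 tau fcs +
    ((c n * b m) * itg 0 tau fsc + (c n * c m) * itg 0 tau fss).
  have z1 := @contZ _ (b n * b m) _ k1; have z2 := @contZ _ (b n * c m) _ k2.
  have z3 := @contZ _ (c n * b m) _ k3; have z4 := @contZ _ (c n * c m) _ k4.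
  rewrite -(itgZ _ _ _ k1) -(itgZ _ _ _ k2) -(itgZ _ _ _ k3) -(itgZ _ _ _ k4).
  rewrite -(itgD _ _ z1 z2) -(itgD _ _ z3 z4) -(itgD _ _ (contD z1 z2) (contD z3 z4)).
  by apply: eq_itg => t _; rewrite /wave /fcc /fcs /fsc /fss; ring.
have P (x y I : R) : `|I| <= A -> `|x * y * I| <= A * (`|x| * `|y|).
  by move=> hI; rewrite normrM (normrM x) mulrC ler_wpM2r// mulr_ge0.
rewrite E (_ : A * _ = A * (`|b n| * `|b m|) + A * (`|b n| * `|c m|) +
  (A * (`|c n| * `|b m|) + A * (`|c n| * `|c m|))); last by rewrite /amp; ring.
apply: le_trans (ler_normD _ _) (lerD (le_trans (ler_normD _ _) (lerD _ _))
  (le_trans (ler_normD _ _) (lerD _ _))); exact: P.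
Qed.

(* Schur test for the Gram matrix, whose rows are summable by [gap_sum]. *)
Lemma bessel_inequality : exists2 K : R, 0 <= K & forall N M : nat, (0 < N)%N ->
  itg 0 tau (fun t => (\sum_(N <= n < M) wave n t) ^+ 2) <=
  K * \sum_(N <= n < M) (`|b n| + `|c n|) ^+ 2.
Proof.
pose c0 : R := 1 - rho ^+ 2 / 4.
have c00 : 0 < c0 by exact: gapconst_gt0.
(* The 4 of [osc_itg] times the 10 of [gap_sum], plus the diagonal. *)
pose K := 40 / c0 + tau.
have K0 : 0 <= K by rewrite addr_ge0// divr_ge0// ltW.
exists K => // N M N0.
pose J n m := 4 / gap n m + tau * (n == m)%:R.
have JC n m : J n m = J m n by rewrite /J gapC eq_sym.
have J0 n m : (0 < n)%N -> (0 < m)%N -> 0 <= J n m.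
  move=> n0 m0; apply: addr_ge0; last exact: mulr_ge0.
  by rewrite divr_ge0// ltW// gap_gt0.
have Jsum n : (0 < n)%N -> \sum_(N <= m < M) J n m <= K.
  move=> n0; rewrite /J big_split/= /K; apply: lerD.
    rewrite -mulr_sumr (_ : 40 / c0 = 4 * (10 / c0)); last by ring.
    rewrite ler_wpM2l//.
    apply: le_trans (_ : 10 / c0 / Num.sqrt n%:R <= _); last first.
      rewrite ler_pdivrMr ?sqrtr_gt0 ?ltr0n// ler_peMr ?divr_ge0 ?(ltW c00)//.
      by rewrite -[leLHS]sqrtr1 ler_wsqrtr// ler1n.
    apply: le_trans (gap_sum halpha hrho M n0).
    have [NM|MN] := leqP N M; last first.
      rewrite big_geq ?(ltnW MN)// big_nat; apply: sumr_ge0 => m /andP[m0 _].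
      by rewrite invr_ge0 ltW// gap_gt0.
    rewrite [leRHS](@big_cat_nat _ _ _ N)//= lerDr big_nat.
    apply: sumr_ge0 => m /andP[m0 _].
    by rewrite invr_ge0 ltW// gap_gt0.
  rewrite -mulr_sumr -[leRHS]mulr1 ler_wpM2l//.
  have [nI|nI] := boolP (n \in index_iota N M).
    rewrite (bigD1_seq n) ?iota_uniq//= eqxx big1 ?addr0// => m /negbTE.
    by rewrite eq_sym => ->.
  rewrite big_seq big1// => m mI; have [nm|//] := eqVneq n m.
  by move: nI; rewrite nm mI.
have cc n m := contM (@cont_wave n) (@cont_wave m).
have -> : itg 0 tau (fun t => (\sum_(N <= n < M) wave n t) ^+ 2) =
    \sum_(N <= n < M) \sum_(N <= m < M) itg 0 tau (fun t => wave n t * wave m t).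
  transitivity (itg 0 tau (fun t => \sum_(N <= n < M) \sum_(N <= m < M)
      wave n t * wave m t)).
    by apply: eq_itg => t _; rewrite expr2 big_distrlr.
  rewrite itg_sum; last by move=> n; apply: cont_sum => m; exact: cc.
  by apply: eq_bigr => n _; rewrite itg_sum.
apply: (@le_trans _ _ (\sum_(N <= n < M) \sum_(N <= m < M)
    (J n m * amp n ^+ 2 / 2 + J m n * amp m ^+ 2 / 2))).
  rewrite big_nat [leRHS]big_nat; apply: ler_sum => n /andP[Nn _].
  rewrite big_nat [leRHS]big_nat; apply: ler_sum => m /andP[Nm _].
  have n0 := leq_trans N0 Nn; have m0 := leq_trans N0 Nm.
  apply: le_trans (ler_norm _) _; apply: le_trans (wave_product_bound n0 m0) _.
  rewrite -/(J n m) (JC m n) -mulrDl -mulrDr -mulrA ler_wpM2l ?J0//.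
  by have := sqr_ge0 (amp n - amp m); nra.
have -> : \sum_(N <= n < M) \sum_(N <= m < M)
    (J n m * amp n ^+ 2 / 2 + J m n * amp m ^+ 2 / 2) =
    \sum_(N <= n < M) (\sum_(N <= m < M) J n m) * amp n ^+ 2.
  under eq_bigr do rewrite big_split/=.
  rewrite big_split/= [X in _ + X]exchange_big/= -big_split/=.
  apply: eq_bigr => n _; rewrite -big_split/= mulr_suml.
  by apply: eq_bigr => m _; field.
rewrite mulr_sumr big_nat [leRHS]big_nat; apply: ler_sum => n /andP[Nn _].
by rewrite ler_wpM2r ?sqr_ge0// Jsum// (leq_trans N0).
Qed.

End bessel.

(** * Explicit adjoint solutions and their traces *)

Section adjoint_problem.
Context {R : realType} (alpha rho : R).
Hypotheses (halpha : 0 < alpha < 1) (hrho : 0 < rho < 2).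
Local Notation sg := (sg alpha rho).
Local Notation om := (om alpha rho).
Implicit Types (tau t : R) (w wt : R -> nat -> R).

(** The weight of mode n in the boundary trace, up to sign, and by duality the strength of the
    control in that mode. Its size is exactly of order n^2, since [cos (n pi)] has modulus 1. *)
Definition kap (n : nat) : R := n%:R ^+ 2 * phiN n (pi : R).

Lemma norm_kap n : (0 < n)%N -> `|kap n| = n%:R ^+ 2 * Num.sqrt (2 / pi).
Proof.
move=> n0; have [_ c1] : sin (n%:R * (pi : R)) = 0 /\ `|cos (n%:R * (pi : R))| = 1.
  elim: n {n0} => [|n [s c]]; first by rewrite mul0r sin0 cos0 normr1.
  have -> : n.+1%:R * (pi : R) = n%:R * pi + pi by rewrite -natr1 mulrDl mul1r.
  by rewrite sinDpi cosDpi s oppr0 normrN.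
rewrite /kap /phiN; case: n n0 c1 => // n _ c1.
by rewrite !normrM c1 mulr1 ger0_norm ?exprn_ge0// ger0_norm// sqrtr_ge0.
Qed.

Lemma norm_kap_gt0 n : (0 < n)%N -> 0 < `|kap n|.
Proof.
move=> n0; rewrite norm_kap// mulr_gt0 ?exprn_gt0 ?ltr0n//.
by rewrite sqrtr_gt0 divr_gt0// pi_gt0.
Qed.

Lemma kap_neq0 n : (0 < n)%N -> kap n != 0.
Proof. by move=> n0; rewrite -normr_gt0 norm_kap_gt0. Qed.

(** The terminal value of the component v for which w'' - 2 s w' + n^4 w = 0 becomes the rotating
    system w' = s w + o v, v' = s v - o w. *)
Definition vel (w0 w1 : nat -> R) (n : nat) : R := (w1 n - sg n * w0 n) / om n.

Lemma om_vel (w0 w1 : nat -> R) n : (0 < n)%N -> om n * vel w0 w1 n = w1 n - sg n * w0 n.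
Proof. by move=> n0; rewrite /vel mulrC divfK// lt0r_neq0// om_gt0. Qed.

Lemma is_derive_wave tau b c n t :
  is_derive t (1 : R) (wave alpha rho tau b c n)
    (sg n * wave alpha rho tau b c n t +
     om n * wave alpha rho tau c (fun k => - b k) n t).
Proof.
have := is_derive_add
  (is_derive_scale (b n) (is_derive_shifted (- tau) t (is_derive_ecos (sg n) (om n))))
  (is_derive_scale (c n) (is_derive_shifted (- tau) t (is_derive_esin (sg n) (om n)))).
by congr (is_derive _ _ _ _); rewrite /wave; ring.
Qed.

Lemma waveN tau b c n t : wave alpha rho tau (fun k => - b k) (fun k => - c k) n t =
  - wave alpha rho tau b c n t.
Proof. by rewrite /wave; ring. Qed.

Lemma is_derive_wave_vel tau b c n t :
  is_derive t (1 : R) (wave alpha rho tau c (fun k => - b k) n)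
    (sg n * wave alpha rho tau c (fun k => - b k) n t -
     om n * wave alpha rho tau b c n t).
Proof.
have := is_derive_wave tau c (fun k => - b k) n t.
by congr (is_derive _ _ _ _); rewrite waveN; ring.
Qed.

Lemma wave_tau tau b c n : wave alpha rho tau b c n tau = b n.
Proof. by rewrite /wave subrr ecos0 esin0; ring. Qed.

Let damping n : rho * n%:R `^ (2 * alpha) = 2 * sg n.
Proof. by rewrite /sg; field. Qed.

(** The weak identity is required for every adjoint solution, not for a chosen one;
    [rotation_system] shows that the terminal data leave no freedom on [0, tau]. *)
Lemma adjoint_explicit tau (w0 w1 : nat -> R) w wt n t : 0 <= tau ->
  adjoint_solution alpha rho tau w0 w1 w wt -> (0 < n)%N -> t \in `[0, tau] ->
  w t n = wave alpha rho tau w0 (vel w0 w1) n t /\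
  wt t n = sg n * wave alpha rho tau w0 (vel w0 w1) n t +
           om n * wave alpha rho tau (vel w0 w1) (fun k => - w0 k) n t.
Proof.
move=> tau0 [_ H] n0 tI; have [d1 d2 e1 e2] := H n n0.
have o0 : om n != 0 by rewrite lt0r_neq0// om_gt0.
pose v s := (om n)^-1 * (wt s n - sg n * w s n).
have cw := deriv_on_continuous d1; have cwt := deriv_on_continuous d2.
have ccst (x : R) : {within `[0, tau], continuous (fun _ : R => x)}.
  by apply: continuous_subspaceT; exact: cont_cst.
have cv : {within `[0, tau], continuous v}.
  apply: within_contM; first exact: ccst.
  apply: within_contB; first exact: cwt.
  by apply: within_contM; [exact: ccst|exact: cw].
have wtE s : wt s n = sg n * w s n + om n * v s.
  by rewrite /v mulVKf//; ring.
have dw s : s \in `]0, tau[ ->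
    is_derive s (1 : R) (fun s => w s n) (sg n * w s n + om n * v s).
  by move=> sI; rewrite -wtE; exact: (deriv_on_interior d1 sI).
have dv s : s \in `]0, tau[ ->
    is_derive s (1 : R) v (sg n * v s - om n * w s n).
  move=> sI; have := is_derive_scale (om n)^-1 (is_derive_sub (deriv_on_interior d2 sI)
    (is_derive_scale (sg n) (deriv_on_interior d1 sI))).
  congr (is_derive _ _ _ _); rewrite damping.
  have -> : n%:R ^+ 4 = om n ^+ 2 + sg n ^+ 2 by rewrite om_sqr// subrK.
  by rewrite /v; field.
have := rotation_system cw cv dw dv tI.
rewrite e1 (_ : v tau = vel w0 w1 n); last by rewrite /v e1 e2 /vel mulrC.
move=> [-> Ev]; split; first by [].
by rewrite wtE (_ : v t = wave alpha rho tau (vel w0 w1) (fun k => - w0 k) n t);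
  [have [-> _] := rotation_system cw cv dw dv tI; rewrite e1 /wave
    (_ : v tau = vel w0 w1 n)//; rewrite /v e1 e2 /vel mulrC
  |rewrite Ev /wave mulNr].
Qed.

Lemma adjoint_exists tau (w0 w1 : nat -> R) :
  exists w wt, adjoint_solution alpha rho tau w0 w1 w wt.
Proof.
exists (fun t n => if n is 0%N then 0 else wave alpha rho tau w0 (vel w0 w1) n t).
exists (fun t n => if n is 0%N then 0 else
  sg n * wave alpha rho tau w0 (vel w0 w1) n t +
  om n * wave alpha rho tau (vel w0 w1) (fun k => - w0 k) n t).
split => // -[//|n] _; split.
- apply: is_derive_deriv_on => t; exact: is_derive_wave.
- apply: is_derive_deriv_on => t.
  have := is_derive_add (is_derive_scale (sg n.+1) (is_derive_wave tau w0 (vel w0 w1) n.+1 t))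
    (is_derive_scale (om n.+1) (is_derive_wave_vel tau w0 (vel w0 w1) n.+1 t)).
  congr (is_derive _ _ _ _); rewrite damping.
  have -> : n.+1%:R ^+ 4 = om n.+1 ^+ 2 + sg n.+1 ^+ 2 by rewrite om_sqr// subrK.
  by ring.
- by rewrite wave_tau.
- by rewrite !wave_tau om_vel// addrC subrK.
Qed.

Let c0 : R := 1 - rho ^+ 2 / 4.
Let c00 : 0 < c0. Proof. exact: gapconst_gt0. Qed.

Lemma vel_le (w0 w1 : nat -> R) n : (0 < n)%N ->
  n%:R ^+ 2 * `|vel w0 w1 n| <= c0^-1 * (`|w1 n| + n%:R ^+ 2 * `|w0 n|).
Proof.
move=> n0; have o0 := om_gt0 halpha hrho n0.
rewrite /vel normrM [`|_^-1|]ger0_norm ?invr_ge0 ?(ltW o0)//.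
rewrite mulrCA mulrC; apply: ler_pM => //.
- by rewrite divr_ge0 ?exprn_ge0// ltW.
- rewrite ler_pdivrMr// mulrC ler_pdivlMr//.
  by rewrite mulrC; exact: om_ge.
- apply: le_trans (ler_normB _ _) _; rewrite lerD2l normrM ger0_norm ?sg_ge0//.
  by rewrite ler_wpM2r// sg_le.
Qed.

Section trace.
Variables (tau : R) (w0 w1 : nat -> R).
Hypotheses (htau : 0 <= tau) (Xw0 : XN0 2 w0) (Xw1 : XN0 0 w1).

Let b n : R := - kap n * w0 n.
Let c n : R := - kap n * vel w0 w1 n.
Let S (N : nat) (t : R) : R := \sum_(1 <= n < N) wave alpha rho tau b c n t.

Let amp_sum : exists2 K : R, 0 <= K & forall N,
  \sum_(1 <= n < N) (`|b n| + `|c n|) ^+ 2 <= K.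
Proof.
pose q : R := Num.sqrt (2 / pi).
have q0 : 0 <= q by exact: sqrtr_ge0.
pose K1 := q * (1 + c0^-1); have K10 : 0 <= K1.
  by rewrite mulr_ge0// addr_ge0// invr_ge0 ltW.
have amp n : (0 < n)%N -> `|b n| + `|c n| <= K1 * (n%:R ^+ 2 * `|w0 n| + `|w1 n|).
  move=> n0; rewrite /b /c !(normrM (- kap n)) !normrN norm_kap// -/q.
  have h := vel_le w0 w1 n0.
  rewrite (_ : _ + _ = q * (n%:R ^+ 2 * `|w0 n| + n%:R ^+ 2 * `|vel w0 w1 n|)); last by ring.
  rewrite /K1 -mulrA ler_wpM2l//.
  rewrite mulrDl mul1r.
  have a1 : 0 <= n%:R ^+ 2 * `|w0 n| by rewrite mulr_ge0// exprn_ge0.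
  have a2 := normr_ge0 (w1 n).
  move: h; rewrite [`|w1 n| + _]addrC; lra.
exists (2 * K1 ^+ 2 * (normX 2 w0 ^+ 2 + normX 0 w1 ^+ 2)).
  apply: mulr_ge0; first by apply: mulr_ge0 => //; exact: sqr_ge0.
  by apply: addr_ge0; exact: sqr_ge0.
move=> N; apply: le_trans (_ : 2 * K1 ^+ 2 * (psumX 2 w0 N + psumX 0 w1 N) <= _); last first.
  apply: ler_wpM2l; first by apply: mulr_ge0 => //; exact: sqr_ge0.
  by apply: lerD; exact: psumX_le_normX.
rewrite /psumX -big_split/= mulr_sumr big_nat [leRHS]big_nat.
apply: ler_sum => n /andP[n0 _].
rewrite mulr0 powRr0 mul1r.
have -> : n%:R `^ (2 * 2) * `|w0 n| ^+ 2 = (n%:R ^+ 2 * `|w0 n|) ^+ 2.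
  by rewrite (_ : 2 * 2 = 4%:R :> R); [rewrite powR_mulrn// exprMn -exprM|ring].
have h := amp n n0.
apply: le_trans (_ : (K1 * (n%:R ^+ 2 * `|w0 n| + `|w1 n|)) ^+ 2 <= _).
  apply: lerXn2r; rewrite ?nnegrE ?addr_ge0//.
  by rewrite mulr_ge0// addr_ge0// mulr_ge0// exprn_ge0.
rewrite [leLHS]exprMn -[leRHS]mulrA [leRHS]mulrCA; apply: ler_wpM2l; first exact: sqr_ge0.
move: (n%:R ^+ 2 * `|w0 n|) (`|w1 n|) => x y.
by have := sqr_ge0 (x - y); nra.
Qed.

(** Strictly before [tau] the damping makes the series converge absolutely, although the amplitudes
    are only square summable. This gives the pointwise limit that represents the trace. *)
Let S_cvg t : t < tau -> cvgn (fun N => S N t).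
Proof.
move=> tt'; have [K K0 HK] := amp_sum.
have [|K' [K'0 HK']] := @expR_sg_decay R alpha rho halpha hrho (tau - t).
  by rewrite subr_gt0.
have ampK n : (0 < n)%N -> `|b n| + `|c n| <= K + 1.
  move=> n0; have := HK n.+1; rewrite big_nat_recr//= => h.
  have h0 : 0 <= \sum_(1 <= i < n) (`|b i| + `|c i|) ^+ 2.
    by apply: sumr_ge0 => i _; exact: sqr_ge0.
  have : (`|b n| + `|c n|) ^+ 2 <= K by lra.
  move: (`|b n| + `|c n|) => x; nra.
have KK : 0 <= (K + 1) * K' by rewrite mulr_ge0 ?addr_ge0// ltW.
have [|||G [e [_ _ cG]]] := @dominated_telescope_lim R unit (fun N _ => S N.+1 t)
  (fun N => \sum_(1 <= n < N.+1) ((K + 1) * K' / n%:R ^+ 2)) ((K + 1) * K' * 2).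
- by move=> N; rewrite -mulr_sumr ler_wpM2l// sum_inv_sqr_le.
- by move=> N; rewrite [leRHS]big_nat_recr//= lerDl divr_ge0// exprn_ge0.
- move=> N _; rewrite /S [\sum_(1 <= n < N.+2) wave _ _ _ _ _ _ _]big_nat_recr//=.
  rewrite [\sum_(1 <= n < N.+2) (_ / _)]big_nat_recr//=.
  rewrite addrAC subrr add0r addrAC subrr add0r.
  apply: le_trans (wave_le _ _ _ _ _ _ _) _.
  rewrite -[leRHS]mulrA; apply: ler_pM; [exact: addr_ge0|exact: expR_ge0|exact: ampK|].
  rewrite -[sg _ * _]opprK -mulNr -mulrN opprB.
  apply: le_trans (HK' N.+1 isT) _; rewrite ler_wpM2l ?(ltW K'0)//.
  rewrite lef_pV2 ?posrE ?exprn_gt0 ?ltr0n// ler_weXn2l//.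
  by rewrite ler1n.
apply/cvg_ex; exists (G tt).
by rewrite -(cvg_shiftS (fun N => S N t)); exact: cG.
Qed.

Lemma trace_exists w wt : adjoint_solution alpha rho tau w0 w1 w wt ->
  exists g, is_trace_xx tau w g.
Proof.
move=> Hw; have [K K0 HK] := bessel_inequality halpha hrho htau b c.
have [B B0 HB] := amp_sum.
pose A N := \sum_(1 <= n < N) (`|b n| + `|c n|) ^+ 2.
have ndA : nondecreasing_seq A.
  apply/nondecreasing_seqP => -[|N]; first by rewrite /A !big_geq.
  by rewrite /A [leRHS]big_nat_recr//= lerDl sqr_ge0.
have cA : cvgn A.
  by apply: nondecreasing_is_cvgn => //; exists B => _ [N _ <-]; exact: HB.
have A_le N : A N <= limn A by exact: nondecreasing_cvgn_le.
pose e N := Num.sqrt (K * (limn A - A N)).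
have e0 N : 0 <= e N by exact: sqrtr_ge0.
have ecv : e @ \oo --> (0 : R).
  rewrite -(sqrtr0 R); apply: (cvg_comp _ Num.sqrt); last exact: sqrt_continuous.
  rewrite -(mulr0 K); apply: cvgMr; rewrite -(subrr (limn A)).
  by apply: cvgB => //; exact: cvg_cst.
have cS N : continuous (S N) by apply: cont_sum => n; exact: cont_wave.
have SE N t : t \in `]0, tau[ ->
    S N t = - \sum_(1 <= n < N) n%:R ^+ 2 * phiN n (pi : R) * w t n.
  rewrite in_itv/= => /andP[/ltW t0 /ltW tt'].
  rewrite /S -sumrN big_nat [RHS]big_nat; apply: eq_bigr => n /andP[n0 _].
  have [|-> _] := @adjoint_explicit tau w0 w1 w wt n t htau Hw n0.
    by rewrite in_itv/= t0.
  by rewrite /wave /b /c /kap; ring.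
have bess (N M : nat) : (0 < N)%N -> (N <= M)%N ->
    itg 0 tau (fun t => (S M t - S N t) ^+ 2) <= e N ^+ 2.
  move=> N0 NM; rewrite /e sqr_sqrtr; last by rewrite mulr_ge0// subr_ge0.
  apply: le_trans (_ : K * \sum_(N <= n < M) (`|b n| + `|c n|) ^+ 2 <= _).
    rewrite (_ : itg 0 tau _ =
      itg 0 tau (fun t => (\sum_(N <= n < M) wave alpha rho tau b c n t) ^+ 2)); last first.
      by apply: eq_itg => t _; rewrite /S (big_cat_nat N0 NM) /= addrAC subrr add0r.
    exact: HK.
  rewrite ler_wpM2l// lerBrDl; apply: le_trans (A_le M).
  by rewrite /A (big_cat_nat N0 NM).
have [||g1 g2] := @L2_pointwise_limit R tau S (fun t => limn (fun N => S N t)) e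
  htau cS _ e0 ecv.
- by move=> t; rewrite in_itv/= => /andP[_ tt']; exact: S_cvg.
- move=> [|N] M NM; last exact: bess.
  have [->|M0] := posnP M.
    apply: le_trans (_ : 0 <= _); last exact: sqr_ge0.
    by rewrite itg_eq0// => t _; rewrite subrr expr0n.
  (* The Bessel inequality needs a positive lower index; as all sums start at 1, the index 0 may be
     replaced by 1. *)
  have S01 : S 0 = S 1%N by apply/funext => t; rewrite /S !big_geq.
  have e01 : e 0%N = e 1%N by rewrite /e /A !big_geq.
  by rewrite S01 e01; exact: bess.
exists (fun t => limn (fun N => S N t)); split => //.
- move=> N; apply: L2_eq (SE N) _.
  have [] := @L2_continuous R tau (Num.sqrt (itg 0 tau (fun t => S N t ^+ 2))) (S N) => //.
  by rewrite sqr_sqrtr// itg_ge0// => t _; exact: sqr_ge0.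
- have -> : (fun N => L2norm tau ((fun t => limn (fun N => S N t)) -
      (fun t => - \sum_(1 <= n < N) n%:R ^+ 2 * phiN n (pi : R) * w t n))) =
    (fun N => L2norm tau ((fun t => limn (fun N => S N t)) - S N)); last exact: g2.
  apply/funext => N; apply: L2norm_eq => t tI.
  by rewrite !fctE SE.
Qed.

End trace.

Lemma L2_N tau f : L2 tau f -> L2 tau (- f).
Proof.
rewrite /L2/= => Lf.
have -> : (- f) \_ (`]0, tau[ : set R) = - (f \_ (`]0, tau[ : set R)).
  by apply/funext => x; rewrite /= !fctE !patchE; case: ifPn => //; rewrite oppr0.
exact: (@Lfun_oppr_closed _ _ _ (@lebesgue_measure R) _ _ Lf).
Qed.

(** Expresses the observation through partial sums, so that it does not depend on which
    representative [g] of the trace was chosen. *)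
Lemma trace_pairing tau w g f (M : R) : 0 <= tau -> is_trace_xx tau w g ->
  continuous f -> (forall x, `|f x| <= M) ->
  \int[@lebesgue_measure R]_(t in `]0, tau[)
    ((- \sum_(1 <= n < N) n%:R ^+ 2 * phiN n (pi : R) * w t n) * f t)
  @[N --> \oo] --> \int[@lebesgue_measure R]_(t in `]0, tau[) (g t * f t).
Proof.
move=> tau0 [Lg LS Sg] cf fM.
set S := fun N t => - \sum_(1 <= n < N) n%:R ^+ 2 * phiN n (pi : R) * w t n in LS Sg *.
have M0 : 0 <= M by exact: le_trans (fM 0).
have C0 : 0 <= M * Num.sqrt tau by rewrite mulr_ge0// sqrtr_ge0.
have bnd N : `|\int[@lebesgue_measure R]_(t in `]0, tau[) (g t * f t) -
    \int[@lebesgue_measure R]_(t in `]0, tau[) (S N t * f t)| <=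
    L2norm tau (g - S N) * (M * Num.sqrt tau).
  have LgS : L2 tau (g - S N) by apply: L2_D; [exact: Lg|exact: (L2_N (LS N))].
  have [i1 _] := L2_pairing_bound tau0 Lg cf fM.
  have [i2 _] := L2_pairing_bound tau0 (LS N) cf fM.
  have [_ h] := L2_pairing_bound tau0 LgS cf fM.
  rewrite -RintegralB//; apply: le_trans h.
  rewrite le_eqVlt; apply/orP; left; apply/eqP; congr (`|_|).
  by apply: eq_Rintegral => t _; rewrite !fctE mulrBl.
apply/cvgrPdist_le => /= eps eps0.
have h : L2norm tau (g - S N) * (M * Num.sqrt tau) @[N --> \oo] --> (0 : R).
  by rewrite -(mul0r (M * Num.sqrt tau)); apply: cvgMl.
have /cvgrPdist_le /(_ _ eps0) := h.
apply: filterS => N; rewrite sub0r normrN => hN.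
by apply: le_trans (bnd N) _; exact: le_trans (ler_norm _) hN.
Qed.

End adjoint_problem.

(** * Weak solutions and their final state *)

Section dominated_coefficients.
Context {R : realType}.
Implicit Types (p k K T t : R) (a q d : nat -> R).

Lemma psumX_dom p a q k K : (forall n, (0 < n)%N -> n%:R `^ p * `|a n| <= k * `|q n|) ->
  (forall N, psumX 0 q N <= K) -> forall N, psumX p a N <= k ^+ 2 * K.
Proof.
move=> H HK N; apply: le_trans (_ : k ^+ 2 * psumX 0 q N <= _).
  by apply: psumX_shift => n n0; rewrite powRr0 mul1r; exact: H.
by rewrite ler_wpM2l ?sqr_ge0.
Qed.

Lemma XN0_dom p a q k K : a 0%N = 0 ->
  (forall n, (0 < n)%N -> n%:R `^ p * `|a n| <= k * `|q n|) ->
  (forall N, psumX 0 q N <= K) -> XN0 p a.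
Proof. by move=> a0 H HK; apply: XN0_intro a0 (psumX_dom H HK). Qed.

Lemma CX_dominated p T (u : R -> nat -> R) d K :
  (forall N, psumX p d N <= K) -> (forall t, u t 0%N = 0) ->
  (forall n, (0 < n)%N -> continuous (fun t => u t n)) ->
  (forall n t, (0 < n)%N -> t \in `[0, T] -> `|u t n| <= d n) ->
  CX p T u.
Proof.
move=> HK u0 cu ud t tI; split.
  apply: (@XN0_intro R p (u t) K) => // N; apply: le_trans (HK N).
  apply: psumX_mono => n n0; apply: le_trans (ud n t n0 tI) _; exact: ler_norm.
apply: (@normX_dominated_cvg0 R p (fun n => 2 * d n) (2 ^+ 2 * K)).
- by move=> N; rewrite psumX_Z ler_wpM2l.
- rewrite near_withinE; apply: nearW => s sI n n0.
  rewrite !fctE (le_trans (ler_normB _ _))//.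
  have h1 := ud n s n0 sI; have h2 := ud n t n0 tI.
  by apply: le_trans (ler_norm _); lra.
- move=> n n0; apply: cvg_within_filter.
  have h : (fun s => u s n - u t n) @ t --> u t n - u t n.
    by apply: cvgB; [exact: (cu n n0 t)|exact: cvg_cst].
  by rewrite subrr in h.
Qed.

Lemma lipschitz_segment (g dg : R -> R) T (B : R) :
  (forall t, is_derive t (1 : R) g (dg t)) ->
  (forall t, t \in `[0, T] -> `|dg t| <= B) ->
  forall s t, s \in `[0, T] -> t \in `[0, T] -> `|g s - g t| <= B * `|s - t|.
Proof.
move=> Dg dgB s t; wlog st : s t / s <= t.
  move=> H sI tI; have [st|/ltW ts] := leP s t; first exact: H.
  by rewrite distrC [`|s - t|]distrC; exact: H.
rewrite !in_itv/= => /andP[s0 sT] /andP[t0 tT].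
have [|c] := @MVT_segment R g dg s t st (fun z _ => Dg z).
  exact/continuous_subspaceT/(is_derive_continuous Dg).
rewrite in_itv/= => /andP[sc ct] E.
rewrite distrC E normrM [`|s - t|]distrC ler_wpM2r// dgB// in_itv/=.
by rewrite (le_trans s0)//= (le_trans ct).
Qed.

(** By the mean value theorem the bound [d] on the velocities also bounds every difference quotient,
    as domination requires. *)
Lemma is_derivX_dominated p T (u ut : R -> nat -> R) d K :
  (forall N, psumX p d N <= K) -> (forall t, u t 0%N = 0) ->
  (forall n t, (0 < n)%N -> is_derive t (1 : R) (fun s => u s n) (ut t n)) ->
  (forall n t, (0 < n)%N -> t \in `[0, T] -> `|ut t n| <= d n) ->
  is_derivX p T u ut.
Proof.
move=> HK u0 du utd t tI.
apply: (@normX_dominated_cvg0 R p (fun n => 2 * d n) (2 ^+ 2 * K)).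
- by move=> N; rewrite psumX_Z ler_wpM2l.
- rewrite near_withinE near_withinE; apply: nearW => s st sI n n0.
  rewrite /= !fctE (le_trans (ler_normB _ _))//.
  have h2 := utd n t n0 tI.
  have h1 : `|(s - t)^-1 * (u s n - u t n)| <= d n.
    rewrite normrM normfV mulrC ler_pdivrMr ?normr_gt0 ?subr_eq0//.
    exact: (lipschitz_segment (fun z => du n z n0) (fun z zI => utd n z n0 zI)).
  by apply: le_trans (ler_norm _); rewrite /GRing.scale/=; lra.
- move=> n n0; have h := is_derive_deriv_on (tau := T) (fun z => du n z n0) tI.
  have h2 : (s - t)^-1 * (u s n - u t n) - ut t n @[s --> within `[0, T] t^'] -->
      ut t n - ut t n by apply: cvgB; [exact: h|exact: cvg_cst].
  by rewrite subrr in h2.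
Qed.

End dominated_coefficients.

(** * Construction of weak solutions for Lipschitz controls *)

Section weak_solutions.
Context {R : realType} (alpha rho : R).
Hypotheses (halpha : 0 < alpha < 1) (hrho : 0 < rho < 2).
Local Notation sg := (sg alpha rho).
Local Notation om := (om alpha rho).
Local Notation vel := (vel alpha rho).
Let c0 : R := 1 - rho ^+ 2 / 4.
Let c00 : 0 < c0. Proof. exact: gapconst_gt0. Qed.

Let natpow (n : nat) : n%:R `^ 2 = n%:R ^+ 2 :> R.
Proof. by rewrite powR_mulrn. Qed.

Let natpowN (n : nat) : n%:R `^ (- 2) = (n%:R ^+ 2)^-1 :> R.
Proof. by rewrite powRN natpow. Qed.

Variables (T L M : R) (f : R -> R) (u0 u1 : nat -> R).
Hypotheses (hT : 0 < T) (LF : forall x y, `|f x - f y| <= L * `|x - y|)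
  (MF : forall x, `|f x| <= M) (Xu0 : XN0 0 u0) (Xu1 : XN0 (-2) u1).

Let cf : continuous f. Proof. exact: lipschitz_cont LF. Qed.

(** The sign of [u0] turns the adjoint formula into the forward one, (u1 + sg u0) / om. *)
Let y0 := vel (fun k => - u0 k) u1.

Let y0E n : (0 < n)%N -> om n * y0 n = u1 n + sg n * u0 n.
Proof. by move=> n0; rewrite /y0 om_vel// mulrN opprK. Qed.

Let y0_le n : (0 < n)%N ->
  `|y0 n| <= c0^-1 * ((n%:R ^+ 2)^-1 * `|u1 n| + `|u0 n|).
Proof.
move=> n0; have := vel_le halpha hrho (fun k => - u0 k) u1 n0.
have n2 : 0 < n%:R ^+ 2 :> R by rewrite exprn_gt0// ltr0n.
rewrite normrN -/y0 -ler_pdivlMl// => h; apply: le_trans h _.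
rewrite le_eqVlt; apply/orP; left; apply/eqP; rewrite -/c0.
by field; rewrite !lt0r_neq0// ltr0n.
Qed.

Let kk n : R := kap n / om n.

(** The bound of [forced_mode_bound]. As [kk] is bounded and [1 / om n] is of order n^(-2), the
    forced part is square summable. *)
Let d n : R := `|u0 n| + `|y0 n| + 2 * (`|kk n| * (pi / om n * (T * L + 2 * M))).

Let d_ge0 n : (0 < n)%N -> 0 <= d n.
Proof.
move=> n0; have L0 : 0 <= L.
  by have := le_trans (normr_ge0 _) (LF 1 0); rewrite subr0 normr1 mulr1.
have M0 : 0 <= M by exact: le_trans (MF 0).
rewrite /d !addr_ge0// !mulr_ge0 ?invr_ge0 ?pi_ge0 ?(ltW (om_gt0 _ _ _))//.
by rewrite addr_ge0 ?mulr_ge0 ?(ltW hT).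
Qed.

Let d_sum : exists K, forall N, psumX 0 d N <= K.
Proof.
have L0 : 0 <= L.
  by have := le_trans (normr_ge0 _) (LF 1 0); rewrite subr0 normr1 mulr1.
have M0 : 0 <= M by exact: le_trans (MF 0).
pose B := T * L + 2 * M; have B0 : 0 <= B by rewrite addr_ge0 ?mulr_ge0 ?(ltW hT).
pose q : R := Num.sqrt (2 / pi).
have q0 : 0 <= q by exact: sqrtr_ge0.
pose K2 := 2 * (q / c0 * (pi / c0 * B)).
have K20 : 0 <= K2.
  by rewrite !mulr_ge0 ?invr_ge0 ?(ltW c00) ?pi_ge0.
pose a1 n := (1 + c0^-1) * u0 n.
pose a2 n := c0^-1 * ((n%:R ^+ 2)^-1 * u1 n).
pose a3 n : R := K2 * (n%:R ^+ 2)^-1.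
have h1 N : psumX 0 a1 N <= (1 + c0^-1) ^+ 2 * normX 0 u0 ^+ 2.
  by rewrite psumX_Z ler_wpM2l ?sqr_ge0// psumX_le_normX.
have h2 N : psumX 0 a2 N <= c0^-1 ^+ 2 * normX (-2) u1 ^+ 2.
  rewrite psumX_Z ler_wpM2l ?sqr_ge0//; apply: le_trans (psumX_le_normX N Xu1).
  have := @psumX_shift R 0 (-2) (fun n => (n%:R ^+ 2)^-1 * u1 n) u1 1 N.
  rewrite expr1n mul1r; apply=> n n0.
  by rewrite powRr0 !mul1r natpowN normrM ger0_norm// invr_ge0 exprn_ge0.
have h3 N : psumX 0 a3 N <= K2 ^+ 2 * 2.
  rewrite psumX_Z ler_wpM2l ?sqr_ge0//; apply: le_trans (sum_inv_sqr_le N).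
  rewrite /psumX big_nat [leRHS]big_nat; apply: ler_sum => n /andP[n0 _].
  rewrite mulr0 powRr0 mul1r ger0_norm ?invr_ge0 ?exprn_ge0//.
  have n1 : 1 <= n%:R ^+ 2 :> R by rewrite exprn_ege1// ler1n.
  rewrite expr2 ler_piMl ?invr_ge0 ?exprn_ge0// invf_le1// (lt_le_trans ltr01)//.
have dle n : (0 < n)%N -> `|d n| <= `| (`|a1 n|) + (`|a2 n| + `|a3 n|) |.
  move=> n0; rewrite (ger0_norm (d_ge0 n0)).
  apply: le_trans (ler_norm _).
  have n2 : 0 < n%:R ^+ 2 :> R by rewrite exprn_gt0// ltr0n.
  have o0 := om_gt0 halpha hrho n0.
  have k1 : `|kk n| <= q / c0.
    rewrite /kk normrM norm_kap// [`|_^-1|]ger0_norm ?invr_ge0 ?(ltW o0)//.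
    rewrite ler_pdivrMr// -/q (_ : q / c0 * om n = om n / c0 * q); last by ring.
    by rewrite ler_wpM2r// ler_pdivlMr// mulrC; exact: om_ge.
  have k2 : pi / om n * B <= (n%:R ^+ 2)^-1 * (pi / c0 * B).
    have cn : 0 < c0 * n%:R ^+ 2 by exact: mulr_gt0.
    have o1 : (om n)^-1 <= (c0 * n%:R ^+ 2)^-1.
      by rewrite lef_pV2 ?posrE//; exact: om_ge.
    rewrite [leRHS](_ : _ = pi * (c0 * n%:R ^+ 2)^-1 * B); last first.
      by move: (n%:R ^+ 2 : R) => x; rewrite (invfM c0 x); ring.
    by rewrite ler_wpM2r// ler_wpM2l ?pi_ge0.
  have k3 : 2 * (`|kk n| * (pi / om n * B)) <= `|a3 n|.
    have a30 : 0 <= a3 n by rewrite mulr_ge0// invr_ge0 exprn_ge0.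
    rewrite (ger0_norm a30) (_ : a3 n =
      2 * (q / c0 * ((n%:R ^+ 2)^-1 * (pi / c0 * B)))); last by rewrite /a3 /K2; ring.
    rewrite ler_wpM2l//; apply: ler_pM => //.
    by rewrite mulr_ge0// divr_ge0 ?pi_ge0// ltW.
  have k4 : `|a1 n| = `|u0 n| + c0^-1 * `|u0 n|.
    by rewrite /a1 normrM ger0_norm ?addr_ge0 ?invr_ge0 ?(ltW c00)// mulrDl mul1r.
  have k5 : `|a2 n| = c0^-1 * ((n%:R ^+ 2)^-1 * `|u1 n|).
    have i1 : 0 <= c0^-1 by rewrite invr_ge0 ltW.
    have i2 : 0 <= (n%:R ^+ 2)^-1 :> R by rewrite invr_ge0 ltW.
    by rewrite /a2 (normrM c0^-1) (normrM (_ ^+ 2)^-1) (ger0_norm i1) (ger0_norm i2).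
  have := y0_le n0; rewrite k4 k5 /d -/B mulrDr; lra.
exists (2 * ((1 + c0^-1) ^+ 2 * normX 0 u0 ^+ 2 +
  2 * (c0^-1 ^+ 2 * normX (-2) u1 ^+ 2 + K2 ^+ 2 * 2))) => N.
apply: le_trans (psumX_mono 0 N dle) _.
apply: le_trans (psumX_D _ _ _ _) _; rewrite ler_wpM2l// lerD//.
  by rewrite psumX_norm.
apply: le_trans (psumX_D _ _ _ _) _; rewrite ler_wpM2l// lerD//.
  by rewrite psumX_norm.
by rewrite psumX_norm.
Qed.

(** The criterion for a zero final state is proved together with existence because it is read off
    the explicit formula: the stated moments make both undamped amplitudes vanish in every mode. *)
Lemma weak_solution_exists : exists u ut : R -> nat -> R,
  weak_solution alpha rho T u0 u1 f u ut /\
  ((forall n, (0 < n)%N ->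
     kap n * itg 0 T (fun t => f t * esin (sg n) (om n) t) = om n * u0 n /\
     kap n * itg 0 T (fun t => f t * ecos (sg n) (om n) t) =
       - (u1 n + sg n * u0 n)) -> u T = 0 /\ ut T = 0).
Proof.
have [n|xy Hxy] := @choice nat ((R -> R) * (R -> R))%type (fun n xy =>
  [/\ xy.1 0 = u0 n /\ xy.2 0 = y0 n,
    forall t, is_derive t (1 : R) xy.1 (- sg n * xy.1 t + om n * xy.2 t),
    forall t, is_derive t (1 : R) xy.2 (- sg n * xy.2 t - om n * xy.1 t + kk n * f t) &
    forall t, 0 <= t ->
      let S := itg 0 t (fun z => f z * esin (sg n) (om n) z) in
      let C := itg 0 t (fun z => f z * ecos (sg n) (om n) z) in
      xy.1 t = (u0 n - kk n * S) * ecos (- sg n) (om n) t +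
               (y0 n + kk n * C) * esin (- sg n) (om n) t /\
      xy.2 t = (y0 n + kk n * C) * ecos (- sg n) (om n) t -
               (u0 n - kk n * S) * esin (- sg n) (om n) t]).
  have [x [y H]] := forced_mode (sg n) (om n) (kk n) (u0 n) (y0 n) cf.
  by exists (x, y).
pose x n := (xy n).1; pose y n := (xy n).2.
have x0 n : x n 0 = u0 n by case: (Hxy n) => -[].
have y00 n : y n 0 = y0 n by case: (Hxy n) => -[].
have dx n t : is_derive t (1 : R) (x n) (- sg n * x n t + om n * y n t).
  by case: (Hxy n).
have dy n t : is_derive t (1 : R) (y n) (- sg n * y n t - om n * x n t + kk n * f t).
  by case: (Hxy n).
have Exy n := let: And4 _ _ _ H := Hxy n in H.
have bxy n t : (0 < n)%N -> t \in `[0, T] -> `|x n t| <= d n /\ `|y n t| <= d n.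
  move=> n0 tI; have t0 : 0 <= t by move: tI; rewrite in_itv/= => /andP[].
  have [ex ey] := Exy n t t0; rewrite /x /y ex ey.
  have tI' : 0 <= t <= T by move: tI; rewrite in_itv.
  exact: (@forced_mode_bound R (sg n) (om n) (kk n) (u0 n) (y0 n) L M f t T
    (sg_ge0 alpha hrho n) (om_gt0 halpha hrho n0) LF MF tI').
pose u t n := if n is 0%N then 0 else x n t.
pose ut t n := if n is 0%N then 0 else - sg n * x n t + om n * y n t.
have uS t n : (0 < n)%N -> u t n = x n t by case: n.
have utS t n : (0 < n)%N -> ut t n = - sg n * x n t + om n * y n t by case: n.
have [K HK] := d_sum.
(* The velocity [- sg n * x + om n * y] costs a factor 2 n^2, which the weight of X^(-2)
   compensates. *)
pose d2 (n : nat) : R := 2 * (n%:R ^+ 2 * d n).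
have HK2 : forall N, psumX (-2) d2 N <= 2 ^+ 2 * K.
  apply: (@psumX_dom R (-2) d2 d 2 K) => [n n0|]; last exact: HK.
  have n2 : n%:R ^+ 2 != 0 :> R by rewrite expf_neq0// pnatr_eq0 -lt0n.
  rewrite natpowN /d2 normrM (normrM (_ ^+ 2)) (@ger0_norm _ 2)//.
  by rewrite (@ger0_norm _ (n%:R ^+ 2)) ?exprn_ge0// mulrCA mulKf.
have but n t : (0 < n)%N -> t \in `[0, T] -> `|ut t n| <= d2 n.
  move=> n0 tI; rewrite utS//; have [bx by_] := bxy n t n0 tI.
  rewrite (le_trans (ler_normD _ _))// (normrM (- _)) (normrM (om n)) normrN.
  rewrite (ger0_norm (sg_ge0 _ hrho n)) (ger0_norm (ltW (om_gt0 halpha hrho n0))).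
  rewrite /d2 (_ : 2 * _ = n%:R ^+ 2 * d n + n%:R ^+ 2 * d n); last by ring.
  apply: lerD; apply: ler_pM => //; first exact: sg_ge0.
  - exact: sg_le.
  - exact/ltW/om_gt0.
  - exact: om_le.
have dut n t : (0 < n)%N -> is_derive t (1 : R) (fun s => u s n) (ut t n).
  by case: n => // n _; exact: dx.
have CXu : CX 0 T u.
  apply: (@CX_dominated R 0 T u d K HK) => //.
  - by move=> n n0; exact: (is_derive_continuous (fun t => dut n t n0)).
  - by move=> n t n0 tI; rewrite uS//; case: (bxy n t n0 tI).
have CXut : CX (-2) T ut.
  apply: (@CX_dominated R (-2) T ut d2 _ HK2) => //.
  case=> // n _; exact: (contD (@contZ R (- sg n.+1) _ (is_derive_continuous (dx n.+1)))
    (@contZ R (om n.+1) _ (is_derive_continuous (dy n.+1)))).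
exists u, ut; split; last first.
  move=> fin; have T0 := ltW hT.
  have xyT n : (0 < n)%N -> x n T = 0 /\ y n T = 0.
    move=> n0; have [ex ey] := Exy n T T0; have [fs fc] := fin n n0.
    have o0 : om n != 0 by rewrite lt0r_neq0// om_gt0.
    have e1 : u0 n - kk n * itg 0 T (fun z => f z * esin (sg n) (om n) z) = 0.
      by rewrite /kk mulrAC fs mulrAC divff// mul1r subrr.
    have e2 : y0 n + kk n * itg 0 T (fun z => f z * ecos (sg n) (om n) z) = 0.
      by rewrite /kk mulrAC fc -y0E// mulNr mulrAC divff// mul1r subrr.
    by rewrite /x /y ex ey e1 e2 !mul0r subrr addr0.
  split; apply/funext => -[|n] //=; have [ex ey] := xyT n.+1 isT.
    by rewrite /u ex.
  by rewrite /ut ex ey !mulr0 addr0.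
split => //.
- split=> //; apply: (@is_derivX_dominated R (-2) T u ut d2 _ HK2) => //.
- by apply/funext => -[|n]; [case: Xu0|rewrite /u x0].
- apply/funext => -[|n]; first by case: Xu1.
  by rewrite /ut x0 y00 y0E// mulNr addrCA addNr addr0.
move=> tau /andP[tau0 tauT] w0 w1 Xw0 Xw1 w wt Hw.
have [g Hg] := trace_exists halpha hrho (ltW tau0) Xw0 Xw1 Hw.
exists g => //.
pose v0 := vel w0 w1.
pose ww n t := wave alpha rho tau w0 v0 n t.
pose vv n t := wave alpha rho tau v0 (fun k => - w0 k) n t.
have z0 : (0 : R) \in `[0, tau] by rewrite in_itv/= lexx ltW.
have [w00 wt00] : w 0 0%N = 0 /\ wt 0 0%N = 0 by case: Hw => /(_ 0 z0).
have wE n : (0 < n)%N -> w 0 n = ww n 0 /\ wt 0 n = sg n * ww n 0 + om n * vv n 0.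
  by move=> n0; exact: adjoint_explicit (ltW tau0) Hw n0 z0.
have dampE (a b : nat -> R) n :
    (b - rho *: ANpow alpha a) n = b n - 2 * sg n * a n.
  by rewrite !fctE /ANpow /GRing.scale/= /sg; field.
pose q (n : nat) : R := n%:R ^+ 2 * `|w0 n| + `|w1 n|.
have q0 n : 0 <= q n by rewrite addr_ge0// mulr_ge0// exprn_ge0.
have n20 (n : nat) : 0 <= n%:R ^+ 2 :> R by rewrite exprn_ge0.
have [KQ HKQ] : exists KQ, forall N, psumX 0 q N <= KQ.
  exists (2 * (normX 2 w0 ^+ 2 + normX 0 w1 ^+ 2)) => N.
  apply: le_trans (psumX_D _ _ _ _) _; rewrite ler_wpM2l// lerD//.
    apply: le_trans (psumX_le_normX N Xw0).
    have := @psumX_shift R 0 2 (fun n => n%:R ^+ 2 * `|w0 n|) w0 1 N.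
    rewrite expr1n mul1r; apply=> n n0.
    by rewrite powRr0 !mul1r natpow normrM normr_id ger0_norm.
  by rewrite psumX_norm; exact: psumX_le_normX.
pose C1 : R := 1 + c0^-1.
have C10 : 0 <= C1 by rewrite addr_ge0// invr_ge0 ltW.
have amp n : (0 < n)%N -> n%:R ^+ 2 * (`|w0 n| + `|v0 n|) <= C1 * q n.
  move=> n0; have h := vel_le halpha hrho w0 w1 n0.
  rewrite mulrDr /C1 mulrDl mul1r lerD//; first by rewrite lerDl.
  by rewrite /q addrC.
have wvle n : (0 < n)%N -> `|ww n 0| <= `|w0 n| + `|v0 n| /\
    `|vv n 0| <= `|w0 n| + `|v0 n|.
  move=> n0; have e1 : expR (sg n * (0 - tau)) <= 1.
    by rewrite -expR0 ler_expR mulr_ge0_le0 ?sg_ge0// sub0r oppr_le0 ltW.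
  split; apply: le_trans (wave_le _ _ _ _ _ _ _) _.
    by rewrite ler_piMr// addr_ge0.
  by rewrite normrN addrC ler_piMr// addr_ge0.
have sgle n (n0 : (0 < n)%N) := sg_le halpha hrho n0.
have omle n (n0 : (0 < n)%N) := om_le halpha hrho n0.
have X1 : XN0 0 (w1 - rho *: ANpow alpha w0).
  apply: (@XN0_dom R 0 _ q 2 KQ) => //.
    rewrite dampE; case: Xw1 => -> _; case: Xw0 => -> _.
    by rewrite mulr0 subrr.
  move=> n n0; rewrite powRr0 mul1r dampE (ger0_norm (q0 n)).
  have s2 : 0 <= 2 * sg n by rewrite mulr_ge0// sg_ge0.
  apply: le_trans (ler_normB _ _) _; rewrite (normrM (2 * sg n)) (ger0_norm s2).
  have := ler_wpM2r (normr_ge0 (w0 n)) (sgle n n0); have := normr_ge0 (w1 n).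
  by rewrite /q; lra.
have X2 : XN0 2 (w 0).
  apply: (@XN0_dom R 2 _ q C1 KQ) => // n n0.
  rewrite natpow (ger0_norm (q0 n)); have [-> _] := wE n n0.
  by apply: le_trans (amp n n0); rewrite ler_wpM2l//; case: (wvle n n0).
have X3 : XN0 0 (wt 0 - rho *: ANpow alpha (w 0)).
  apply: (@XN0_dom R 0 _ q (2 * C1) KQ) => //.
    by rewrite dampE w00 wt00 mulr0 subrr.
  move=> n n0; rewrite powRr0 mul1r dampE (ger0_norm (q0 n)).
  have [-> ->] := wE n n0; have [h1 h2] := wvle n n0.
  rewrite (_ : _ - _ = om n * vv n 0 - sg n * ww n 0); last by ring.
  apply: le_trans (ler_normB _ _) _; rewrite (normrM (om n)) (normrM (sg n)).
  rewrite (ger0_norm (sg_ge0 _ hrho n)) (ger0_norm (ltW (om_gt0 halpha hrho n0))).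
  rewrite -mulrA (_ : 2 * _ = C1 * q n + C1 * q n); last by ring.
  by apply: lerD; apply: le_trans (amp n n0); apply: ler_pM => //;
    [exact/ltW/om_gt0|exact: omle|exact: sg_ge0|exact: sgle].
have tauI : tau \in `[0, T] by rewrite in_itv/= (ltW tau0).
have [Xut _] := CXut tau tauI; have [Xu _] := CXu tau tauI.
have Xu' : XN0 (- 0) (u tau) by rewrite oppr0.
have Xu0' : XN0 (- 0) u0 by rewrite oppr0.
have cA := pairing_cvg X1 Xu'; have cB := pairing_cvg Xw0 Xut.
have cC := pairing_cvg X3 Xu0'; have cD := pairing_cvg X2 Xu1.
have cE := trace_pairing (ltW tau0) Hg cf MF.
have cw n : continuous (ww n) by exact: cont_wave.
(* The weak identity truncated at [N]. By [duality_mode] each mode contributes exactly 0, so only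
   the limit has to be justified. *)
pose E (N : nat) : R :=
  (\sum_(1 <= n < N) (w1 - rho *: ANpow alpha w0) n * u tau n
   - \sum_(1 <= n < N) w0 n * ut tau n
   - \sum_(1 <= n < N) (wt 0 - rho *: ANpow alpha (w 0)) n * u0 n
   + \sum_(1 <= n < N) w 0 n * u1 n)
  - \int[@lebesgue_measure R]_(t in `]0, tau[)
      ((- \sum_(1 <= n < N) n%:R ^+ 2 * phiN n (pi : R) * w t n) * f t).
have lim : E @ \oo --> pairing (w1 - rho *: ANpow alpha w0) (u tau)
    - pairing w0 (ut tau) - pairing (wt 0 - rho *: ANpow alpha (w 0)) u0
    + pairing (w 0) u1
    - \int[@lebesgue_measure R]_(t in `]0, tau[) (g t * f t).
  exact: (cvgB (cvgD (cvgB (cvgB cA cB) cC) cD) cE).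
have ident N : E N = 0.
  rewrite /E.
  have -> : \int[@lebesgue_measure R]_(t in `]0, tau[)
      ((- \sum_(1 <= n < N) n%:R ^+ 2 * phiN n (pi : R) * w t n) * f t) =
      - \sum_(1 <= n < N) kap n * itg 0 tau (fun t => ww n t * f t).
    transitivity (\int[@lebesgue_measure R]_(t in `]0, tau[)
        (\sum_(1 <= n < N) - kap n * (ww n t * f t))).
      apply: eq_Rintegral => t; rewrite inE/= => tI.
      rewrite mulNr mulr_suml -sumrN; apply: eq_big_nat => n /andP[n0 _].
      have [|-> _] := @adjoint_explicit R alpha rho halpha hrho tau w0 w1 w wt n t (ltW tau0) Hw n0.
        by move: tI; rewrite !in_itv/= => /andP[/ltW-> /ltW->].
      by rewrite /ww /v0 /kap; ring.
    have cwf n := contM (cw n) cf.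
    rewrite Rintegral_oo_cc; last first.
      by apply: cont_sum => n; apply: contZ; exact: cwf.
    rewrite itg_sum; last by move=> n; apply: contZ; exact: cwf.
    rewrite -sumrN; apply: eq_bigr => n _; rewrite (itgZ _ _ _ (cwf n)).
    by rewrite mulNr.
  rewrite opprK -!sumrN -!big_split/= big_nat big1// => n /andP[n0 _].
  rewrite !dampE uS// utS//.
  have [-> ->] := wE n n0.
  have := duality_mode (ltW tau0) cf (is_derive_wave alpha rho tau w0 v0 n)
    (is_derive_wave_vel alpha rho tau w0 v0 n) (dx n) (dy n).
  rewrite !wave_tau x0 y00 -/(ww n 0) -/(vv n 0) -/(ww n) => dual.
  have o0 : om n != 0 by rewrite lt0r_neq0// om_gt0.
  have e1 : w1 n = om n * v0 n + sg n * w0 n by rewrite om_vel// subrK.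
  have e2 : u1 n = om n * y0 n - sg n * u0 n by rewrite y0E// addrK.
  have e3 : kap n = om n * kk n by rewrite /kk mulrC divfK.
  move/(congr1 -%R): dual; rewrite opprK => dual.
  rewrite e1 e2 e3 -[om n * kk n * _]mulrA -dual; ring.
rewrite -(cvg_lim (@Rhausdorff R) lim) (_ : E = cst 0) ?lim_cst//.
by apply/funext => N; exact: ident.
Qed.

End weak_solutions.

(** * Uniqueness of the final state *)

Section single_mode_tests.
Context {R : realType}.

Definition delta (n : nat) (a : R) (k : nat) : R := if k == n then a else 0.

Lemma pairing_support (n : nat) (a b : nat -> R) : (0 < n)%N ->
  (forall k, k != n -> a k = 0) -> pairing a b = a n * b n.
Proof.
move=> n0 a0; apply: (cvg_lim (@Rhausdorff R)).
apply: cvg_near_cst; near=> N.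
have nN : (n < N)%N by near: N; exact: nbhs_infty_gt.
rewrite (bigD1_seq n) ?mem_index_iota ?n0 ?iota_uniq//=.
by rewrite big1 ?addr0// => k kn; rewrite a0// mul0r.
Unshelve. all: by end_near. Qed.

Lemma XN0_delta (p : R) n a : (0 < n)%N -> XN0 p (delta n a).
Proof.
move=> n0; apply: (@XN0_intro R p _ (n%:R `^ (2 * p) * `|a| ^+ 2)).
  by rewrite /delta; case: n n0.
move=> N; have [nN|Nn] := ltnP n N.
  rewrite /psumX (bigD1_seq n) ?mem_index_iota ?n0 ?iota_uniq//=.
  rewrite big1 ?addr0; first by rewrite /delta eqxx.
  by move=> k /negbTE kn; rewrite /delta kn normr0 expr0n mulr0.
rewrite /psumX big_nat big1 ?mulr_ge0 ?powR_ge0 ?exprn_ge0// => k /andP[_ kN].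
by rewrite /delta ltn_eqF ?normr0 ?expr0n ?mulr0// (leq_trans kN).
Qed.

End single_mode_tests.

Section final_state.
Context {R : realType} (alpha rho : R).
Hypotheses (halpha : 0 < alpha < 1) (hrho : 0 < rho < 2).
Variables (T M : R) (f : R -> R) (u0 u1 : nat -> R).
Hypotheses (hT : 0 < T) (cf : continuous f) (MF : forall x, `|f x| <= M).

Lemma weak_solution_final_unique (u ut v vt : R -> nat -> R) :
  weak_solution alpha rho T u0 u1 f u ut ->
  weak_solution alpha rho T u0 u1 f v vt -> u T = v T /\ ut T = vt T.
Proof.
move=> [CXu [CXut _] _ _ Hu] [CXv [CXvt _] _ _ Hv].
have TI : T \in `[0, T] by rewrite in_itv/= lexx ltW.
have TT : 0 < T <= T by rewrite hT lexx.
have key n a b : (0 < n)%N ->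
    (b - 2 * sg alpha rho n * a) * u T n - a * ut T n =
    (b - 2 * sg alpha rho n * a) * v T n - a * vt T n.
  move=> n0; pose w0 := delta n a; pose w1 := delta n b.
  have Xw0 : XN0 2 w0 by exact: XN0_delta.
  have Xw1 : XN0 0 w1 by exact: XN0_delta.
  have [w [wt Hw]] := adjoint_exists halpha hrho T w0 w1.
  have [g1 tr1 e1] := Hu T TT w0 w1 Xw0 Xw1 w wt Hw.
  have [g2 tr2 e2] := Hv T TT w0 w1 Xw0 Xw1 w wt Hw.
  (* The two weak identities may come with different traces [g1] and [g2], but both integrals are
     limits of the same truncated ones. *)
  have E : \int[@lebesgue_measure R]_(t in `]0, T[) (g1 t * f t) =
           \int[@lebesgue_measure R]_(t in `]0, T[) (g2 t * f t).
    apply: cvg_unique (trace_pairing (ltW hT) tr1 cf MF)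
      (trace_pairing (ltW hT) tr2 cf MF); exact: Rhausdorff.
  have pA (z : nat -> R) : pairing (w1 - rho *: ANpow alpha w0) z =
      (b - 2 * sg alpha rho n * a) * z n.
    have dampE k : (w1 - rho *: ANpow alpha w0) k = w1 k - 2 * sg alpha rho k * w0 k.
      by rewrite !fctE /ANpow /GRing.scale/= /sg; field.
    rewrite (pairing_support _ n0).
      by rewrite dampE /w0 /w1 /delta eqxx.
    by move=> k /negbTE kn; rewrite dampE /w0 /w1 /delta kn mulr0 subrr.
  have pB (z : nat -> R) : pairing w0 z = a * z n.
    rewrite (pairing_support _ n0); first by rewrite /w0 /delta eqxx.
    by move=> k /negbTE kn; rewrite /w0 /delta kn.
  move: e1 e2; rewrite !pA !pB E => e1 e2.
  by move: e1; rewrite {1}e2; lra.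
have [[u00 _] _] := CXu T TI; have [[v00 _] _] := CXv T TI.
have [[ut00 _] _] := CXut T TI; have [[vt00 _] _] := CXvt T TI.
(* The terminal data (0, 1) isolate the displacement, and (1, 2 sg) the velocity. *)
split; apply/funext => -[|n]; rewrite ?u00 ?v00 ?ut00 ?vt00//.
  by have := key n.+1 0 1 isT; rewrite !mulr0 !mul0r !subr0 !mul1r.
have := key n.+1 1 (2 * sg alpha rho n.+1) isT.
by rewrite mulr1 subrr !mul0r !sub0r !mul1r => /oppr_inj.
Qed.

End final_state.

(** * Null controllability and the cost of the control *)

Unset Implicit Arguments.

Theorem theorem5 (R : realType) (alpha rho T : R)
    (halpha : 0 < alpha < 1) (hrho : 0 < rho < 2) (hT : 0 < T) :
  exists C : R,
    forall u0 u1 : nat -> R, XN0 0 u0 -> XN0 (-2) u1 ->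
    exists f : R -> R,
      [/\ L2 T f,
          exists u ut : R -> nat -> R, weak_solution alpha rho T u0 u1 f u ut,
          forall u ut : R -> nat -> R,
            weak_solution alpha rho T u0 u1 f u ut -> u T = 0 /\ ut T = 0 &
          L2norm T f <= C * (normX 0 u0 + normX (-2) u1)].
Proof.
have [C [C0 HC]] := moment_problem halpha hrho hT.
pose q : R := Num.sqrt (2 / pi).
have q0 : 0 < q by rewrite sqrtr_gt0 divr_gt0// pi_gt0.
(* The constant [C] of the moment problem, [q^-1] from dividing by [kap], and [sqrt T] from passing
   from the sup norm to the L2 norm. *)
exists (C * q^-1 * Num.sqrt T) => u0 u1 Xu0 Xu1.
pose D := q^-1 * (normX 0 u0 + normX (-2) u1).
have D0 : 0 <= D by rewrite mulr_ge0 ?invr_ge0 ?(ltW q0)// addr_ge0// normX_ge0.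
(* The moment conditions solved for the moments. In both numerators [sg], [om] and [u1] contribute
   at most order n^2, which [kap n] cancels, so the moments are bounded by [D]. *)
pose al n := - (u1 n + sg alpha rho n * u0 n) / kap n : R.
pose be n := om alpha rho n * u0 n / kap n : R.
have albe n : (0 < n)%N -> `|al n| <= D /\ `|be n| <= D.
  move=> n0; have n2 : 0 < n%:R ^+ 2 :> R by rewrite exprn_gt0// ltr0n.
  have k0 : 0 < n%:R ^+ 2 * q by rewrite mulr_gt0.
  have h0 : n%:R ^+ 2 * `|u0 n| <= n%:R ^+ 2 * normX 0 u0.
    have := coef_le_normX Xu0 n0; rewrite powRr0 mul1r => h.
    by rewrite ler_wpM2l// ltW.
  have h1 : `|u1 n| <= n%:R ^+ 2 * normX (-2) u1.
    have := coef_le_normX Xu1 n0; rewrite powRN powR_mulrn//.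
    by rewrite ler_pdivrMl.
  have hD : n%:R ^+ 2 * (normX 0 u0 + normX (-2) u1) = D * (n%:R ^+ 2 * q).
    rewrite /D; field; exact: lt0r_neq0.
  have s0 := sg_ge0 alpha hrho n; have s1 := sg_le halpha hrho n0.
  have o0 := om_gt0 halpha hrho n0; have o1 := om_le halpha hrho n0.
  have a0 := normr_ge0 (u0 n).
  have x0 := normX_ge0 0 u0; have x1 := normX_ge0 (-2) u1.
  split; rewrite normrM normfV norm_kap// ler_pdivrMr// -hD mulrDr.
    rewrite normrN (le_trans (ler_normD _ _))// addrC lerD//.
    rewrite normrM (ger0_norm s0); apply: le_trans h0.
    by rewrite ler_wpM2r.
  rewrite normrM (gtr0_norm o0).
  apply: le_trans (_ : n%:R ^+ 2 * `|u0 n| <= _); first by rewrite ler_wpM2r.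
  by apply: le_trans h0 _; rewrite lerDl mulr_ge0// ltW.
have [f [bf mf]] := HC D al be D0 albe.
have cf := bump_cont bf.
have [LF MF _ _] := bf.
have CD0 : 0 <= C * D by rewrite mulr_ge0.
have [L2f Nf] : L2 T f /\ L2norm T f <= C * D * Num.sqrt T.
  apply: L2_continuous => //; [exact: ltW|by rewrite mulr_ge0 ?sqrtr_ge0|].
  rewrite exprMn sqr_sqrtr ?(ltW hT)// -[X in _ * X](subr0 T).
  apply: le_trans (ler_norm _) _; apply: itg_norm_le; rewrite ?(ltW hT)//.
    by have := contM cf cf; under eq_fun do rewrite -expr2.
  by move=> x _; rewrite normrX lerXn2r ?nnegrE.
have [u [ut [Wu fin]]] := weak_solution_exists halpha hrho hT LF MF Xu0 Xu1.
have [uT utT] : u T = 0 /\ ut T = 0.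
  apply: fin => n n0; have [-> ->] := mf n n0.
  have k0 := @kap_neq0 R n n0.
  by rewrite /al /be; split; rewrite mulrC divfK.
exists f; split => //; first by exists u, ut.
- move=> v vt Wv.
  by have [-> ->] := weak_solution_final_unique halpha hrho hT cf MF Wv Wu.
- apply: le_trans Nf _; rewrite /D le_eqVlt; apply/orP; left; apply/eqP; ring.
Qed.
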